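(* Let $M$ be a closed connected manifold of dimension at least two with non-trivial first Betti number. Then for each integer $2\le l<\infty$ there exists a dense subset of $\mathcal G^l(M)$ such that for every Riemannian metric $g$ in this subset there exists an infinite-dimensional space (in the sense specified in the context) of magnetic fields $\sigma$ such that $(M,g,\sigma)$ is of geodesic type and, for each energy value $\kappa\in(0,\infty)$, the magnetic geodesic flow $\Phi^t_{g,\sigma}$ has at least one embedded periodic orbit of energy $\kappa$.
   Context: $\mathcal G^l(M)$ is the space of smooth Riemannian metrics on $M$ with the $C^l$-topology. A magnetic field is a closed two-form $\sigma$ on $M$. The Lorentz force $Y:TM\to TM$ is defined by $g_q(Y_qu,v)=\sigma_q(u,v)$; magnetic geodesics are the smooth curves with $\nabla_{\dot\gamma}\dot\gamma=Y_\gamma\dot\gamma$; $\Phi^t_{g,\sigma}$ is the corresponding flow on $TM$; the energy is $\frac12g(\dot\gamma,\dot\gamma)$. A periodic orbit is embedded if its projected loop in $M$ is embedded. $(M,g,\sigma)$ is of geodesic type if there is a smooth embedded loop $\gamma:\mathbb R/T\mathbb Z\to M$, $T>0$, that is a geodesic of $(M,g)$ with $\sigma_{\gamma(t)}(\dot\gamma(t),\cdot)=0$ for all $t$. ''Infinite-dimensional space'' means: such a $\sigma$ (with loop $\gamma$) exists, and $\sigma$ is prescribed only in a small neighbourhood of $\gamma$, being arbitrary outside. That is, for every (arbitrarily small) open neighbourhood $U$ of $\gamma$, every closed two-form $\sigma'$ on $M$ that equals $\sigma$ on $U$ also has the stated properties. *)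

(* Defs.v *)
From HB Require Import structures.
From mathcomp Require Import all_boot all_order all_algebra.
From mathcomp Require Import all_classical all_reals all_analysis.
From mathcomp Require Import freeg.
Import Order.TTheory GRing.Theory Num.Theory numFieldNormedType.Exports.

Set Implicit Arguments.
Unset Strict Implicit.
Unset Printing Implicit Defensive.

Local Open Scope classical_set_scope.
Local Open Scope ring_scope.

Section SmoothMaps.
Context {R : realType}.

(* Meant for open A; the spaces are finite dimensional in all uses. *)
Fixpoint is_Ck (V W : normedModType R) (k : nat) (A : set V) (f : V -> W) :
    Prop :=
  if k is k'.+1 then
    (forall x, A x -> differentiable f x) /\
    (forall v, is_Ck k' A (fun x => 'D_v f x))
  else {in A, continuous f}.

Definition smooth_on (V W : normedModType R) (A : set V) (f : V -> W) :=
  forall k, is_Ck k A f.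

Definition partial n (a : 'I_n) (f : 'rV[R]_n -> R) : 'rV[R]_n -> R :=
  fun x => 'D_(delta_mx 0 a) f x.

Definition partials n (s : seq 'I_n) (f : 'rV[R]_n -> R) : 'rV[R]_n -> R :=
  foldr (@partial n) f s.

End SmoothMaps.

Section FirstBetti.
Context {R : realType}.

Definition std_simplex q : set 'rV[R]_q.+1 :=
  [set x | (forall j, 0 <= x ord0 j) /\ \sum_j x ord0 j = 1].
Arguments std_simplex : clear implicits.

Definition face_row q (i : 'I_q.+2) (x : 'rV[R]_q.+1) : 'rV[R]_q.+2 :=
  \row_j oapp (x ord0) 0 (unlift i j).

Lemma face_row_simplex q (i : 'I_q.+2) (x : std_simplex q) :
  face_row i (set_val x) \in std_simplex q.+1.
Proof.
case: x => x xS; rewrite set_valE /=; have [x0 x1] := set_mem xS.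
apply/mem_set; split.
  by move=> j; rewrite mxE; case: unliftP => [k _|_] //=.
rewrite (bigD1_ord i) //= mxE unlift_none /= add0r -x1.
by apply: eq_bigr => j _; rewrite mxE liftK.
Qed.

Definition face q (i : 'I_q.+2) (x : std_simplex q) : std_simplex q.+1 :=
  exist (fun y => y \in std_simplex q.+1) _ (face_row_simplex i x).

Lemma continuous_row (T : topologicalType) q (f : T -> 'rV[R]_q) (x : T) :
  (forall j, {for x, continuous (fun y => f y ord0 j)}) ->
  {for x, continuous f}.
Proof.
move=> fc; apply/cvg_ballP => e e0.
have H j : \forall y \near x, ball (f x ord0 j) e (f y ord0 j).
  by move: (fc j) => /cvg_ballP; exact.
have {}H : \forall y \near x, forall j, ball (f x ord0 j) e (f y ord0 j) by exact: filter_forall.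
by apply: filterS H => y Hy; split=> // k j; rewrite (ord1 k); exact: Hy.
Qed.

Lemma face_continuous q (i : 'I_q.+2) : continuous (face i).
Proof.
apply: continuous_comp_initial => x.
rewrite (_ : _ \o _ = fun y : std_simplex q => face_row i (set_val y))//.
apply: continuous_row => j.
rewrite /face_row; case: (unliftP i j) => [k ->|->].
  rewrite (_ : (fun _ => _) = fun y : std_simplex q => set_val y ord0 k); last first.
    by apply/funext => y; rewrite mxE liftK.
  have /= := @continuous_comp _ _ _ set_val (fun z : 'rV[R]_q.+1 => z ord0 k) x.
  apply; first exact: initial_continuous.
  exact: coord_continuous.
rewrite (_ : (fun _ => _) = fun=> 0); first exact: cst_continuous.
by apply/funext => y; rewrite mxE unlift_none.
Qed.

HB.instance Definition _ q (i : 'I_q.+2) :=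
  isContinuous.Build _ _ (face i) (@face_continuous q i).

Variable M : topologicalType.

Definition singular_simplex q := continuousType (std_simplex q) M.

Definition chain q := {freeg (singular_simplex q) / int}.

Definition boundary q : chain q.+1 -> chain q :=
  fglift (fun s : singular_simplex q.+1 =>
    \sum_(i < q.+2) (-1) ^+ i *: (<< (s \o face i : singular_simplex q) >> : chain q)).

(* The rank of H_1(M; Z), as an extended real since it may be infinite for a
   general space. *)
Definition first_betti : \bar R :=
  ereal_sup [set k%:R%:E | k in [set k : nat |
    exists z : 'I_k -> chain 1,
      (forall i, boundary (z i) = 0) /\
      (forall a : 'I_k -> int,
        (exists d : chain 2, boundary d = \sum_i a i *: z i) ->
        forall i, a i = 0)]].

End FirstBetti.

Arguments first_betti R M : clear implicits.

(* An atlas need not be maximal: tensor fields and curves below are required to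
   be smooth and compatible in all of its charts, which determines them on the
   smooth structure it generates. *)
Record smooth_atlas (R : realType) (n : nat) (M : topologicalType) := SmoothAtlas {
  chart_index : Type;
  chart_dom : chart_index -> set M;
  chart : chart_index -> M -> 'rV[R]_n;
  chart_inv : chart_index -> 'rV[R]_n -> M;
  chart_dom_open : forall i, open (chart_dom i);
  chart_img_open : forall i, open (chart i @` chart_dom i);
  chartK : forall i, {in chart_dom i, cancel (chart i) (chart_inv i)};
  chart_continuous : forall i, {in chart_dom i, continuous (chart i)};
  chart_inv_continuous : forall i,
    {in chart i @` chart_dom i, continuous (chart_inv i)};
  chart_cover : forall p, exists i, chart_dom i p;
  transition_smooth : forall i j,
    smooth_on (chart i @` (chart_dom i `&` chart_dom j))
      (chart j \o chart_inv i) }.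

Section Geometry.
Context {R : realType} {n : nat} {M : topologicalType}.
Variable X : smooth_atlas R n M.
Local Notation chart := (@chart _ _ _ X).
Local Notation chart_inv := (@chart_inv _ _ _ X).
Local Notation dom := (@chart_dom _ _ _ X).

Definition chart_img i : set 'rV[R]_n := chart i @` dom i.

Definition transition i j : 'rV[R]_n -> 'rV[R]_n := chart j \o chart_inv i.

(* Tangent vectors at p are given by their row vector of components in each
   chart around p; a covariant 2-tensor field T by the Gram matrix of its
   components T_i(x)_ab = T(d_a, d_b) at the point with coordinates x in chart i.
   As 'J f x is the transposed Jacobian (it acts on row vectors), the
   transformation law below says T_i(u, v) = T_j(df u, df v) for the transition
   map f. Components are 0 off the image of the chart, so that a tensor field
   has exactly one family of components. *)
Record tensor2 := Tensor2 {
  comp :> chart_index X -> 'rV[R]_n -> 'M[R]_n;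
  comp_smooth : forall i a b, smooth_on (chart_img i) (fun x => comp i x a b : R^o);
  comp_transition : forall i j x, (chart i @` (dom i `&` dom j)) x ->
    comp i x = 'J (transition i j) x *m comp j (transition i j x)
                 *m ('J (transition i j) x)^T;
  comp_out : forall i x, ~ chart_img i x -> comp i x = 0 }.

Definition bilin (A : 'M[R]_n) (u v : 'rV[R]_n) : R := (u *m A *m v^T) ord0 ord0.

Record riem_metric := RiemMetric {
  metric_tensor :> tensor2;
  metric_sym : forall i x, (metric_tensor i x)^T = metric_tensor i x;
  metric_pos : forall i x, chart_img i x ->
    forall v, v != 0 -> 0 < bilin (metric_tensor i x) v v }.

Record magnetic_field := MagneticField {
  magnetic_tensor :> tensor2;
  magnetic_alt : forall i x, (magnetic_tensor i x)^T = - magnetic_tensor i x;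
  magnetic_closed : forall i x, chart_img i x -> forall a b c,
    partial a (fun y => magnetic_tensor i y b c) x
    + partial b (fun y => magnetic_tensor i y c a) x
    + partial c (fun y => magnetic_tensor i y a b) x = 0 }.

Definition agree_on (U : set M) (s s' : magnetic_field) :=
  forall i p, dom i p -> U p -> s i (chart i p) = s' i (chart i p).

Definition smooth_curve (gamma : R -> M) :=
  continuous gamma /\
  forall i, smooth_on (gamma @^-1` dom i : set R^o) (chart i \o gamma : R^o -> _).

Definition velocity i (gamma : R -> M) (t : R) : 'rV[R]_n :=
  'D_1 (chart i \o gamma : R^o -> _) t.

Definition christoffel (g : riem_metric) i (x : 'rV[R]_n) (a b c : 'I_n) : R :=
  2^-1 * \sum_m invmx (g i x) c m *
    (partial a (fun y => g i y m b) x + partial b (fun y => g i y a m) x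
     - partial m (fun y => g i y a b) x).

(* Components in chart i of the Levi-Civita covariant derivative of the velocity
   along the curve. *)
Definition cov_accel (g : riem_metric) i (gamma : R -> M) (t : R) : 'rV[R]_n :=
  \row_c ('D_1 (velocity i gamma : R^o -> _) t ord0 c
    + \sum_a \sum_b christoffel g i (chart i (gamma t)) a b c
        * velocity i gamma t ord0 a * velocity i gamma t ord0 b).

Definition lorentz (g : riem_metric) (s : magnetic_field) i (x u : 'rV[R]_n) :
    'rV[R]_n :=
  u *m s i x *m invmx (g i x).

Lemma metric_unit (g : riem_metric) i x : chart_img i x -> g i x \in unitmx.
Proof.
move=> ix; rewrite -row_free_unit -kermx_eq0; apply/eqP/row_matrixP => k.
rewrite row0; apply/eqP; apply: contraT => /(metric_pos g ix).
by rewrite /bilin -row_mul mulmx_ker row0 mul0mx mxE ltxx.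
Qed.

Lemma lorentzP (g : riem_metric) (s : magnetic_field) i x u v :
  chart_img i x -> bilin (g i x) (lorentz g s i x u) v = bilin (s i x) u v.
Proof. by move=> ix; rewrite /bilin /lorentz mulmxKV// metric_unit. Qed.

Definition geodesic (g : riem_metric) (gamma : R -> M) :=
  smooth_curve gamma /\
  forall i t, dom i (gamma t) -> cov_accel g i gamma t = 0.

Definition magnetic_geodesic (g : riem_metric) (s : magnetic_field)
    (gamma : R -> M) :=
  smooth_curve gamma /\
  forall i t, dom i (gamma t) ->
    cov_accel g i gamma t =
      lorentz g s i (chart i (gamma t)) (velocity i gamma t).

(* A smooth embedding of R/TZ: an immersion which is injective modulo T and a
   homeomorphism onto its image, the open sets of R/TZ being the T-periodic open
   sets of R. *)
Definition embedded_loop (T : R) (gamma : R -> M) :=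
  [/\ 0 < T /\ (forall t, gamma (t + T) = gamma t),
      smooth_curve gamma,
      (forall i t, dom i (gamma t) -> velocity i gamma t != 0),
      (forall s t, gamma s = gamma t -> exists m : int, s = t + m%:~R * T) &
      (forall O : set R, open O -> (forall t, O (t + T) <-> O t) ->
        exists2 V : set M, open V & O = gamma @^-1` V)].

Definition geodesic_type_loop (g : riem_metric) (s : magnetic_field)
    (T : R) (gamma : R -> M) :=
  [/\ embedded_loop T gamma, geodesic g gamma &
      forall i t, dom i (gamma t) ->
        forall v, bilin (s i (chart i (gamma t))) (velocity i gamma t) v = 0].

Definition geodesic_type (g : riem_metric) (s : magnetic_field) :=
  exists T gamma, geodesic_type_loop g s T gamma.

(* The orbits of the magnetic flow on TM are the lifts (gamma, gamma') of the
   magnetic geodesics; this is a T-periodic orbit of energy kappa. *)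
Definition periodic_orbit (g : riem_metric) (s : magnetic_field) (kappa T : R)
    (gamma : R -> M) :=
  [/\ 0 < T, magnetic_geodesic g s gamma,
      (forall t, gamma (t + T) = gamma t),
      (forall i t, dom i (gamma t) ->
        velocity i gamma (t + T) = velocity i gamma t) &
      (forall i t, dom i (gamma t) ->
        2^-1 * bilin (g i (chart i (gamma t)))
                 (velocity i gamma t) (velocity i gamma t) = kappa)].

Definition has_embedded_periodic_orbit (g : riem_metric) (s : magnetic_field)
    (kappa : R) :=
  exists T gamma, periodic_orbit g s kappa T gamma /\ embedded_loop T gamma.

(* The metrics with the C^l topology: the coarsest one for which each Cl_ball is
   open, i.e. uniform convergence of all partial derivatives of order at most l
   of the components on compact subsets of chart images. *)
Definition metrics_Cl (l : nat) := riem_metric.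

Definition Cl_ball (l : nat) (g : riem_metric) i (K : set 'rV[R]_n) (e : R) :
    set riem_metric :=
  [set h : riem_metric | forall s : seq 'I_n, (size s <= l)%N -> forall a b x, K x ->
    `|partials s (fun y => h i y a b) x - partials s (fun y => g i y a b) x| < e].

Definition Cl_subbase (l : nat) : set (set riem_metric) :=
  [set O | exists g i K e,
    [/\ compact K, K `<=` chart_img i, 0 < e & O = Cl_ball l g i K e]].

HB.instance Definition _ (l : nat) := gen_eqMixin (metrics_Cl l).
HB.instance Definition _ (l : nat) := gen_choiceMixin (metrics_Cl l).
HB.instance Definition _ (l : nat) := @isSubBaseTopological.Build (metrics_Cl l)
  (set riem_metric) (Cl_subbase l) id.

End Geometry.

Arguments metrics_Cl {R n M} X l.

(* Main.v *)
(* A magnetic field that agrees with 0 near a loop vanishes along it, and a closed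
   geodesic run at any constant speed stays a geodesic. So the zero field works for
   every metric once M carries an embedded closed geodesic.

   Let L be the infimum of the speeds of the Lipschitz loops [0,1] -> M that are not
   null-homologous; such loops exist because the first Betti number is not zero. By
   Tychonoff a minimizing sequence has a pointwise cluster point, again a loop of
   speed L, and it is not null-homologous because its class is a sum of differences
   of local potentials. A self-intersection would split this loop into two strictly
   shorter loops one of which is not null-homologous, so it is embedded. Moreover
   replacing a short arc by another arc with the same ends in the same chart ball
   does not change the homology class, so no such arc has smaller speed. Comparison
   with chords gives a Hoelder continuous derivative, comparison with variations the
   Euler-Lagrange equation in integrated form, and this equation gives smoothness by
   induction. *)

From HB Require Import structures.
From mathcomp Require Import freeg ring_quotient.
Require Import Defs.
From mathcomp Require Import all_boot all_order all_algebra.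
From mathcomp Require Import all_classical all_reals all_analysis.
From mathcomp Require Import ring lra.
Import Order.TTheory GRing.Theory Num.Theory numFieldNormedType.Exports.

Set Implicit Arguments.
Unset Strict Implicit.
Unset Printing Implicit Defensive.

Local Open Scope classical_set_scope.
Local Open Scope ring_scope.

(** * Singular 1-chains modulo boundaries *)

(** Speed, a local Lipschitz bound, replaces length and energy: it makes sense for continuous
    curves, passes to pointwise limits and needs neither integrals nor arc length. Its drawback is
    that it is a supremum in time, so a competitor that is slower on part of an arc gains nothing by
    itself. The gain has to be spread over time. A slower arc, run at the old speed, saves time and
    shortens the whole loop; a variation that lowers the energy on average is reparametrized until
    it lowers the speed at every time.

    Limits are taken along an ultrafilter of nearly minimal loops, separately at each time. No
    uniform convergence is used: almost every loop behaves well at the finitely many times that an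
    argument needs, and the common speed bound controls it in between. Arguments along a curve
    proceed by real induction.

    The limit is only Lipschitz, so a derivative must be produced before any equation can be stated.
    Minimality does this directly: difference quotients over one point form a Cauchy family of order
    one half. *)

Section Continuity.
Context {R : realType} {T : topologicalType} {V : normedModType R}.
Implicit Types (f g : T -> V) (s r : T -> R) (x : T).

Lemma ctsD f g x : {for x, continuous f} -> {for x, continuous g} ->
  {for x, continuous (fun y => f y + g y)}.
Proof. by move=> fc gc; exact: (cvgD fc gc). Qed.

Lemma ctsN f x : {for x, continuous f} -> {for x, continuous (fun y => - f y)}.
Proof. by move=> fc; exact: (cvgN fc). Qed.

Lemma ctsB f g x : {for x, continuous f} -> {for x, continuous g} ->
  {for x, continuous (fun y => f y - g y)}.
Proof. by move=> fc gc; exact: (cvgB fc gc). Qed.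

Lemma ctsZ s f x : {for x, continuous s} -> {for x, continuous f} ->
  {for x, continuous (fun y => s y *: f y)}.
Proof. by move=> sc fc; exact: (cvgZ sc fc). Qed.

Lemma ctsM s r x : {for x, continuous s} -> {for x, continuous r} ->
  {for x, continuous (fun y => s y * r y)}.
Proof. by move=> sc fc; exact: (cvgM sc fc). Qed.

Lemma ctsC (U : topologicalType) (m : U) x : {for x, continuous (fun=> m : U)}.
Proof. exact: cst_continuous. Qed.

Lemma ctsid x : {for x, continuous (fun y : T => y)}.
Proof. exact: cvg_id. Qed.

Lemma ctscomp (U W : topologicalType) (f : T -> U) (g : U -> W) x :
  {for x, continuous f} -> {for f x, continuous g} ->
  {for x, continuous (fun y => g (f y))}.
Proof. by move=> fc gc; apply: continuous_comp. Qed.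

Lemma ctspair (U W : topologicalType) (f : T -> U) (g : T -> W) x :
  {for x, continuous f} -> {for x, continuous g} ->
  {for x, continuous (fun y => (f y, g y))}.
Proof. by move=> fc gc; exact: (cvg_pair fc gc). Qed.

Lemma cts_sum (I : Type) (r : seq I) (P : pred I) (F : I -> T -> V) x :
  (forall i, P i -> {for x, continuous (F i)}) ->
  {for x, continuous (fun y => \sum_(i <- r | P i) F i y)}.
Proof.
move=> Fc; elim: r => [|i r IH].
  have -> : (fun y => \sum_(i <- [::] | P i) F i y) = fun=> 0.
    by apply/funext => y; rewrite big_nil.
  exact: ctsC.
have -> : (fun y => \sum_(j <- i :: r | P j) F j y) = fun y =>
    (if P i then F i y else 0) + \sum_(j <- r | P j) F j y.
  by apply/funext => y; rewrite big_cons; case: ifP => // _; rewrite add0r.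
apply: ctsD => //; case Pi: (P i); [exact: Fc|exact: ctsC].
Qed.

End Continuity.

Section Cycles.
Context {R : realType} {M : topologicalType}.

Local Notation chain1 := (@chain R M 1).

Definition bounding : {pred chain1} :=
  fun z => `[< exists d : @chain R M 2, boundary d = z >].

Lemma boundary_is_additive q : additive (@boundary R M q).
Proof. exact: lift_is_additive. Qed.

HB.instance Definition _ q := GRing.isAdditive.Build
  (@chain R M q.+1) (@chain R M q) (@boundary R M q) (@boundary_is_additive q).

Lemma bounding_zmod_closed : zmod_closed bounding.
Proof.
split; first by apply/asboolP; exists 0; rewrite raddf0.
move=> x y /asboolP[d <-] /asboolP[e <-]; apply/asboolP.
by exists (d - e); rewrite raddfB.
Qed.

HB.instance Definition _ := GRing.isZmodClosed.Build chain1 bounding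
  bounding_zmod_closed.

(* Chains modulo boundaries, not cycles modulo boundaries: arcs have classes too,
   so that the class of a loop is the sum of the classes of its pieces. *)
Definition H1 : zmodType := Quotient.quot bounding.

(** Additivity and the kernel are all that is needed of the quotient map. Drawing [hclass] from an
    opaque existence proof keeps the quotient from being unfolded. *)
Fact hclass_exists : exists f : {additive chain1 -> H1},
  forall z, f z = 0 <-> exists d : @chain R M 2, boundary d = z.
Proof.
pose f (z : chain1) : H1 := (\pi_(Quotient.quot bounding) z)%qT.
have fadd : additive f by move=> x y; rewrite /f; rewrite !piE.
pose fm := GRing.isAdditive.Build _ _ f fadd.
exists (HB.pack_for {additive chain1 -> H1} f fm) => z /=.
have f0 : f 0 = 0 by have := fadd 0 0; rewrite !subrr.
rewrite -f0; split.
  by move/eqP; rewrite -Quotient.idealrBE subr0 => /asboolP.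
by move=> zb; apply/eqP; rewrite -Quotient.idealrBE subr0; apply/asboolP.
Qed.

Definition hclass : {additive chain1 -> H1} := projT1 (cid hclass_exists).

Lemma hclass_eq0 z : hclass z = 0 <-> exists d : @chain R M 2, boundary d = z.
Proof. exact: (projT2 (cid hclass_exists)). Qed.

Lemma rowsimplex_continuous q (h : 'rV[R]_q.+1 -> M) : continuous h ->
  continuous (fun x : @std_simplex R q => h (set_val x)).
Proof.
move=> hc x; apply: (@continuous_comp _ _ _ set_val h); last exact: hc.
exact: initial_continuous.
Qed.

(** Simplices are restrictions of maps on the whole row space, so that formulas for faces and edges
    avoid the subtype of the standard simplex. *)
Definition rowsimplex q (h : 'rV[R]_q.+1 -> M) (hc : continuous h) :
    @singular_simplex R M q := mkcts (rowsimplex_continuous hc).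

(* 0 if [h] is not continuous. *)
Definition smx q (h : 'rV[R]_q.+1 -> M) : @chain R M q :=
  if pselect (continuous h) is left hc then << rowsimplex hc >> else 0.

Lemma smxE q (h : 'rV[R]_q.+1 -> M) (hc : continuous h) :
  smx h = << rowsimplex hc >>.
Proof.
rewrite /smx; case: pselect => // hc'.
by rewrite (Prop_irrelevance hc hc').
Qed.

Lemma eq_smx q (h h' : 'rV[R]_q.+1 -> M) : continuous h -> continuous h' ->
  {in @std_simplex R q, h =1 h'} -> smx h = smx h'.
Proof.
move=> hc hc' hh'; rewrite !smxE; congr (<< _ >>); apply/continuousEP => -[x xS].
exact: hh'.
Qed.

Lemma boundary_smx q (h : 'rV[R]_q.+2 -> M) : continuous h ->
  boundary (smx h) = \sum_(i < q.+2) (-1) ^+ i *: smx (h \o face_row i).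
Proof.
move=> hc; rewrite smxE /boundary liftU scale1r; apply: eq_bigr => i _.
have fc : continuous (h \o face_row i).
  move=> x; apply: continuous_comp; last exact: hc.
  apply: continuous_row => j; rewrite /face_row.
  case: (unliftP i j) => [k ->|->].
    rewrite (_ : (fun _ => _) = fun y : 'rV[R]_q.+1 => y ord0 k); last first.
      by apply/funext => y; rewrite mxE liftK.
    exact: coord_continuous.
  rewrite (_ : (fun _ => _) = fun=> 0); first exact: cst_continuous.
  by apply/funext => y; rewrite mxE unlift_none.
rewrite smxE; congr (_ *: << _ >>); exact/continuousEP.
Qed.

Lemma face_row0 q (x : 'rV[R]_q.+1) i : face_row i x ord0 i = 0.
Proof. by rewrite mxE unlift_none. Qed.

Lemma face_row_lift q (x : 'rV[R]_q.+1) i j :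
  face_row i x ord0 (lift i j) = x ord0 j.
Proof. by rewrite mxE liftK. Qed.

Section Edges.
Context {V : normedModType R}.
Implicit Types (F : V -> M) (p q r : V).

(** The space [V] is the line for arcs, the row space for chart segments and the plane for homotopy
    squares. *)
Definition edge_map F p q (x : 'rV[R]_2) :=
  F (x ord0 ord0 *: p + x ord0 ord_max *: q).

Lemma edge_map_continuous F p q : continuous F -> continuous (edge_map F p q).
Proof.
move=> Fc x; apply: (@continuous_comp _ _ _
  (fun x : 'rV[R]_2 => x ord0 ord0 *: p + x ord0 ord_max *: q) F); last exact: Fc.
by apply: ctsD; apply: ctsZ; [exact: coord_continuous|exact: ctsC|exact: coord_continuous|exact: ctsC].
Qed.

Definition hedge F p q := hclass (smx (edge_map F p q)).

Lemma hedgeE F p q : hedge F p q = hclass (smx (edge_map F p q)).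
Proof. by []. Qed.

#[global] Opaque hedge.

(** The affine triangle with vertices [p], [q], [r], mapped by [F], has as boundary the edge from
    [q] to [r], minus that from [p] to [r], plus that from [p] to [q]. *)
Lemma hedge_trans F p q r : continuous F ->
  hedge F p r = hedge F p q + hedge F q r.
Proof.
move=> Fc; pose h (x : 'rV[R]_3) := F (x ord0 ord0 *: p +
  x ord0 (lift ord0 ord0) *: q + x ord0 ord_max *: r).
have hc : continuous h.
  move=> x; apply: (@continuous_comp _ _ _ (fun x : 'rV[R]_3 => x ord0 ord0 *: p +
    x ord0 (lift ord0 ord0) *: q + x ord0 ord_max *: r) F); last exact: Fc.
  by do 2?apply: ctsD; apply: ctsZ; do ?[exact: coord_continuous|exact: ctsC].
have : hclass (boundary (smx h)) = 0 by apply/hclass_eq0; exists (smx h).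
rewrite boundary_smx// !big_ord_recl big_ord0 addr0 /= !expr0 !scale1r.
rewrite -[bump 0 0]/1%N expr1 scaleN1r.
have -> : h \o face_row ord0 = edge_map F q r.
  apply/funext => x; rewrite /h /edge_map /= face_row0 scale0r add0r.
  have -> : ord_max = lift ord0 (ord_max : 'I_2) :> 'I_3 by apply/val_inj.
  by rewrite !face_row_lift.
have -> : h \o face_row (lift ord0 ord0) = edge_map F p r.
  apply/funext => x; rewrite /h /edge_map /= face_row0 scale0r addr0.
  have -> : ord0 = lift (lift ord0 ord0) (ord0 : 'I_2) :> 'I_3 by apply/val_inj.
  have -> : ord_max = lift (lift ord0 ord0) (ord_max : 'I_2) :> 'I_3
    by apply/val_inj.
  by rewrite !face_row_lift; congr (F (x _ _ *: _ + _)); apply/val_inj.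
have -> : h \o face_row (lift ord0 (lift ord0 ord0)) = edge_map F p q.
  apply/funext => x; rewrite /h /edge_map /=.
  have -> : ord_max = lift ord0 (lift ord0 ord0) :> 'I_3 by apply/val_inj.
  rewrite face_row0 scale0r addr0.
  set i := lift ord0 (lift ord0 ord0) : 'I_3.
  have -> : ord0 = lift i (ord0 : 'I_2) :> 'I_3 by apply/val_inj.
  have -> : lift (lift i ord0) ord0 = lift i (ord_max : 'I_2) :> 'I_3
    by apply/val_inj.
  by rewrite !face_row_lift; congr (F (x _ _ *: _ + _)); apply/val_inj.
rewrite raddfD /= raddfD /= raddfN /= -!hedgeE.
by rewrite addrCA addrC [X in X + _ = 0]addrC => /eqP; rewrite subr_eq0 => /eqP ->.
Qed.

Lemma hedge_id F p : continuous F -> hedge F p p = 0.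
Proof.
move=> Fc; have /eqP := hedge_trans p p p Fc.
by rewrite -[X in X == _]addr0 (inj_eq (addrI _)) => /eqP.
Qed.

End Edges.

#[global] Opaque hedge.

Lemma hclass_cst (m : M) : hclass (smx (fun=> m : M)) = 0.
Proof. by rewrite -(hedge_id (V := R^o) 0 (@cst_continuous _ _ m)) hedgeE. Qed.

Definition hseg (c : R -> M) (a b : R) := hedge (c : R^o -> M) a b.

Section Segments.
Implicit Types (c : R -> M) (a b : R).

Lemma hseg_trans c a b e : continuous c ->
  hseg c a e = hseg c a b + hseg c b e.
Proof. exact: (@hedge_trans R^o). Qed.

Lemma hseg_id c a : continuous c -> hseg c a a = 0.
Proof. exact: (@hedge_id R^o). Qed.

Lemma hsegC c a b : continuous c -> hseg c a b = - hseg c b a.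
Proof.
move=> cc; apply/eqP; rewrite -addr_eq0 -hseg_trans//; apply/eqP.
exact: hseg_id.
Qed.

Lemma simplex2P (x : 'rV[R]_2) : x \in @std_simplex R 1 ->
  [/\ 0 <= x ord0 ord0, 0 <= x ord0 ord_max &
   x ord0 ord_max = 1 - x ord0 ord0].
Proof.
move=> /set_mem[x0]; rewrite !big_ord_recl big_ord0 addr0 => <-; split => //.
by rewrite addrC addKr; congr (x _ _); apply/val_inj.
Qed.

Lemma eq_hseg c c' a b : a <= b -> continuous c -> continuous c' ->
  (forall t, a <= t <= b -> c t = c' t) -> hseg c a b = hseg c' a b.
Proof.
move=> ab cc cc' cE; rewrite /hseg !hedgeE; congr (hclass _); apply: eq_smx; do ?exact: edge_map_continuous.
move=> x /simplex2P[x0 x1 xE]; rewrite /edge_map; apply: cE.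
rewrite /GRing.scale/= xE; rewrite xE in x1.
by apply/andP; split; nra.
Qed.

Lemma hseg_affine c k m a b : continuous c ->
  hseg (fun t => c (k * t + m)) a b = hseg c (k * a + m) (k * b + m).
Proof.
move=> cc; have cc' : continuous (fun t => c (k * t + m)).
  move=> t; apply: (@continuous_comp _ _ _ (fun t => k * t + m) c); last exact: cc.
  by apply: ctsD; [apply: ctsM; [exact: ctsC|exact: ctsid]|exact: ctsC].
rewrite /hseg !hedgeE; congr (hclass _); apply: eq_smx; do ?exact: edge_map_continuous.
move=> x /simplex2P[x0 x1 xE]; rewrite /edge_map; congr c.
by rewrite /GRing.scale/= xE; ring.
Qed.

Lemma hseg_cst (m : M) a b : hseg (fun=> m : M) a b = 0.
Proof. by rewrite /hseg hedgeE; exact: hclass_cst. Qed.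

Lemma cts_slice (H : R^o * R^o -> M) (t : R) : continuous H ->
  continuous (fun s : R => H (s, t)).
Proof.
move=> Hc s; apply: (@ctscomp R^o (R^o * R^o)%type M (fun s => (s, t)) H s); last exact: Hc.
by apply: ctspair; [exact: ctsid|exact: ctsC].
Qed.

Lemma hedge_horizontal (H : R^o * R^o -> M) a b (t : R) : continuous H ->
  hedge H (a, t) (b, t) = hseg (fun s => H (s, t)) a b.
Proof.
move=> Hc; rewrite /hseg !hedgeE.
have e : {in @std_simplex R 1, edge_map H (a, t) (b, t) =1
    edge_map (fun s : R^o => H (s, t)) a b}.
  move=> x /simplex2P[x0 x1 xE]; rewrite /edge_map; congr H.
  by congr (_, _); rewrite /= -scalerDl xE addrC subrK; exact: scale1r.
rewrite (eq_smx _ _ e)//; first exact: edge_map_continuous.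
apply: edge_map_continuous; exact: cts_slice.
Qed.

Lemma hedge_vertical (H : R^o * R^o -> M) (s : R) (m : M) : continuous H ->
  (forall t, H (s, t) = m) -> hedge H (s, 0) (s, 1) = 0.
Proof.
move=> Hc Hm; rewrite -(hclass_cst m) hedgeE.
have e : {in @std_simplex R 1, edge_map H (s, 0) (s, 1) =1 (fun=> m)}.
  move=> x /simplex2P[x0 x1 xE]; rewrite /edge_map -[RHS](Hm (x ord0 ord_max)).
  congr H; congr (_, _); first by rewrite /= -scalerDl xE addrC subrK; exact: scale1r.
  by rewrite /= scaler0 add0r; exact: mulr1.
rewrite (eq_smx _ _ e)//; [exact: edge_map_continuous|exact: cst_continuous].
Qed.

(** * Homotopy invariance of the class of an arc *)

Section Homotopy.
Variables (V : normedModType R) (F : V -> M) (w : R -> V) (a b : R).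
Hypotheses (Fc : continuous F) (wc : continuous w) (ab : a != b).

Let chord (s : R) : V := w a + ((s - a) / (b - a)) *: (w b - w a).

Let chord_continuous : continuous chord.
Proof.
move=> s; apply: (@ctsD _ _ _ (fun=> w a) _ s); first exact: ctsC.
apply: ctsZ; last exact: ctsC.
by apply: ctsM; [apply: ctsB; [exact: ctsid|exact: ctsC]|exact: ctsC].
Qed.

Let H (z : R^o * R^o) : M := F (w z.1 + z.2 *: (chord z.1 - w z.1)).

Let H_continuous : continuous H.
Proof.
move=> z; apply: (@continuous_comp _ _ _
  (fun z : R^o * R^o => w z.1 + z.2 *: (chord z.1 - w z.1)) F); last exact: Fc.
have w1 : {for z, continuous (fun z : R^o * R^o => w z.1)}.
  by apply: continuous_comp; [exact: cvg_fst|exact: wc].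
have l1 : {for z, continuous (fun z : R^o * R^o => chord z.1)}.
  by apply: continuous_comp; [exact: cvg_fst|exact: chord_continuous].
have s1 : {for z, continuous (fun z : R^o * R^o => z.2 : R)} by exact: cvg_snd.
exact: (ctsD w1 (ctsZ s1 (ctsB l1 w1))).
Qed.

Let ba : b - a != 0. Proof. by rewrite subr_eq0 eq_sym. Qed.

Let bottom : hseg (F \o w) a b = hedge H (a, 0) (b, 0).
Proof.
rewrite (hedge_horizontal _ _ _ H_continuous); congr hseg.
by apply/funext => s; rewrite /H/= scale0r addr0.
Qed.

Let top : hedge F (w a) (w b) = hedge H (a, 1) (b, 1).
Proof.
rewrite (hedge_horizontal _ _ _ H_continuous) /hseg !hedgeE.
have e : {in @std_simplex R 1, edge_map F (w a) (w b) =1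
    edge_map (fun s : R^o => H (s, 1)) a b}.
  move=> x /simplex2P[x0 x1 xE]; rewrite /edge_map /H /=; congr F.
  rewrite scale1r [RHS]addrC subrK /chord xE.
  have -> : (x ord0 ord0 *: a + (1 - x ord0 ord0) *: b - a) / (b - a)
      = 1 - x ord0 ord0 by rewrite /GRing.scale/=; field.
  rewrite -[in LHS](subrK (w a) (w b)) scalerDr addrCA -scalerDl addrCA.
  by rewrite subrr addr0 scale1r addrC.
rewrite (eq_smx _ _ e)//; first exact: edge_map_continuous.
by apply: edge_map_continuous; apply: cts_slice; exact: H_continuous.
Qed.

(* The straight-line homotopy in [V] from [w] to its chord. *)
Lemma homotopic_chord : hseg (F \o w) a b = hedge F (w a) (w b).
Proof.
have vert s : chord s = w s -> hedge H (s, 0) (s, 1) = 0.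
  move=> cw; apply: (hedge_vertical (m := F (w s)) H_continuous) => t.
  by rewrite /H/= cw subrr scaler0 addr0.
have la : chord a = w a by rewrite /chord subrr mul0r scale0r addr0.
have lb : chord b = w b by rewrite /chord divff// scale1r addrC subrK.
have Hc := H_continuous.
(* Both ways around the square from [(a, 0)] to [(b, 1)] have the class of its diagonal, and the
   vertical sides are constant. *)
have e1 := @hedge_trans (R^o * R^o)%type H (a, 0) (b, 0) (b, 1) Hc.
have e2 := @hedge_trans (R^o * R^o)%type H (a, 0) (a, 1) (b, 1) Hc.
rewrite (vert _ lb) addr0 in e1; rewrite (vert _ la) add0r in e2.
exact: etrans bottom (etrans (esym e1) (etrans e2 (esym top))).
Qed.

End Homotopy.

(** Whatever factors through a normed space is determined by its ends; with [F] an inverse chart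
    this makes homology locally trivial. *)
Lemma hseg_comp (V : normedModType R) (F : V -> M) (w : R -> V) a b :
  continuous F -> continuous w ->
  hseg (F \o w) a b = hedge F (w a) (w b).
Proof.
move=> Fc wc.
have [<-|ab] := eqVneq a b; last exact: homotopic_chord.
rewrite hseg_id// ?hedge_id// => t.
by apply: continuous_comp; [exact: wc|exact: Fc].
Qed.

End Segments.

End Cycles.

(** * Path components, and essential loops from a nonzero Betti number *)

Section Loops.
Context {R : realType} {M : topologicalType}.
Implicit Types (c f g : R -> M).

Definition glue f g (b : R) (t : R) : M := if t <= b then f t else g t.

Lemma glue_continuous f g b : continuous f -> continuous g -> f b = g b ->
  continuous (glue f g b).
Proof.
move=> fc gc fg t A At; suff: \forall s \near t, A (glue f g b s) by [].
move: At; rewrite /glue; have [tb|bt|->] := ltgtP t b => At.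
- have fA := fc _ _ At; near=> s; rewrite ifT; first by near: s; exact: fA.
  by apply: ltW; near: s; exact: lt_nbhsl.
- have gA := gc _ _ At; near=> s; rewrite leNgt ifF; first by near: s; exact: gA.
  by apply/negbF; near: s; exact: lt_nbhsr.
- have fA := fc _ _ At; have gA : \forall s \near b, A (g s).
    by apply: gc; rewrite -fg.
  near=> s; case: ifP => _; near: s; [exact: fA|exact: gA].
Unshelve. all: end_near. Qed.

Lemma glueL f g b t : t <= b -> glue f g b t = f t.
Proof. by rewrite /glue => ->. Qed.

Lemma glueR f g b t : f b = g b -> b <= t -> glue f g b t = g t.
Proof.
rewrite /glue => fg bt; case: ifP => // tb.
by have -> : t = b by apply/eqP; rewrite eq_le tb.
Qed.

Lemma hseg_glue f g a b e : continuous f -> continuous g -> f b = g b ->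
  a <= b <= e -> hseg (glue f g b) a e = hseg f a b + hseg g b e.
Proof.
move=> fc gc fg /andP[ab be]; have hc := glue_continuous fc gc fg.
rewrite (hseg_trans a b e hc); congr (_ + _); apply: eq_hseg => // t /andP[t1 t2].
  exact: glueL.
exact: glueR.
Qed.

Definition joined (p q : M) := exists f, [/\ continuous f, f 0 = p & f 1 = q].

Lemma joined_refl p : joined p p.
Proof. by exists (fun=> p); split => //; exact: cst_continuous. Qed.

Lemma cts_affine f (k m : R) : continuous f -> continuous (fun t => f (k * t + m)).
Proof.
move=> fc t; apply: (@ctscomp R R M (fun t => k * t + m) f t); last exact: fc.
by apply: ctsD; [apply: ctsM; [exact: ctsC|exact: ctsid]|exact: ctsC].
Qed.

Lemma joined_sym p q : joined p q -> joined q p.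
Proof.
move=> [f [fc f0 f1]]; exists (fun t => f (-1 * t + 1)); split.
- exact: cts_affine.
- by rewrite mulr0 add0r.
- by rewrite mulr1 addNr.
Qed.

Lemma joined_trans p q r : joined p q -> joined q r -> joined p r.
Proof.
move=> [f [fc f0 f1]] [g [gc g0 g1]].
pose g' t := g (1 * t + -1); have g'c : continuous g' by exact: cts_affine.
have fg : f 1 = g' 1 by rewrite /g' mulr1 subrr f1 g0.
have hc := glue_continuous fc g'c fg.
exists (fun t => glue f g' 1 (2 * t + 0)); split.
- exact: cts_affine.
- by rewrite mulr0 addr0 glueL.
- rewrite mulr1 addr0 glueR//; last by rewrite ler1n.
  by rewrite /g' mul1r (_ : 2 + -1 = 1)//; ring.
Qed.

Definition base_of (S : set M) (hS : exists q, S q) : M := projT1 (cid hS).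

(** A representative of the path component. It is chosen from the set of points joined to [p], so
    that equal sets give equal choices in [base_eq]. *)
Definition base p : M :=
  base_of (ex_intro (fun q => joined q p) p (joined_refl p)).

Lemma base_joined p : joined (base p) p.
Proof. by rewrite /base /base_of; case: cid. Qed.

Lemma base_eq p q : joined p q -> base p = base q.
Proof.
move=> pq; rewrite /base.
have /= := Prop_irrelevance.
move: (ex_intro _ p _) (ex_intro _ q _) => h1 h2.
have e : (fun r => joined r p) = (fun r => joined r q).
  apply/funext => r; apply/propext; split => h; first exact: joined_trans h pq.
  exact: joined_trans h (joined_sym pq).
by move=> irr; move: h1; rewrite e => h1; rewrite (irr _ h1 h2).
Qed.

Definition base_path p : R -> M := projT1 (cid (base_joined p)).

Lemma base_pathP p :
  [/\ continuous (base_path p), base_path p 0 = base p & base_path p 1 = p].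
Proof. by rewrite /base_path; case: cid. Qed.

Definition clamp (a b t : R) := Num.max a (Num.min b t).

Lemma clamp_itv a b t : a <= b -> a <= clamp a b t <= b.
Proof. by move=> ab; rewrite /clamp le_max lexx/= ge_max ab ge_min lexx. Qed.

Lemma clamp_id a b t : a <= t <= b -> clamp a b t = t.
Proof. by move=> /andP[h1 h2]; rewrite /clamp min_r// max_r. Qed.

Lemma clamp_continuous a b : continuous (clamp a b : R -> R).
Proof.
move=> t; apply: (@continuous_max _ _ (fun=> a) (fun t => Num.min b t)).
  exact: cst_continuous.
apply: (@continuous_min _ _ (fun=> b) (fun t => t)); first exact: cst_continuous.
exact: cvg_id.
Qed.

Definition seg_row (t : R) : 'rV[R]_2 := \row_i (if i == ord0 then 1 - t else t).

Lemma seg_row_simplex t : 0 <= t <= 1 -> seg_row t \in @std_simplex R 1.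
Proof.
move=> /andP[t0 t1]; apply/mem_set; split => [j|].
  by rewrite mxE; case: ifP => // _; rewrite subr_ge0.
by rewrite !big_ord_recl big_ord0 addr0 !mxE/= subrK.
Qed.

(** Clamping extends the parametrization of the standard 1-simplex to the whole line, so that every
    singular 1-simplex becomes an arc defined on [R]. *)
Definition seg_pt (t : R) : @std_simplex R 1 :=
  exist (fun y => y \in @std_simplex R 1) _
    (seg_row_simplex (clamp_itv t (@ler01 R))).

Lemma seg_pt_continuous : continuous seg_pt.
Proof.
apply: continuous_comp_initial => t; apply: (@continuous_row R R) => j.
have -> : (fun y : R => (set_val (seg_pt y) : 'rV[R]_2) ord0 j) =
    fun y => if j == ord0 then 1 - clamp 0 1 y else clamp 0 1 y.
  by apply/funext => y; rewrite set_valE /= mxE.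
case: (j == ord0); last exact: clamp_continuous.
by apply: ctsB; [exact: ctsC|exact: clamp_continuous].
Qed.

Lemma hclass_simplex (s : @singular_simplex R M 1) :
  hclass << s >> = hseg (s \o seg_pt) 0 1.
Proof.
have sc : continuous (s \o seg_pt).
  by move=> t; apply: continuous_comp; [exact: seg_pt_continuous|exact: cts_fun].
have ec := @edge_map_continuous R M R^o (s \o seg_pt) 0 1 sc.
rewrite /hseg hedgeE (smxE ec); congr (hclass _); congr (<< _ >>); apply/continuousEP => -[x xS].
rewrite /= /rowsimplex /mkcts /edge_map /= set_valE /=; congr (s _).
apply/val_inj => /=; have [x0 x1 xE] := simplex2P xS.
have xm : x ord0 ord0 *: (0 : R^o) + x ord0 ord_max *: (1 : R^o) = x ord0 ord_max.
  by rewrite scaler0 add0r; exact: mulr1.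
rewrite xm clamp_id; last by rewrite x1 /= xE gerBl.
apply/rowP => j; rewrite mxE; case: eqP => [->|/eqP j0]; first by rewrite xE subKr.
by congr (x _ _); apply/val_inj; case: j j0 => -[|[]].
Qed.
Lemma vertex_simplex : (\row_(j < 1) 1 : 'rV[R]_1) \in @std_simplex R 0.
Proof.
by apply/mem_set; split => [j|]; rewrite ?big_ord_recl ?big_ord0 !mxE ?addr0.
Qed.

Definition vertex : @std_simplex R 0 :=
  exist (fun y => y \in @std_simplex R 0) _ vertex_simplex.

(** A cone operator in degree 0: each point is joined to the representative of its component, which
    closes every arc up to a loop. *)
Definition base_chain : @chain R M 0 -> @chain R M 1 :=
  fglift (fun t : @singular_simplex R M 0 =>
    smx (edge_map (base_path (t (vertex)) : R^o -> M) 0 1)).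

Lemma base_chain_is_additive : additive base_chain.
Proof. exact: lift_is_additive. Qed.
HB.instance Definition _ :=
  GRing.isAdditive.Build _ _ base_chain base_chain_is_additive.

(** Face [i] omits vertex [i], so face 0 is the end of the arc and face 1 its start. *)
Lemma face_vertex (s : @singular_simplex R M 1) (i : 'I_2) :
  s (face i vertex) = (s \o seg_pt) (if i == ord0 then 1 else 0).
Proof.
congr (s _); apply/val_inj/rowP => /= j; rewrite !mxE.
have -> : clamp 0 1 (if i == ord0 then 1 else 0) = (if i == ord0 then 1 else 0) :> R.
  by rewrite clamp_id//; case: ifP; rewrite lexx ler01.
case: unliftP => [k ->|->] /=; first rewrite mxE;
  case: i => -[|[|//]] //= ilt; rewrite -?val_eqE/= ?bump0 ?subr0 ?subrr//.
- by case: k => -[].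
Qed.

Lemma base_chain_boundary (s : @singular_simplex R M 1) :
  base_chain (boundary << s >>) =
  smx (edge_map (base_path (s (seg_pt 1)) : R^o -> M) 0 1) -
  smx (edge_map (base_path (s (seg_pt 0)) : R^o -> M) 0 1).
Proof.
rewrite /boundary liftU scale1r !big_ord_recl big_ord0 addr0 expr0 scale1r.
rewrite expr1 scaleN1r raddfB /= /base_chain !liftU !scale1r.
have e0 := face_vertex s ord0; have e1 := face_vertex s (lift ord0 ord0).
by congr (smx (edge_map (base_path _ : R^o -> M) 0 1)
  - smx (edge_map (base_path _ : R^o -> M) 0 1)); [exact: e0|exact: e1].
Qed.

Hypothesis loop0 : forall f, continuous f -> f 0 = f 1 -> hseg f 0 1 = 0.

Lemma hseg_loop f a b : a < b -> continuous f -> f a = f b -> hseg f a b = 0.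
Proof.
move=> ab fc fab; have := @hseg_affine R M f (b - a) a 0 1 fc.
rewrite mulr0 add0r mulr1 subrK => <-; apply: loop0; first exact: cts_affine.
by rewrite mulr0 add0r mulr1 subrK.
Qed.

(** Running along [p], then [f], then [q] backwards is a loop on [[0, 3]], whose class vanishes by
    [loop0]. *)
Lemma hseg_endpoints f (p q : R -> M) : continuous f -> continuous p -> continuous q ->
  p 0 = q 0 -> p 1 = f 0 -> q 1 = f 1 -> hseg f 0 1 = hseg q 0 1 - hseg p 0 1.
Proof.
move=> fc pc qc pq pf qf.
have e1 : 1 * 1 + -1 = 0 :> R by ring.
have e2 : 1 * 2 + -1 = 1 :> R by ring.
have e3 : -1 * 2 + 3 = 1 :> R by ring.
have e4 : -1 * 3 + 3 = 0 :> R by ring.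
pose f' t := f (1 * t + -1); pose q' t := q (-1 * t + 3).
have f'c : continuous f' by exact: cts_affine.
have q'c : continuous q' by exact: cts_affine.
have pf' : p 1 = f' 1 by rewrite /f' e1.
have fq : f' 2 = q' 2 by rewrite /f' /q' e2 e3.
pose g := glue f' q' 2; have gc : continuous g by exact: glue_continuous.
have pg : p 1 = g 1 by rewrite /g glueL// ler1n.
have h1 : hseg (glue p g 1) 0 3 = 0.
  apply: hseg_loop; [by []|exact: glue_continuous|].
  rewrite glueL// glueR//; last by rewrite ler1n.
  by rewrite /g glueR ?ler_nat// /q' e4.
rewrite hseg_glue ?ler01 ?ler1n// in h1.
rewrite hseg_glue ?ler_nat ?ler1n// in h1.
rewrite /f' /q' !hseg_affine// e1 e2 e3 e4 (@hsegC R M q 1 0)// in h1.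
by move/eqP: h1; rewrite addrA subr_eq0 => /eqP <-; rewrite addrAC subrr add0r.
Qed.

Lemma hclass_simplex0 (s : @singular_simplex R M 1) :
  hclass << s >> = hclass (base_chain (boundary << s >>)).
Proof.
rewrite base_chain_boundary raddfB /= -!(hedgeE (V := R^o)) -!/(hseg _ _ _).
rewrite hclass_simplex.
have fc : continuous (s \o seg_pt).
  by move=> t; apply: continuous_comp; [exact: seg_pt_continuous|exact: cts_fun].
have [pc p0 p1] := base_pathP (s (seg_pt 0)).
have [qc q0 q1] := base_pathP (s (seg_pt 1)).
apply: hseg_endpoints => //; rewrite p0 q0; apply: base_eq.
by exists (s \o seg_pt).
Qed.

(** Linear extension from single simplices. On a cycle the right-hand side is zero, so 1-cycles
    bound as soon as loops do. *)
Lemma hclass_chain0 z : hclass z = hclass (base_chain (boundary z)).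
Proof.
rewrite -(freeg_sumE z) !raddf_sum /=; apply: eq_bigr => s _.
rewrite -[coeff s z]intz -freegU_mulz !raddfMz /=; congr (_ *~ _).
exact: hclass_simplex0.
Qed.

End Loops.

(** If all loops bounded, so would all cycles, no nonempty family of cycles would be independent,
    and the supremum that defines the Betti number would be over 0 alone. *)
Lemma exists_essential_loop (R : realType) (M : topologicalType) :
  first_betti R M <> 0%:E ->
  exists f : R -> M, [/\ continuous f, f 0 = f 1 & hseg f 0 1 <> 0].
Proof.
move=> b1; apply: contrapT => noloop; apply: b1.
have loop0 (f : R -> M) : continuous f -> f 0 = f 1 -> hseg f 0 1 = 0.
  by move=> fc f01; apply: contrapT => f1; apply: noloop; exists f.
rewrite /first_betti; set S := [set k : nat | _].
have -> : S = [set 0%N].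
  apply/seteqP; split => k /=.
    case: k => // k [z [z0 zi]]; exfalso.
    have /hclass_eq0[d dz] : hclass (z ord0) = 0.
      by rewrite (hclass_chain0 loop0) z0 !raddf0.
    have := zi (fun i => if i == ord0 then 1 else 0) _ ord0; rewrite eqxx.
    suff h : exists d, boundary d =
        \sum_i (if i == ord0 then 1 else 0 : int) *: z i by move=> /(_ h)/eqP.
    exists d; rewrite dz (bigD1 ord0)//= scale1r big1 ?addr0// => i /negPf ->.
    by rewrite scale0r.
  move=> ->; exists (fun i : 'I_0 => 0).
  by split => [i|a _ i]; case: i.
by rewrite image_set1 ereal_sup1.
Qed.

(** * Calculus and bilinear forms in coordinates *)

Section Calculus.
Context {R : realType} {n : nat}.
Implicit Types (f : 'rV[R]_n -> R^o) (u : R^o -> 'rV[R]_n) (x v : 'rV[R]_n).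

Lemma diff_partial f x v : differentiable f x ->
  'd f x v = \sum_a v ord0 a * partial a f x.
Proof.
move=> df; rewrite {1}[v]row_sum_delta linear_sum; apply: eq_bigr => a _.
by rewrite linearZ /partial deriveE.
Qed.

Lemma is_derive_comp_row f u t du : differentiable f (u t) ->
  is_derive t 1 u du ->
  is_derive t 1 (f \o u : R^o -> R^o) (\sum_a du ord0 a * partial a f (u t)).
Proof.
move=> df [ud0 <-].
have ud : differentiable u t by apply/derivable1_diffP.
have fud : differentiable (f \o u) t by exact: differentiable_comp.
apply: DeriveDef; first exact/derivable1_diffP.
rewrite [LHS]deriveE// diff_comp// -diff_partial// [in RHS]deriveE//.
Qed.

Lemma is_derive_row u (t : R^o) (du : 'rV[R]_n) :
  (forall a, is_derive t 1 (fun s => u s ord0 a : R^o) (du ord0 a)) <->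
  is_derive t 1 u du.
Proof.
split=> [h|h a].
  have ud : derivable u t 1.
    by apply/derivable_mxP => i j; rewrite (ord1 i); case: (h j).
  apply: DeriveDef => //; rewrite derive_mx//; apply/rowP => j; rewrite mxE.
  by case: (h j).
move: h => [ud <-]; rewrite derive_mx// mxE.
by apply: DeriveDef => //; have /derivable_mxP := ud; exact.
Qed.

Lemma norm_row_leP v e : 0 <= e -> (forall a, `|v ord0 a| <= e) <-> `|v| <= e.
Proof.
move=> e0; rewrite /Num.norm/= mx_normrE; split=> [h|/bigmax_leP[_ h] a].
  by apply/bigmax_leP; split => // -[i a] _ /=; rewrite (ord1 i); exact: h.
exact: (h (ord0, a) isT).
Qed.

Lemma coord_le_norm v a : `|v ord0 a| <= `|v|.
Proof. exact: (norm_row_leP v (normr_ge0 v)).2. Qed.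

(** The norm on rows is the maximum norm, so these balls are cubes, and clamping each coordinate
    retracts onto them. *)
Definition cball x (r : R) : set 'rV[R]_n := [set y | `|y - x| <= r].

Lemma cball_convex x r y z t : cball x r y -> cball x r z -> 0 <= t <= 1 ->
  cball x r (y + t *: (z - y)).
Proof.
rewrite /cball/= => hy hz /andP[t0 t1].
have -> : y + t *: (z - y) - x = (1 - t) *: (y - x) + t *: (z - x).
  by apply/rowP => a; rewrite !mxE; ring.
apply: (le_trans (ler_normD _ _)); rewrite !normrZ !ger0_norm ?subr_ge0//.
have -> : r = (1 - t) * r + t * r by ring.
by apply: lerD; apply: ler_wpM2l => //; rewrite subr_ge0.
Qed.

Lemma nbhs_cball (A : set 'rV[R]_n) x : nbhs x A ->
  exists2 r, 0 < r & cball x r `<=` A.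
Proof.
move=> /nbhs_ballP[e /= e0 he]; exists (e / 2); first by rewrite divr_gt0.
move=> y hy; apply: he; rewrite -ball_normE /= distrC; apply: le_lt_trans hy _.
by rewrite ltr_pdivrMr// mulr_natr mulr2n ltrDl.
Qed.

Lemma cball_sub x r r' : r' <= r -> cball x r' `<=` cball x r.
Proof. by move=> rr y; rewrite /cball/= => h; apply: le_trans h _. Qed.

Lemma is_derive_line x v (t : R^o) :
  is_derive t 1 (fun s : R^o => x + s *: v) v.
Proof.
apply/is_derive_row => a.
have -> : (fun s : R^o => (x + s *: v) ord0 a) = (fun s => x ord0 a + s * v ord0 a).
  by apply/funext => s; rewrite !mxE.
by apply: is_derive_eq; rewrite ?scaler0 !add0r ?mul1r; exact: mulr1.
Qed.

Lemma mvt_closed (f df : R -> R) (a b : R) : a <= b ->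
  (forall t, a <= t <= b -> is_derive t 1 f (df t)) ->
  exists2 t, a <= t <= b & f b - f a = df t * (b - a).
Proof.
move=> ab fd; have [||c] := @MVT_segment R f df a b ab.
- by move=> t; rewrite in_itv/= => /andP[/ltW h1 /ltW h2]; apply: fd; rewrite h1.
- apply: derivable_within_continuous => t; rewrite in_itv/= => h.
  by case: (fd t h).
- by rewrite in_itv/= => h1 h2; exists c.
Qed.

Lemma C1_lipschitz (A : set 'rV[R]_n) f x0 : open A -> A x0 -> is_Ck 1 A f ->
  exists r C, [/\ 0 < r, 0 < C, cball x0 r `<=` A,
    (forall x, cball x0 r x -> `|f x| <= C /\ forall a, `|partial a f x| <= C) &
    forall x y, cball x0 r x -> cball x0 r y -> `|f x - f y| <= C * `|x - y|].
Proof.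
move=> oA Ax0 /= [df dc].
have bnd (h : 'rV[R]_n -> R^o) : {for x0, continuous h} ->
    \forall y \near x0, `|h y| <= `|h x0| + 1.
  move=> hc; have /cvgrPdist_le /(_ 1 ltr01) := hc; apply: filterS => y hy.
  by rewrite -lerBlDl; apply: le_trans hy; rewrite distrC; exact: lerB_dist.
pose C0 := \big[Num.max/`|f x0| + 1]_a (`|partial a f x0| + 1).
have C0f : `|f x0| + 1 <= C0 by exact: bigmax_ge_id.
have C0p a : `|partial a f x0| + 1 <= C0 by exact: (le_bigmax _ (fun a => `|partial a f x0| + 1)).
have fc x : A x -> {for x, continuous f} by move=> /df/differentiable_continuous.
have near_bnd : \forall y \near x0, [/\ A y, `|f y| <= C0 & forall a, `|partial a f y| <= C0].
  have h1 := bnd f (fc _ Ax0).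
  have h2' a : \forall y \near x0, `|partial a f y| <= `|partial a f x0| + 1.
    by apply: bnd; exact: (dc (delta_mx 0 a) x0 (mem_set Ax0)).
  have h2 : \forall y \near x0, forall a, `|partial a f y| <= `|partial a f x0| + 1.
    exact: (@filter_forall _ _ (fun a y => `|partial a f y| <= `|partial a f x0| + 1) _ _ h2').
  have h3 : \forall y \near x0, A y by exact: open_nbhs_nbhs.
  apply: filterS3 h3 h1 h2 => y h3 h1 h2; split => // [|a].
    exact: le_trans h1 C0f.
  exact: le_trans (h2 a) (C0p a).
have [r r0 hr] := nbhs_cball near_bnd.
have C00 : 0 < C0 by apply: lt_le_trans C0f; rewrite ltr_wpDl.
exists r, (n.+1%:R * C0); split => //.
- by rewrite mulr_gt0// ltr0n.
- by move=> y /hr[].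
- move=> y /hr[_ h1 h2]; split => [|a].
    by apply: le_trans h1 _; rewrite ler_peMl ?ler1n// ltW.
  by apply: le_trans (h2 a) _; rewrite ler_peMl ?ler1n// ltW.
move=> x y hx hy; pose l (t : R^o) : 'rV[R]_n := x + t *: (y - x).
have lin t : 0 <= t <= 1 -> cball x0 r (l t) by move=> t01; exact: cball_convex.
have ld (t : R) : is_derive (t : R^o) 1 l (y - x) by exact: is_derive_line.
pose df' (t : R) : R := \sum_a (y - x) ord0 a * partial a f (l t).
have dfl (t : R) : 0 <= t <= 1 -> is_derive t 1 (f \o l : R -> R) (df' t).
  by move=> t01; apply: is_derive_comp_row; apply: df; have [] := hr _ (lin _ t01).
have [t t01] := mvt_closed ler01 dfl.
have l1 : l 1 = y by rewrite /l scale1r addrC subrK.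
have l0 : l 0 = x by rewrite /l scale0r addr0.
rewrite /= l1 l0 subr0 mulr1 distrC => ->.
apply: le_trans (ler_norm_sum _ _ _) _.
have : \sum_(a < n) `|(y - x) ord0 a * partial a f (l t)| <= \sum_(a < n) `|x - y| * C0.
  apply: ler_sum => a _; rewrite normrM distrC; apply: ler_pM => //.
    exact: coord_le_norm.
  by have [_ _] := hr _ (lin _ t01); exact.
move=> /le_trans; apply; rewrite sumr_const card_ord -[leLHS]mulr_natl.
have h : n%:R * (`|x - y| * C0) <= n.+1%:R * (`|x - y| * C0).
  by rewrite ler_wpM2r ?ler_nat// mulr_ge0// ltW.
by apply: le_trans h _; rewrite [`|x - y| * _]mulrC mulrA.
Qed.

End Calculus.

(** * Positive definite forms *)

Section Bilinear.
Context {R : realType} {n : nat}.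
Implicit Types (A B : 'M[R]_n) (u v w : 'rV[R]_n) (k : R).

Lemma bilinE A u v : bilin A u v = \sum_a \sum_b u ord0 a * A a b * v ord0 b.
Proof.
rewrite /bilin mxE exchange_big; apply: eq_bigr => b _.
by rewrite mxE mulr_suml; apply: eq_bigr => a _; rewrite mxE.
Qed.

Lemma bilinDl A u v w : bilin A (u + v) w = bilin A u w + bilin A v w.
Proof. by rewrite /bilin !mulmxDl mxE. Qed.

Lemma bilinDr A u v w : bilin A u (v + w) = bilin A u v + bilin A u w.
Proof. by rewrite /bilin linearD mulmxDr mxE. Qed.

Lemma bilinZl A k u v : bilin A (k *: u) v = k * bilin A u v.
Proof. by rewrite /bilin -!scalemxAl mxE. Qed.

Lemma bilinZr A k u v : bilin A u (k *: v) = k * bilin A u v.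
Proof. by rewrite /bilin linearZ -!scalemxAr mxE. Qed.

Lemma bilinBmx A B u v : bilin (A - B) u v = bilin A u v - bilin B u v.
Proof. by rewrite /bilin mulmxBr mulmxBl mxE [in X in _ + X]mxE. Qed.

Lemma bilinC A u v : A^T = A -> bilin A u v = bilin A v u.
Proof.
move=> As; rewrite /bilin; have -> : u *m A *m v^T = (v *m A *m u^T)^T.
  by rewrite !trmx_mul trmxK As mulmxA.
by rewrite mxE.
Qed.

Lemma bilin0l A v : bilin A 0 v = 0.
Proof. by rewrite -(scale0r 0) bilinZl mul0r. Qed.

Lemma bilin_le A v k : 0 <= k -> (forall a b, `|A a b| <= k) ->
  `|bilin A v v| <= n%:R ^+ 2 * k * `|v| ^+ 2.
Proof.
move=> k0 Ak; rewrite bilinE; apply: le_trans (ler_norm_sum _ _ _) _.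
have h : \sum_(a < n) `|\sum_b v ord0 a * A a b * v ord0 b| <=
    \sum_(a < n) \sum_(b < n) `|v| * k * `|v|.
  apply: ler_sum => a _; apply: le_trans (ler_norm_sum _ _ _) _.
  apply: ler_sum => b _; rewrite !normrM; apply: ler_pM => //.
  - by apply: ler_pM => //; exact: coord_le_norm.
  - exact: coord_le_norm.
apply: le_trans h _; rewrite !sumr_const card_ord -mulrnA -[leLHS]mulr_natr natrM.
by rewrite le_eqVlt; apply/orP; left; apply/eqP; ring.
Qed.

Definition mnorm A v := Num.sqrt (bilin A v v).

Definition spd_mx A := A^T = A /\ forall v, v != 0 -> 0 < bilin A v v.

Section Spd.
Variable A : 'M[R]_n.
Hypothesis hA : spd_mx A.

Lemma bilin_ge0 v : 0 <= bilin A v v.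
Proof.
have [->|v0] := eqVneq v 0; first by rewrite bilin0l.
by case: hA => _ /(_ v v0)/ltW.
Qed.

Lemma mnorm_ge0 v : 0 <= mnorm A v.
Proof. exact: sqrtr_ge0. Qed.

Lemma mnorm_sq v : mnorm A v ^+ 2 = bilin A v v.
Proof. by rewrite sqr_sqrtr// bilin_ge0. Qed.

Lemma mnormZ k v : mnorm A (k *: v) = `|k| * mnorm A v.
Proof.
rewrite /mnorm bilinZl bilinZr mulrA -expr2 sqrtrM ?sqr_ge0//.
by rewrite sqrtr_sqr.
Qed.

Lemma mnormN v : mnorm A (- v) = mnorm A v.
Proof. by rewrite -scaleN1r mnormZ normrN1 mul1r. Qed.

Lemma mnorm0 : mnorm A 0 = 0.
Proof. by rewrite /mnorm bilin0l sqrtr0. Qed.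

Lemma bilinDD u v : bilin A (u + v) (u + v) =
  bilin A u u + 2 * bilin A u v + bilin A v v.
Proof.
rewrite !bilinDl !bilinDr (bilinC v u); last by case: hA.
ring.
Qed.

Lemma cauchy_schwarz u v : `|bilin A u v| <= mnorm A u * mnorm A v.
Proof.
have [->|v0] := eqVneq v 0.
  by rewrite bilinC; [rewrite bilin0l normr0 mulr_ge0// mnorm_ge0|case: hA].
have qv : 0 < bilin A v v by case: hA => _; apply.
have := bilin_ge0 (u + (- (bilin A u v / bilin A v v)) *: v).
rewrite bilinDD !bilinZr !bilinZl => h.
rewrite -(@ler_pXn2r _ 2)// ?nnegrE ?mulr_ge0 ?mnorm_ge0// exprMn !mnorm_sq.
rewrite -normrX ger0_norm ?sqr_ge0//.
have e : bilin A u v / bilin A v v * bilin A v v = bilin A u v.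
  by rewrite divfK// gt_eqF.
move: h e; set k := bilin A u v / _; move: (bilin A u v) (bilin A v v) (bilin A u u) qv.
move=> p V U V0 h e; rewrite -e in h *.
have h' : 0 <= U - k ^+ 2 * V by move: h; lra.
have := mulr_ge0 h' (ltW V0); nra.
Qed.

Lemma mnormD u v : mnorm A (u + v) <= mnorm A u + mnorm A v.
Proof.
rewrite -(@ler_pXn2r _ 2)// ?nnegrE ?addr_ge0 ?mnorm_ge0//.
rewrite mnorm_sq bilinDD sqrrD !mnorm_sq.
have := le_trans (ler_norm _) (cauchy_schwarz u v).
move: (bilin A u v) (_ * _) => p q; lra.
Qed.

Lemma spd_unitmx : A \in unitmx.
Proof.
rewrite -row_free_unit -kermx_eq0; apply/eqP/row_matrixP => k.
rewrite row0; apply/eqP; apply: contraT => /hA.2.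
by rewrite /bilin -row_mul mulmx_ker row0 mul0mx mxE ltxx.
Qed.

(* Cauchy-Schwarz against the rows of the inverse matrix bounds coordinates. *)
Lemma mnorm_ge_norm : exists2 m, 0 < m & forall v, m * `|v| <= mnorm A v.
Proof.
pose w (a : 'I_n) := row a (invmx A).
have wE v a : bilin A v (w a) = v ord0 a.
  rewrite /bilin /w tr_row trmx_inv (proj1 hA) colE mulmxA mulmxK ?spd_unitmx//.
  by rewrite -colE mxE.
pose s := \sum_a mnorm A (w a).
have s0 : 0 <= s by apply: sumr_ge0 => a _; exact: mnorm_ge0.
have s1 : 0 < 1 + s by rewrite ltr_pwDl.
exists (1 + s)^-1; first by rewrite invr_gt0.
move=> v; rewrite ler_pdivrMl//; apply/norm_row_leP.
  by rewrite mulr_ge0 ?mnorm_ge0// ltW.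
move=> a; rewrite -wE; apply: le_trans (cauchy_schwarz _ _) _.
rewrite mulrC ler_wpM2r ?mnorm_ge0//.
rewrite /s (bigD1 a)//= addrCA lerDl addr_ge0//.
by apply: sumr_ge0 => b _; exact: mnorm_ge0.
Qed.

(** Stewart's theorem on cevians. It turns near equality in the triangle inequality into closeness
    of directions. *)
Lemma stewart (t : R) u v :
  bilin A ((1 - t) *: u + t *: v) ((1 - t) *: u + t *: v) =
  (1 - t) * bilin A u u + t * bilin A v v - t * (1 - t) * bilin A (u - v) (u - v).
Proof.
rewrite -[- v]scaleN1r !bilinDD !bilinZr !bilinZl; ring.
Qed.

End Spd.
End Bilinear.

(** * Local constants that control the metric *)

Section FiniteConstants.
Context {R : realType}.

Lemma fin_constants (I : finType) (P : I -> R -> R -> Prop) :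
  (forall i, exists r C, [/\ 0 < r, 0 < C & P i r C]) ->
  (forall i r r' C C', 0 < r' <= r -> C <= C' -> P i r C -> P i r' C') ->
  exists r C, [/\ 0 < r, 0 < C & forall i, P i r C].
Proof.
move=> ex mon.
suff [r [C [r0 C0 h]]] : exists r C, [/\ 0 < r, 0 < C &
    forall i, i \in enum I -> P i r C].
  by exists r, C; split => // i; apply: h; rewrite mem_enum.
elim: (enum I) => [|i s [r [C [r0 C0 h]]]].
  by exists 1, 1; split.
have [ri [Ci [ri0 Ci0 hi]]] := ex i.
exists (Num.min r ri), (Num.max C Ci); split.
- by rewrite lt_min r0.
- by rewrite lt_max C0.
move=> j; rewrite inE => /orP[/eqP->|/h].
  by apply: mon hi; rewrite ?lt_min ?r0 ?ri0 ?ge_min ?lexx ?orbT// le_max lexx orbT.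
by apply: mon; rewrite ?lt_min ?r0 ?ri0 ?ge_min ?lexx// le_max lexx.
Qed.

End FiniteConstants.

Section GoodBalls.
Context {R : realType} {n : nat} {M : topologicalType}.
Variables (X : smooth_atlas R n M) (g : riem_metric X).
Local Notation img := (@chart_img _ _ _ X).

Lemma metric_spd i x : img i x -> spd_mx (g i x).
Proof. by move=> ix; split; [exact: (Defs.metric_sym g)|move=> v; exact: (metric_pos g ix)]. Qed.

Lemma img_open i : open (img i).
Proof. exact: chart_img_open. Qed.

(* On the cube of radius [r] around [x0] the constant [C] controls the metric in
   chart [i], its oscillation and its first two derivatives. *)
Record good_ball i (x0 : 'rV[R]_n) (r C : R) : Prop := GoodBall {
  gb_r : 0 < r;
  gb_C : 0 < C;
  gb_img : cball x0 r `<=` img i;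
  gb_lower : forall x v, cball x0 r x -> `|v| <= C * mnorm (g i x) v;
  gb_upper : forall x v, cball x0 r x -> mnorm (g i x) v <= C * `|v|;
  gb_osc : forall x y v, cball x0 r x -> cball x0 r y ->
    mnorm (g i y) v <= (1 + C * `|x - y|) * mnorm (g i x) v;
  gb_coef : forall x y a b, cball x0 r x -> cball x0 r y ->
    `|g i x a b| <= C /\ `|g i x a b - g i y a b| <= C * `|x - y|;
  gb_dcoef : forall x y a b c, cball x0 r x -> cball x0 r y ->
    `|partial c (fun z => g i z a b) x| <= C /\
    `|partial c (fun z => g i z a b) x - partial c (fun z => g i z a b) y|
       <= C * `|x - y| }.

Lemma good_ball_coef i x0 : img i x0 -> exists r C, [/\ 0 < r, 0 < C &
  cball x0 r `<=` img i /\ forall ab : 'I_n * 'I_n, forall x y, cball x0 r x -> cball x0 r y ->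
    `|g i x ab.1 ab.2| <= C /\
    `|g i x ab.1 ab.2 - g i y ab.1 ab.2| <= C * `|x - y|].
Proof.
move=> ix0.
have [||r [C [r0 C0 h]]] := @fin_constants R ('I_n * 'I_n)%type (fun ab r C =>
  forall x y, cball x0 r x -> cball x0 r y -> `|g i x ab.1 ab.2| <= C /\
    `|g i x ab.1 ab.2 - g i y ab.1 ab.2| <= C * `|x - y|).
- move=> [a b] /=.
  have [r [C [r0 C0 rA h1 h2]]] := C1_lipschitz (img_open (i := i)) ix0
    (comp_smooth g i a b 1%N).
  by exists r, C; split => // x y hx hy; split; [have [] := h1 _ hx|exact: h2].
- move=> [a b] r r' C C' /andP[_ rr] CC h x y hx hy /=.
  have [h1 h2] := h x y (cball_sub rr hx) (cball_sub rr hy).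
  split; first exact: le_trans h1 CC.
  by apply: le_trans h2 _; rewrite ler_wpM2r.
have [r1 r10 hr1] : exists2 r, 0 < r & cball x0 r `<=` img i.
  by apply: nbhs_cball; apply: open_nbhs_nbhs; split => //; exact: img_open.
exists (Num.min r r1), C; split => //; first by rewrite lt_min r0.
split=> [x hx|ab x y hx hy].
  by apply: hr1; apply: cball_sub hx; rewrite ge_min lexx orbT.
by apply: h; [apply: cball_sub hx|apply: cball_sub hy]; rewrite ge_min lexx.
Qed.

Lemma good_ball_dcoef i x0 : img i x0 -> exists r C, [/\ 0 < r, 0 < C &
  forall abc : 'I_n * 'I_n * 'I_n, forall x y, cball x0 r x -> cball x0 r y ->
    `|partial abc.2 (fun z => g i z abc.1.1 abc.1.2) x| <= C /\
    `|partial abc.2 (fun z => g i z abc.1.1 abc.1.2) x -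
      partial abc.2 (fun z => g i z abc.1.1 abc.1.2) y| <= C * `|x - y|].
Proof.
move=> ix0; apply: fin_constants.
- move=> [[a b] c] /=.
  have [r [C [r0 C0 rA h1 h2]]] := C1_lipschitz (img_open (i := i)) ix0
    ((comp_smooth g i a b 2%N).2 (delta_mx 0 c)).
  by exists r, C; split => // x y hx hy; split; [have [] := h1 _ hx|exact: h2].
- move=> [[a b] c] r r' C C' /andP[_ rr] CC h x y hx hy /=.
  have [h1 h2] := h x y (cball_sub rr hx) (cball_sub rr hy).
  split; first exact: le_trans h1 CC.
  by apply: le_trans h2 _; rewrite ler_wpM2r.
Qed.

Lemma good_ball_exists i x0 : img i x0 -> exists r C, good_ball i x0 r C.
Proof.
move=> ix0; have [r1 [C1 [r10 C10 [h1i h1]]]] := good_ball_coef ix0.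
have [r2 [C2 [r20 C20 h2]]] := good_ball_dcoef ix0.
have [m m0 hm] := mnorm_ge_norm (metric_spd ix0).
pose k := n%:R ^+ 2 * C1 + 1.
have k0 : 0 < k by rewrite ltr_wpDl// mulr_ge0 ?sqr_ge0// ltW.
have osc x y v : cball x0 r1 x -> cball x0 r1 y ->
    `|bilin (g i x) v v - bilin (g i y) v v| <= k * `|x - y| * `|v| ^+ 2.
  move=> hx hy; rewrite -bilinBmx; apply: le_trans (bilin_le (k := C1 * `|x - y|) _ _ _) _.
  - by rewrite mulr_ge0// ltW.
  - by move=> a b; rewrite !mxE; have [] := h1 (a, b) _ _ hx hy.
  - apply: ler_wpM2r; first exact: sqr_ge0.
    by rewrite mulrA ler_wpM2r// /k lerDl.
(* The last bound makes the oscillation of the form at most half of its lower bound [m ^+ 2] at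
   [x0]. *)
pose r := Num.min (Num.min r1 r2) (m ^+ 2 / (2 * k)).
have r0 : 0 < r by rewrite !lt_min r10 r20 divr_gt0 ?exprn_gt0// mulr_gt0.
have s1 : cball x0 r `<=` cball x0 r1 by apply: cball_sub; rewrite !ge_min lexx.
have s2 : cball x0 r `<=` cball x0 r2 by apply: cball_sub; rewrite !ge_min lexx !orbT.
have low x v : cball x0 r x -> m ^+ 2 / 2 * `|v| ^+ 2 <= bilin (g i x) v v.
  move=> hx; have hx0 : cball x0 r1 x0 by rewrite /cball/= subrr normr0 ltW.
  have := osc x x0 v (s1 _ hx) hx0; rewrite ler_norml => /andP[+ _].
  have : (m * `|v|) ^+ 2 <= bilin (g i x0) v v.
    rewrite -(mnorm_sq (metric_spd ix0)) ler_pXn2r ?nnegrE ?mnorm_ge0//.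
    by rewrite mulr_ge0// ltW.
  have : k * `|x - x0| * `|v| ^+ 2 <= m ^+ 2 / 2 * `|v| ^+ 2.
    apply: ler_wpM2r; first exact: sqr_ge0.
    have : `|x - x0| <= m ^+ 2 / (2 * k).
      by apply: le_trans hx _; rewrite !ge_min lexx !orbT.
    rewrite ler_pdivlMr ?mulr_gt0//; lra.
  rewrite exprMn; lra.
have low' x v : cball x0 r x -> m / 2 * `|v| <= mnorm (g i x) v.
  move=> hx; have ix := h1i _ (s1 _ hx).
  rewrite -(@ler_pXn2r _ 2)// ?nnegrE ?mnorm_ge0 ?mulr_ge0 ?divr_ge0 ?(ltW m0)//.
  rewrite (mnorm_sq (metric_spd ix)); apply: le_trans (low x v hx).
  rewrite !exprMn ler_wpM2r ?sqr_ge0// ler_wpM2l ?sqr_ge0//.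
  by rewrite exprVn lef_pV2 ?posrE// expr2; lra.
(* After the 1, the summands serve in turn the lower bound, the upper bound, the coefficients, their
   derivatives and the oscillation. *)
pose c := 1 + 2 / m + (n%:R ^+ 2 * C1 + 1) + C1 + C2 + 4 * k / m ^+ 2.
have cp1 : 0 < 2 / m by rewrite divr_gt0.
have cp2 : 0 <= n%:R ^+ 2 * C1 by rewrite mulr_ge0 ?sqr_ge0// ltW.
have cp3 : 0 < 4 * k / m ^+ 2 by rewrite divr_gt0 ?exprn_gt0// mulr_gt0.
have c0 : 0 <= c by rewrite /c; lra.
exists r, c; split => //.
- by rewrite /c; lra.
- by move=> x hx; apply: h1i; exact: s1.
- move=> x v hx; have := low' x v hx; rewrite -ler_pdivlMl ?divr_gt0//.
  move=> /le_trans; apply; rewrite invf_div ler_wpM2r ?mnorm_ge0//.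
  by rewrite /c; lra.
- move=> x v hx; have ix := h1i _ (s1 _ hx).
  rewrite -(@ler_pXn2r _ 2)// ?nnegrE ?mnorm_ge0 ?mulr_ge0//.
  rewrite (mnorm_sq (metric_spd ix)); apply: le_trans (ler_norm _) _.
  apply: le_trans (bilin_le v (ltW C10) _) _.
    by move=> a b; have [] := h1 (a, b) _ _ (s1 _ hx) (s1 _ hx).
  rewrite exprMn ler_wpM2r ?sqr_ge0//.
  have : n%:R ^+ 2 * C1 <= c /\ 1 <= c by rewrite /c; lra.
  move=> []; rewrite expr2; nra.
- move=> x y v hx hy; have ix := h1i _ (s1 _ hx); have iy := h1i _ (s1 _ hy).
  have d0 : 0 <= `|x - y| by [].
  rewrite -(@ler_pXn2r _ 2)// ?nnegrE ?mulr_ge0 ?mnorm_ge0 ?addr_ge0 ?mulr_ge0//.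
  rewrite exprMn !mnorm_sq; [|exact: metric_spd..].
  have := osc y x v (s1 _ hy) (s1 _ hx); rewrite ler_norml => /andP[_].
  have lo := low x v hx; rewrite [`|y - x|]distrC.
  have kc : 4 * k / m ^+ 2 <= c by rewrite /c; lra.
  rewrite ler_pdivrMr ?exprn_gt0// in kc.
  have q0 := bilin_ge0 (metric_spd ix) v; have V0 := sqr_ge0 `|v|.
  move: lo kc q0 V0 c0 d0 k0.
  move: (bilin _ _ _) (bilin _ _ _) (`|v| ^+ 2) (m ^+ 2) `|x - y| => p q V m2 d.
  move=> lo kc q0 V0 cc0 dd0 kk0 hi.
  have h1' : c * (m2 / 2 * V) <= c * q by rewrite ler_wpM2l.
  have h2' : 4 * k * V <= c * m2 * V by rewrite ler_wpM2r.
  have kV : 0 <= k * V by rewrite mulr_ge0// ltW.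
  have h3 : k * V <= c * q by lra.
  have h4 : k * V * d <= c * q * d by rewrite ler_wpM2r.
  have h5 : 0 <= c * q * d by rewrite !mulr_ge0.
  have h6 : 0 <= (c * d) ^+ 2 * q by rewrite mulr_ge0// sqr_ge0.
  lra.
- move=> x y a b hx hy; have [h3 h4] := h1 (a, b) _ _ (s1 _ hx) (s1 _ hy).
  split; first by apply: le_trans h3 _; rewrite /c; lra.
  by apply: le_trans h4 _; rewrite ler_wpM2r// /c; lra.
- move=> x y a b e hx hy; have [h3 h4] := h2 (a, b, e) _ _ (s2 _ hx) (s2 _ hy).
  split; first by apply: le_trans h3 _; rewrite /c; lra.
  by apply: le_trans h4 _; rewrite ler_wpM2r// /c; lra.
Qed.

Lemma good_ball_shrink i x0 r r' C : good_ball i x0 r C -> 0 < r' <= r ->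
  good_ball i x0 r' C.
Proof.
move=> [r0 C0 h1 h2 h3 h4 h5 h6] /andP[r'0 /(@cball_sub _ _ x0) s]; split => //.
- by move=> x /s/h1.
- by move=> x v /s; exact: h2.
- by move=> x v /s; exact: h3.
- by move=> x y v /s hx /s hy; exact: h4.
- by move=> x y a b /s hx /s hy; exact: h5.
- by move=> x y a b c /s hx /s hy; exact: h6.
Qed.

End GoodBalls.

Lemma diff_eps (R : realType) (V W : normedModType R) (f : V -> W) x e :
  differentiable f x -> 0 < e ->
  \forall y \near x, `|f y - f x - 'd f x (y - x)| <= e * `|y - x|.
Proof.
move=> /diff_locally /eqaddoP /(_ e) h e0.
have {}h := h e0.
have : {for x, continuous (fun y : V => y - x)}.
  by apply: ctsB; [exact: ctsid|exact: ctsC].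
rewrite /prop_for /continuous_at subrr.
move=> /(_ _ h) h1; apply: (@filterS _ (nbhs x) _ _ _ _ h1) => y.
have e1 : (f \o shift x - (cst (f x) + 'd f x)) (y - x) =
    f y - f x - 'd f x (y - x).
  rewrite -[LHS]/(f (y - x + x) - (f x + 'd f x (y - x))).
  by rewrite subrK opprD addrA.
by rewrite -e1.
Qed.

(** * Induction along a segment and the mean value inequality *)

Section RealInduction.
Context {R : realType}.

(** Take the supremum of the times up to which [P] holds throughout. The hypothesis carries [P] to
    [t] from the left and from [t] to the right, which is what a compactness argument along a curve
    would use. *)
Lemma real_induction (P : R -> Prop) (a b : R) : a <= b -> P a ->
  (forall t, a <= t <= b -> exists2 d, 0 < d &
     (forall s, a <= s < t -> t - d < s -> P s -> P t) /\
     (P t -> forall s, t < s <= b -> s < t + d -> P s)) ->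
  P b.
Proof.
move=> ab Pa H.
pose S := [set t | a <= t <= b /\ forall s, a <= s <= t -> P s].
have Sa : S a.
  split=> [|s /andP[h1 h2]]; first by rewrite lexx ab.
  by have -> : s = a by apply/eqP; rewrite eq_le h1 h2.
have supS : has_sup S.
  by split; [exists a|exists b => t [/andP[]]].
set u := sup S.
have ub t : S t -> t <= u by move=> St; exact: (sup_upper_bound supS).
have au : a <= u by exact: ub.
have ub' : u <= b by apply: ge_sup; [exists a|move=> t [/andP[]]].
have [d d0 [Hl Hr]] := H u (introT andP (conj au ub')).
have below s : a <= s < u -> P s.
  move=> /andP[as_ su]; have : 0 < u - s by rewrite subr_gt0.
  move=> /(sup_adherent)/(_ supS)[t [_ St]]; rewrite -/u opprB addrC subrK => st.
  by apply: St; rewrite as_ ltW.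
have Pu : P u.
  move: au; rewrite le_eqVlt => /orP[/eqP<-//|au'].
  pose s := Num.max a (u - d / 2).
  have asu : a <= s < u.
    by rewrite /s le_max lexx/= gt_max au' ltrBlDr ltrDl divr_gt0.
  apply: (Hl s) => //; last exact: below.
  rewrite /s lt_max; apply/orP; right.
  by rewrite ltrD2l ltrN2 ltr_pdivrMr// mulr_natr mulr2n ltrDl.
have Su : S u.
  split=> [|s /andP[h1]]; first by rewrite au ub'.
  by rewrite le_eqVlt => /orP[/eqP->//|h2]; apply: below; rewrite h1.
move: ub'; rewrite le_eqVlt => /orP[/eqP<-//|ub''].
pose v := Num.min b (u + d / 2).
have uv : u < v by rewrite /v lt_min ub'' ltrDl divr_gt0.
have vd : v < u + d.
  rewrite /v gt_min; apply/orP; right.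
  by rewrite ltrD2l ltr_pdivrMr// mulr_natr mulr2n ltrDl.
have vb : v <= b by rewrite /v ge_min lexx.
have : S v.
  split=> [|s /andP[h1 h2]]; first by rewrite vb andbT (le_trans au)// ltW.
  have [su|us] := leP s u; first by case: Su => _; apply; rewrite h1.
  by apply: Hr => //; [rewrite us (le_trans h2)|exact: le_lt_trans vd].
by move=> /ub; rewrite leNgt uv.
Qed.

Lemma near_delta (t : R) (A : R -> Prop) : (\forall s \near t, A s) ->
  exists2 d, 0 < d & forall s, `|s - t| < d -> A s.
Proof.
move=> /nbhs_ballP[d /= d0 h]; exists d => // s hs; apply: h.
by rewrite -ball_normE /= distrC.
Qed.

Lemma delta_near (t : R) (A : R -> Prop) d : 0 < d ->
  (forall s, `|s - t| < d -> A s) -> \forall s \near t, A s.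
Proof.
move=> d0 h; apply/nbhs_ballP; exists d => //= s.
by rewrite -ball_normE /= distrC; exact: h.
Qed.

Context {n : nat}.

(** No differentiability is assumed: the local bound on difference quotients is propagated by real
    induction with a fixed slack [e], which then tends to zero. *)
Lemma mean_value (A : 'M[R]_n) (w : R -> 'rV[R]_n) (a b K : R) :
  spd_mx A -> a <= b ->
  (forall t e, a <= t <= b -> 0 < e -> \forall s \near t, a <= s <= b ->
     mnorm A (w s - w t) <= (K + e) * `|s - t|) ->
  mnorm A (w b - w a) <= K * (b - a).
Proof.
move=> hA ab H.
suff h e : 0 < e -> mnorm A (w b - w a) <= (K + e) * (b - a).
  move: ab; rewrite le_eqVlt => /orP[/eqP ab|ab].
    by rewrite ab !subrr mulr0 mnorm0.
  apply/ler_addgt0Pr => e e0.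
  have ba : 0 < b - a by rewrite subr_gt0.
  have := h (e / (b - a)) (divr_gt0 e0 ba); rewrite mulrDl.
  by rewrite divfK// gt_eqF.
move=> e0; apply: (@real_induction (fun t => mnorm A (w t - w a) <= (K + e) * (t - a)) a b ab).
  by rewrite !subrr mulr0 mnorm0.
move=> t tab; have [d d0 hd] := near_delta (H t e tab e0).
move/andP: (tab) => [at_ tb].
exists d => //; split=> [s /andP[as_ st] sd Ps|Pt s /andP[ts sb] sd].
  have -> : w t - w a = - (w s - w t) + (w s - w a).
    by rewrite opprB addrA subrK.
  apply: le_trans (mnormD hA _ _) _; rewrite mnormN//.
  have st' : `|s - t| = t - s by rewrite distrC ger0_norm// subr_ge0 ltW.
  have := hd s _ _; rewrite st' => /(_ _ _)/= h1.
  have : mnorm A (w s - w t) <= (K + e) * (t - s).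
    by apply: h1; [move: sd; lra|rewrite as_/= (le_trans (ltW st))].
  move: Ps; lra.
have -> : w s - w a = (w s - w t) + (w t - w a) by rewrite addrA subrK.
apply: le_trans (mnormD hA _ _) _.
have st' : `|s - t| = s - t by rewrite ger0_norm// subr_ge0 ltW.
have : mnorm A (w s - w t) <= (K + e) * (s - t).
  rewrite -st'; apply: hd; first by rewrite st'; move: sd; lra.
  by rewrite sb andbT (le_trans at_)// ltW.
move: Pt; lra.
Qed.

End RealInduction.

(** * Curves of bounded speed *)

Section Speed.
Context {R : realType} {n : nat} {M : topologicalType}.
Variables (X : smooth_atlas R n M) (g : riem_metric X).
Local Notation img := (@chart_img _ _ _ X).
Local Notation dom := (@chart_dom _ _ _ X).
Local Notation ph := (@chart _ _ _ X).
Local Notation ps := (@chart_inv _ _ _ X).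
Implicit Types (c : R -> M) (i j : chart_index X).

Lemma chart_img_in i q : dom i q -> img i (ph i q).
Proof. by move=> iq; exists q. Qed.

Lemma chart_invK i x : img i x -> ph i (ps i x) = x.
Proof. by move=> [q iq <-]; rewrite chartK//; exact/mem_set. Qed.

Lemma chart_inv_dom i x : img i x -> dom i (ps i x).
Proof. by move=> [q iq <-]; rewrite chartK//; exact/mem_set. Qed.

Lemma chartKd i q : dom i q -> ps i (ph i q) = q.
Proof. by move=> iq; rewrite chartK//; exact/mem_set. Qed.

Lemma chart_cts i q : dom i q -> {for q, continuous (ph i)}.
Proof. by move=> iq; apply: chart_continuous; exact/mem_set. Qed.

Lemma chart_inv_cts i x : img i x -> {for x, continuous (ps i)}.
Proof. by move=> ix; apply: chart_inv_continuous; exact/mem_set. Qed.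

Lemma near_dom c i t : {for t, continuous c} -> dom i (c t) ->
  \forall s \near t, dom i (c s).
Proof.
by move=> cc ct; apply: cc; apply: open_nbhs_nbhs; split=> //; exact: chart_dom_open.
Qed.

Lemma chart_curve_cts c i t : {for t, continuous c} -> dom i (c t) ->
  {for t, continuous (fun s => ph i (c s))}.
Proof. by move=> cc ct; apply: ctscomp => //; exact: chart_cts. Qed.

(* The metric is frozen at [c t]; no differentiability of [c] is required. *)
Definition speed_at (S : set R) c i (K t : R) :=
  forall e, 0 < e -> \forall s \near t, S s ->
    mnorm (g i (ph i (c t))) (ph i (c s) - ph i (c t)) <= (K + e) * `|s - t|.

Lemma differentiable_transition i j q : dom i q -> dom j q ->
  differentiable (transition i j) (ph i q).
Proof.
move=> iq jq; have [h _] := @transition_smooth _ _ _ X i j 1%N.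
by apply: h; exists q.
Qed.

Lemma bilin_transition i j q v : dom i q -> dom j q ->
  bilin (g j (ph j q)) ('d (transition i j) (ph i q) v)
                       ('d (transition i j) (ph i q) v) =
  bilin (g i (ph i q)) v v.
Proof.
move=> iq jq; have E : transition i j (ph i q) = ph j q.
  by rewrite /transition /= chartKd.
have hx : (ph i @` (dom i `&` dom j)) (ph i q) by exists q.
rewrite (comp_transition g hx) E.
have -> : 'd (transition i j) (ph i q) v = v *m 'J (transition i j) (ph i q).
  have d := differentiable_transition iq jq.
  by rewrite -deriveE// deriveEjacobian.
by rewrite /bilin trmx_mul !mulmxA.
Qed.

(** The differential of the transition map is an isometry for the two frozen metrics, and its
    remainder is absorbed by the slack. *)
Lemma speed_at_chart (S : set R) c i j K t : 0 <= K -> {for t, continuous c} ->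
  dom i (c t) -> dom j (c t) -> speed_at S c i K t -> speed_at S c j K t.
Proof.
move=> K0 cc it jt H e e0; set T := transition i j; set x := ph i (c t).
have dT : differentiable T x by exact: differentiable_transition.
have [r1 [C1 B1]] := good_ball_exists g (chart_img_in it).
have [r2 [C2 B2]] := good_ball_exists g (chart_img_in jt).
have C10 := gb_C B1; have C20 := gb_C B2.
have z1 : cball x r1 x by rewrite /cball/= subrr normr0 ltW// (gb_r B1).
have z2 : cball (ph j (c t)) r2 (ph j (c t)).
  by rewrite /cball/= subrr normr0 ltW// (gb_r B2).
have hA := metric_spd g (chart_img_in jt).

(* Half of the slack is spent on the given chart; the remainder costs [e'] times a speed of
   [K + e / 2], at most the other half. *)
pose e' := e / (2 * (K + e)).
have Ke : 0 < K + e by rewrite ltr_wpDl.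
have e'0 : 0 < e' by rewrite divr_gt0// mulr_gt0.
pose d := e' / (C1 * C2).
have d0 : 0 < d by rewrite divr_gt0// mulr_gt0.
have e20 : 0 < e / 2 by rewrite divr_gt0.
have dE : e' = C2 * d * C1 by rewrite /d; field; rewrite !gt_eqF.
have ee : e' * (K + e / 2) <= e / 2.
  rewrite /e' mulrAC ler_pdivrMr ?mulr_gt0//.
  have : 0 <= e * K by rewrite mulr_ge0// ltW.
  have : 0 < e * e by rewrite mulr_gt0.
  lra.
clearbody d e'.
have Tn := diff_eps dT d0.
have wc := chart_curve_cts cc it.
have h1 : \forall s \near t, `|T (ph i (c s)) - T x - 'd T x (ph i (c s) - x)|
    <= d * `|ph i (c s) - x| by exact: (wc _ Tn).
have h2 := H _ e20; have h3 := near_dom cc it.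
apply: filterS3 h1 h2 h3 => s h1 h2 h3 Ss; have {}h2 := h2 Ss.
have Ts : T (ph i (c s)) = ph j (c s) by rewrite /T /transition /= chartKd.
have Tx : T x = ph j (c t) by rewrite /T /transition /= chartKd.
rewrite Ts Tx in h1; set v := ph i (c s) - x in h1 h2 *.
set w := ph j (c s) - ph j (c t) in h1 *.
have -> : w = (w - 'd T x v) + 'd T x v by rewrite subrK.
apply: le_trans (mnormD hA _ _) _.
have -> : mnorm (g j (ph j (c t))) ('d T x v) = mnorm (g i x) v.
  by rewrite /mnorm bilin_transition.
have {h1} : mnorm (g j (ph j (c t))) (w - 'd T x v) <= e' * mnorm (g i x) v.
  apply: le_trans (gb_upper B2 _ z2) _.
  apply: le_trans (ler_wpM2l (ltW C20) h1) _.
  rewrite dE.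
  rewrite -!mulrA ler_wpM2l ?(ltW C20)// ler_wpM2l ?(ltW d0)//.
  exact: (gb_lower B1 _ z1).
move: (mnorm _ (w - _)) (mnorm _ v) h2 (normr_ge0 (s - t)) => a b hb st ha.
have hb' : e' * b <= e' * ((K + e / 2) * `|s - t|) by rewrite ler_wpM2l// ltW.
have := ler_wpM2r st ee; lra.
Qed.

(** Only times in [[a, b]] are compared, one-sidedly at the ends, so that arcs can be glued; the
    curve itself is continuous on the whole line. *)
Definition speed_le (K a b : R) c := continuous c /\
  forall t i, a <= t <= b -> dom i (c t) ->
    speed_at [set s | a <= s <= b] c i K t.

Lemma speed_leP (K a b : R) c : 0 <= K -> continuous c ->
  (forall t, a <= t <= b -> exists2 i, dom i (c t) &
    speed_at [set s | a <= s <= b] c i K t) -> speed_le K a b c.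
Proof.
move=> K0 cc H; split=> // t i tab it; have [j jt hj] := H t tab.
by apply: speed_at_chart hj => //; exact: cc.
Qed.

Lemma speed_leW (K K' a b : R) c : K <= K' -> speed_le K a b c -> speed_le K' a b c.
Proof.
move=> KK [cc H]; split => // t i tab it e e0.
apply: filterS (H t i tab it e e0) => s hs Ss; apply: le_trans (hs Ss) _.
by rewrite ler_wpM2r// lerD2r.
Qed.

Lemma eq_speed_le (K a b : R) c c' : continuous c' ->
  (forall t, a <= t <= b -> c t = c' t) -> speed_le K a b c -> speed_le K a b c'.
Proof.
move=> c'c cE [cc H]; split => // t i tab; rewrite -cE// => it e e0.
apply: filterS (H t i tab it e e0) => s hs Ss; rewrite -!cE//; exact: hs.
Qed.

Lemma speed_le_glue (K a b e : R) c c' : 0 <= K -> c b = c' b ->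
  a <= b <= e -> speed_le K a b c -> speed_le K b e c' ->
  speed_le K a e (glue c c' b).
Proof.
move=> K0 cb /andP[ab be] [cc H] [c'c H']; have gc := glue_continuous cc c'c cb.
split => // t i /andP[at_ te] it d d0.
have [tb|bt|tb] := ltgtP t b.
- have ct : glue c c' b t = c t by rewrite glueL// ltW.
  have tab : a <= t <= b by rewrite at_ ltW.
  rewrite ct in it *; have h1 := H t i tab it d d0.
  have h2 : \forall s \near t, s < b by exact: lt_nbhsl.
  apply: filterS2 h1 h2 => s h1 sb /= /andP[s1 s2].
  by rewrite glueL ?(ltW sb)//; apply: h1; rewrite /= s1 ltW.
- have ct : glue c c' b t = c' t by rewrite glueR// ltW.
  have tbe : b <= t <= e by rewrite te ltW.
  rewrite ct in it *; have h1 := H' t i tbe it d d0.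
  have h2 : \forall s \near t, b < s by exact: lt_nbhsr.
  apply: filterS2 h1 h2 => s h1 sb /= /andP[s1 s2].
  by rewrite glueR ?(ltW sb)//; apply: h1; rewrite /= s2 ltW.
- subst t; have ct : glue c c' b b = c b by rewrite glueL.
  rewrite ct in it *; have h1 := H b i (introT andP (conj ab (lexx b))) it d d0.
  rewrite cb in it.
  have h2 := H' b i (introT andP (conj (lexx b) be)) it d d0.
  apply: filterS2 h1 h2 => s h1 h2 /= /andP[s1 s2].
  have [sb|bs] := leP s b; first by rewrite glueL//; apply: h1; rewrite /= s1.
  by rewrite glueR ?(ltW bs)// cb; apply: h2; rewrite /= s2 ltW.
Qed.

(** The minimum and maximum allow negative [k], that is, reversal of time. *)
Lemma speed_le_affine (K a b k m : R) c : k != 0 -> 0 <= K ->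
  speed_le K (Num.min (k * a + m) (k * b + m)) (Num.max (k * a + m) (k * b + m)) c ->
  speed_le (`|k| * K) a b (fun t => c (k * t + m)).
Proof.
move=> k0 K0 [cc H]; split; first exact: cts_affine.
have kp : 0 < `|k| by rewrite normr_gt0.
have sub s : a <= s <= b -> Num.min (k * a + m) (k * b + m) <= k * s + m
   <= Num.max (k * a + m) (k * b + m).
  move=> /andP[s1 s2]; rewrite ge_min le_max !lerD2r.
  have [k1|k1] := leP 0 k.
    by rewrite (ler_wpM2l k1 s1) (ler_wpM2l k1 s2) orbT.
  by rewrite (ler_wnM2l (ltW k1) s1) (ler_wnM2l (ltW k1) s2) orbT.
move=> t i /sub tab it e e0.
have ek : 0 < e / `|k| by rewrite divr_gt0.
have h := H _ i tab it _ ek.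
have ac : {for t, continuous (fun t => k * t + m)}.
  by apply: ctsD; [apply: ctsM; [exact: ctsC|exact: ctsid]|exact: ctsC].
have {}h := ac _ h.
apply: (@filterS _ (nbhs t) _ _ _ _ h) => s hs /= /sub sab; apply: le_trans (hs sab) _.
have -> : k * s + m - (k * t + m) = k * (s - t) by ring.
rewrite normrM mulrA; apply: ler_wpM2r => //.
by rewrite mulrDl divfK ?gt_eqF// mulrC.
Qed.

End Speed.

(** * Curves inside coordinate cubes *)

Section ChartBalls.
Context {R : realType} {n : nat} {M : topologicalType}.
Variables (X : smooth_atlas R n M) (g : riem_metric X).
Hypothesis M_hausdorff : hausdorff_space M.
Local Notation img := (@chart_img _ _ _ X).
Local Notation dom := (@chart_dom _ _ _ X).
Local Notation ph := (@chart _ _ _ X).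
Local Notation ps := (@chart_inv _ _ _ X).
Implicit Types (c : R -> M) (i j : chart_index X).

Definition tball i (x0 : 'rV[R]_n) (r : R) : set M := [set q | dom i q /\ cball x0 r (ph i q)].

Lemma tball_sub i x0 r r' : r' <= r -> tball i x0 r' `<=` tball i x0 r.
Proof. by move=> rr q [iq]; split => //; exact: cball_sub rr _ _. Qed.

Lemma cball_compact (x0 : 'rV[R]_n) (r : R) : compact (cball x0 r).
Proof.
apply: bounded_closed_compact.
  exists (r + `|x0|); split; first exact: num_real.
  move=> k rk y hy; apply: ltW; apply: le_lt_trans rk.
  rewrite -(subrK x0 y); apply: le_trans (ler_normD _ _) _.
  by rewrite lerD2r.
rewrite (_ : cball x0 r = (fun y => `|y - x0|) @^-1` [set z | z <= r])//.
apply: closed_comp; last exact: closed_le.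
move=> y _; apply: (@ctscomp _ _ _ (fun y : 'rV[R]_n => y - x0) (fun z => `|z|)).
  by apply: ctsB; [exact: ctsid|exact: ctsC].
exact: norm_continuous.
Qed.

(** The image of a compact cube is closed because [M] is Hausdorff. This keeps a curve from leaving
    the chart while its coordinates stay bounded. *)
Lemma tball_closed i x0 r : cball x0 r `<=` img i -> closed (tball i x0 r).
Proof.
move=> sub; have -> : tball i x0 r = ps i @` cball x0 r.
  apply/seteqP; split=> [q [iq hq]|q [x hx <-]].
    by exists (ph i q) => //; exact: chartKd.
  by split; [exact: chart_inv_dom (sub _ hx)|rewrite chart_invK//; exact: sub].
apply: compact_closed => //; apply: continuous_compact; last exact: cball_compact.
apply: continuous_in_subspaceT => x /set_mem hx.
by apply: chart_inv_cts; exact: sub.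
Qed.

Lemma tball_nbhs i x0 r r' q : tball i x0 r' q -> r' < r -> nbhs q (tball i x0 r).
Proof.
move=> [iq hq] rr; have h1 : \forall p \near q, dom i p.
  by apply: open_nbhs_nbhs; split=> //; exact: chart_dom_open.
have h2 : \forall p \near q, cball x0 r (ph i p).
  apply: chart_cts => //; apply/nbhs_ballP; exists (r - r') => /=; first by rewrite subr_gt0.
  move=> y; rewrite -ball_normE /= => hy; rewrite /cball/=.
  rewrite -(subrK (ph i q) y) -addrA; apply: le_trans (ler_normD _ _) _.
  rewrite distrC; apply: ltW; rewrite -(subrK r' r).
  by apply: ltr_leD => //; move: hy.
by apply: filterS2 h1 h2 => p; split.
Qed.

Lemma tball_center i q r : 0 <= r -> dom i q -> tball i (ph i q) r q.
Proof. by move=> r0 iq; split => //; rewrite /cball/= subrr normr0. Qed.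

(** On an arc within [rho] of [z], freezing the metric at [z] costs the factor [1 + C * rho]. *)
Lemma chart_mean_value i x0 r C (K a b : R) c s t z rho : good_ball g i x0 r C ->
  0 <= K -> speed_le g K a b c -> a <= s -> s <= t -> t <= b -> cball x0 r z ->
  0 <= rho ->
  (forall u, s <= u <= t -> tball i x0 r (c u) /\ `|ph i (c u) - z| <= rho) ->
  mnorm (g i z) (ph i (c t) - ph i (c s)) <= (1 + C * rho) * K * (t - s).
Proof.
move=> B K0 [cc H] as_ st tb hz rho0 hc; have C0 := gb_C B.
have f0 : 0 < 1 + C * rho by rewrite ltr_pwDl// mulr_ge0// ltW.
apply: (@mean_value _ _ (g i z) (fun u => ph i (c u)) s t) => //; first by apply: metric_spd; exact: (gb_img B).
move=> u e /andP[su ut] e0.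
have [[iu hu] zu] := hc u (introT andP (conj su ut)).
have uab : a <= u <= b by rewrite (le_trans as_)//= (le_trans ut).
have e'0 : 0 < e / (1 + C * rho) by rewrite divr_gt0.
have h := H u i uab iu _ e'0; apply: filterS h => v hv /= /andP[sv vt].
have vab : a <= v <= b by rewrite (le_trans as_)//= (le_trans vt).
apply: le_trans (gb_osc B _ hu hz) _.
have -> : ((1 + C * rho) * K + e) * `|v - u| =
    (1 + C * rho) * ((K + e / (1 + C * rho)) * `|v - u|).
  by field; rewrite gt_eqF.
apply: ler_pM => //; last exact: hv.
- by rewrite addr_ge0// mulr_ge0// ltW.
- exact: mnorm_ge0.
- by rewrite lerD2l ler_wpM2l// ltW.
Qed.

(** Being in the chart and the displacement bound support each other: the bound keeps the curve in
    the cube of size 3/4, and in the cube the speed gives the bound. Closedness of that cube carries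
    both to the limit time of the real induction. *)
Lemma stay_forward i x0 r C (K a b : R) c s t : good_ball g i x0 r C -> C * r <= 1 ->
  0 <= K -> speed_le g K a b c -> a <= t -> t <= s -> s <= b ->
  tball i x0 (r / 2) (c t) -> 16 * C * K * (s - t) <= r ->
  forall u, t <= u <= s -> tball i x0 (r * (3 / 4)) (c u).
Proof.
move=> B Cr K0 [cc H] at_ ts sb ct Ks; have C0 := gb_C B; have r0 := gb_r B.
have ts0 : 0 <= s - t by rewrite subr_ge0.
(* With this slack the displacement [2 * C * (K + e) * (s - t)] is at most [r / 4], the gap between
   the cubes of size 1/2 and 3/4; the 1 only avoids a division by zero. *)
pose e := r / (16 * C * (s - t + 1)).
have st1 : 0 < s - t + 1 by rewrite ltr_wpDl.
have e0 : 0 < e by rewrite divr_gt0// !mulr_gt0.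
have eE : 16 * C * e * (s - t) <= r.
  have -> : 16 * C * e * (s - t) = r * ((s - t) / (s - t + 1)).
    by rewrite /e; field; rewrite !gt_eqF.
  by rewrite ler_piMr ?(ltW r0)// ler_pdivrMr// mul1r lerDl.
clearbody e.
have x0x0 : cball x0 r x0 by rewrite /cball/= subrr normr0 ltW.
have sub34 : r * (3 / 4) <= r by rewrite ler_piMr ?(ltW r0)//; lra.
have hA : spd_mx (g i x0) by apply: metric_spd; exact: (gb_img B).
(* The factor 2 bounds [1 + C * r], the price of freezing the metric at the centre. *)
pose P u := dom i (c u) /\
  mnorm (g i x0) (ph i (c u) - ph i (c t)) <= 2 * (K + e) * (u - t).
have Pball u : t <= u <= s -> P u -> tball i x0 (r * (3 / 4)) (c u).
  move=> /andP[tu us] [iu hu]; split => //; rewrite /cball/=.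
  rewrite -(subrK (ph i (c t)) (ph i (c u))) -addrA.
  apply: le_trans (ler_normD _ _) _.
  have : `|ph i (c u) - ph i (c t)| <= C * (2 * (K + e) * (u - t)).
    by apply: le_trans (gb_lower B _ x0x0) _; rewrite ler_wpM2l// ltW.
  have : C * (K + e) * (u - t) <= C * (K + e) * (s - t).
    by rewrite ler_wpM2l ?lerD2r// mulr_ge0 ?addr_ge0// ltW.
  by case: ct => _; rewrite /cball/=; lra.
have it : dom i (c t) by case: ct.
suff HP u : t <= u <= s -> P u by move=> u hu; apply: Pball => //; exact: HP.
move=> /andP[tu us]; apply: (@real_induction _ P t u tu).
  by split => //; rewrite !subrr mulr0 mnorm0.
move=> v /andP[tv vu].
have vs : v <= s by exact: le_trans us.
have [ball_v|nball] := pselect (tball i x0 (r * (3 / 4)) (c v)); last first.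
  have cl : closed (tball i x0 (r * (3 / 4))).
    by apply: tball_closed; apply: subset_trans (gb_img B); exact: cball_sub.
  have nb : nbhs (c v) (~` tball i x0 (r * (3 / 4))).
    by apply: open_nbhs_nbhs; split => //; exact: closed_openC.
  have [d d0 hd] := near_delta (cc v _ nb).
  exists d => //; split => [w /andP[tw wv] dw Pw|Pv].
    exfalso; apply: (hd w); last by apply: Pball Pw; rewrite tw (le_trans (ltW wv)).
    by rewrite ltr0_norm ?subr_lt0//; move: dw; lra.
  by exfalso; apply: nball; apply: Pball => //; rewrite tv.
have [iv hv] := ball_v; have vab : a <= v <= b by rewrite (le_trans at_)//= (le_trans vs).
have h1 := H v i vab iv e e0; have h2 := near_dom (cc v) iv.
have [d d0 hd] := near_delta (filterI h1 h2).
have hvr := cball_sub sub34 hv.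
have key w : `|w - v| < d -> t <= w <= s -> dom i (c w) /\
    mnorm (g i x0) (ph i (c w) - ph i (c v)) <= 2 * (K + e) * `|w - v|.
  move=> wd /andP[tw ws]; have [w1 w2] := hd w wd; split => //.
  have wab : a <= w <= b by rewrite (le_trans at_)//= (le_trans ws).
  apply: le_trans (gb_osc B _ hvr x0x0) _.
  rewrite -mulrA; apply: ler_pM; [|exact: mnorm_ge0| |exact: w1].
    by rewrite addr_ge0// mulr_ge0// ltW.
  have : C * `|ph i (c v) - x0| <= C * r by rewrite ler_wpM2l// ltW.
  by move: Cr; lra.
exists d => //; split => [w /andP[tw wv] dw [iw Pw]|[_ Pv] w /andP[vw wu] wd].
  split => //.
  have := key w _ _; rewrite ltr0_norm ?subr_lt0// => /(_ _ _)[||_].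
  - by move: dw; lra.
  - by rewrite tw (le_trans (ltW wv)).
  rewrite -mnormN// opprB => h3.
  have -> : ph i (c v) - ph i (c t) = (ph i (c v) - ph i (c w)) + (ph i (c w) - ph i (c t)).
    by rewrite addrA subrK.
  by apply: le_trans (mnormD hA _ _) _; move: h3 Pw; lra.
have := key w _ _; rewrite gtr0_norm ?subr_gt0// => /(_ _ _)[||iw h3].
- by move: wd; lra.
- by rewrite (le_trans tv (ltW vw)) (le_trans wu).
split => //.
have -> : ph i (c w) - ph i (c t) = (ph i (c w) - ph i (c v)) + (ph i (c v) - ph i (c t)).
  by rewrite addrA subrK.
by apply: le_trans (mnormD hA _ _) _; move: h3 Pv; lra.
Qed.

Lemma stay i x0 r C (K a b : R) c s t : good_ball g i x0 r C -> C * r <= 1 ->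
  0 <= K -> speed_le g K a b c -> a <= t <= b -> a <= s <= b ->
  tball i x0 (r / 2) (c t) -> 16 * C * K * `|s - t| <= r ->
  tball i x0 (r * (3 / 4)) (c s) /\
  `|ph i (c s) - ph i (c t)| <= 2 * C * K * `|s - t|.
Proof.
move=> B Cr K0.
have r0 := gb_r B; have C0 := gb_C B.
have x0x0 : cball x0 r x0 by rewrite /cball/= subrr normr0 ltW.

have sub34 : r * (3 / 4) <= r by rewrite ler_piMr ?(ltW r0)//; lra.
(* For [s < t] the reversed curve is used. *)
wlog ts : a b c s t / t <= s => [W|].
  have [ts|st] := leP t s; first exact: W.
  move=> H tab sab ct Ks.
  have := W (- b) (- a) (fun u => c (-1 * u + 0)) (- s) (- t).
  have e1 u : -1 * - u + 0 = u :> R by ring.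

  rewrite !e1 => W'; have ee : `|- s - - t| = `|s - t|.
    by rewrite -normrN opprD !opprK.
  rewrite ee in W'; apply: W' => //.
  - by rewrite lerN2 ltW.
  - have ab : a <= b by move: tab => /andP[h1 h2]; exact: le_trans h2.
    have := @speed_le_affine R n M X g K (- b) (- a) (-1) 0 c.
    rewrite normrN1 mul1r !e1 oppr_eq0 oner_eq0 => W2; apply: W2 => //.
    by rewrite min_r// max_l.
  - by rewrite !lerN2 andbC.
  - by rewrite !lerN2 andbC.
move=> H /andP[at_ tb] /andP[as_ sb] ct Ks.
rewrite ger0_norm ?subr_ge0// in Ks *.
have hb := stay_forward B Cr K0 H at_ ts sb ct Ks.
split; first by apply: hb; rewrite ts lexx.
have h1 u : t <= u <= s -> tball i x0 r (c u) /\ `|ph i (c u) - x0| <= r.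
  move=> /hb h; have [h1 h2] := tball_sub sub34 h; by split.
have := chart_mean_value B K0 H at_ ts sb x0x0 (ltW r0) h1.
move=> h2; apply: le_trans (gb_lower B _ x0x0) _.
rewrite -!mulrA [2 * _]mulrCA ler_wpM2l ?(ltW C0)//; apply: le_trans h2 _.
rewrite -mulrA ler_wpM2r ?mulr_ge0 ?subr_ge0//; lra.
Qed.

End ChartBalls.

(** * Local potentials of the homology class *)

Section Potentials.
Context {R : realType} {n : nat} {M : topologicalType}.
Variables (X : smooth_atlas R n M) (g : riem_metric X).
Local Notation img := (@chart_img _ _ _ X).
Local Notation dom := (@chart_dom _ _ _ X).
Local Notation ph := (@chart _ _ _ X).
Local Notation ps := (@chart_inv _ _ _ X).
Implicit Types (c : R -> M) (i j : chart_index X).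

(** Precomposed with this clamp, an inverse chart is continuous on the whole row space, as
    [hseg_comp] requires. *)
Definition retract (y : 'rV[R]_n) (r : R) (x : 'rV[R]_n) : 'rV[R]_n :=
  \row_a clamp (y ord0 a - r) (y ord0 a + r) (x ord0 a).

Lemma retract_continuous y r : continuous (retract y r).
Proof.
move=> x; apply: (@continuous_row R) => a.
have -> : (fun x => retract y r x ord0 a) =
    (fun x : 'rV[R]_n => clamp (y ord0 a - r) (y ord0 a + r) (x ord0 a)).
  by apply/funext => z; rewrite mxE.
apply: (@ctscomp _ _ _ (fun x : 'rV[R]_n => x ord0 a)
  (clamp (y ord0 a - r) (y ord0 a + r))); first exact: coord_continuous.
exact: clamp_continuous.
Qed.

Lemma retract_cball y r x : 0 <= r -> cball y r (retract y r x).
Proof.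
move=> r0; apply/norm_row_leP => // a; rewrite !mxE ler_distl.
by apply: clamp_itv; lra.
Qed.

Lemma retract_id y r x : 0 <= r -> cball y r x -> retract y r x = x.
Proof.
move=> r0 hx; apply/rowP => a; rewrite mxE clamp_id//.
rewrite -ler_distl; have := (norm_row_leP (x - y) r0).2 hx a.
by rewrite !mxE.
Qed.

(* Two arcs in [W] with the same ends have the same class. *)
Definition potential (W : set M) (pi : M -> @H1 R M) :=
  forall c (a b : R), continuous c -> a <= b -> (forall t, a <= t <= b -> W (c t)) ->
    hseg c a b = pi (c b) - pi (c a).

(** The potential of a point is the class of the chart segment from the centre to it. *)
Lemma local_potential i x0 r : 0 <= r -> cball x0 r `<=` img i ->
  exists pi, potential (tball i x0 r) pi.
Proof.
move=> r0 sub; pose F (x : 'rV[R]_n) := ps i (retract x0 r x).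
have Fc : continuous F.
  move=> x; apply: (@ctscomp _ _ _ (retract x0 r) (ps i)).
    exact: retract_continuous.
  by apply: chart_inv_cts; apply: sub; exact: retract_cball.
exists (fun q => hedge F x0 (ph i q)) => c a b cc ab hc.
have ccl : continuous (fun t => c (clamp a b t)).
  by move=> t; apply: (@ctscomp R R M (clamp a b) c t); [exact: clamp_continuous|exact: cc].
pose w t := ph i (c (clamp a b t)).
have tb t : tball i x0 r (c (clamp a b t)) by apply: hc; exact: clamp_itv.
have wc : continuous w.
  by move=> t; apply: chart_curve_cts; [exact: ccl|case: (tb t)].
have cE : (fun t => c (clamp a b t)) = F \o w.
  apply/funext => t; have [iq hq] := tb t; rewrite /F /w /= retract_id//.
  by rewrite chartKd.
have -> : hseg c a b = hseg (fun t => c (clamp a b t)) a b.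
  by apply: eq_hseg => // t tab; rewrite clamp_id.
rewrite cE hseg_comp//.
have -> : w a = ph i (c a) by rewrite /w clamp_id// lexx.
have -> : w b = ph i (c b) by rewrite /w clamp_id// lexx ab.
rewrite (hedge_trans x0 (ph i (c a)) (ph i (c b)) Fc) addrAC subrr.
by rewrite add0r.
Qed.

(** The clamp makes the curve continuous on the line although [w] is controlled on [[a, b]] only. *)
Definition chart_curve i (w : R -> 'rV[R]_n) (a b t : R) : M := ps i (w (clamp a b t)).

Section ChartCurve.
Variables (i : chart_index X) (w : R -> 'rV[R]_n) (a b : R).
Hypotheses (ab : a <= b) (wc : forall t, a <= t <= b -> {for t, continuous w})
  (w_img : forall t, a <= t <= b -> img i (w t)).

Lemma chart_curve_continuous : continuous (chart_curve i w a b).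
Proof.
move=> t; have h := clamp_itv t ab.
apply: (@ctscomp _ _ _ (fun t => w (clamp a b t)) (ps i)); last first.
  by apply: chart_inv_cts; exact: w_img.
by apply: (@ctscomp _ _ _ (clamp a b) w); [exact: clamp_continuous|exact: wc].
Qed.

Lemma chart_curve_dom t : a <= t <= b -> dom i (chart_curve i w a b t).
Proof.
by move=> tab; rewrite /chart_curve clamp_id//; apply: chart_inv_dom; exact: w_img.
Qed.

Lemma chart_curveK t : a <= t <= b -> ph i (chart_curve i w a b t) = w t.
Proof.
by move=> tab; rewrite /chart_curve clamp_id// chart_invK//; exact: w_img.
Qed.

Lemma chart_curve_speed K : 0 <= K ->
  (forall t, a <= t <= b ->
     exists2 dw, is_derive t 1 w dw & mnorm (g i (w t)) dw <= K) ->
  speed_le g K a b (chart_curve i w a b).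
Proof.
move=> K0 H; apply: speed_leP => //; first exact: chart_curve_continuous.
move=> t tab; exists i; first exact: chart_curve_dom.
have [dw [wd <-] Hdw] := H t tab.
have hA := metric_spd g (w_img tab).
move=> e e0; rewrite chart_curveK//.
have [r [C B]] := good_ball_exists g (w_img tab).
have z1 : cball (w t) r (w t) by rewrite /cball/= subrr normr0 ltW// (gb_r B).
have C0 := gb_C B.
have wd' : differentiable w t by apply/derivable1_diffP.
have h := diff_eps wd' (divr_gt0 e0 C0); apply: filterS h => s hs /= sab.
rewrite chart_curveK//.
have -> : w s - w t = (w s - w t - 'd w t (s - t)) + 'd w t (s - t) by rewrite subrK.
apply: le_trans (mnormD hA _ _) _; rewrite mulrDl addrC; apply: lerD.
  have -> : 'd w t (s - t) = (s - t) *: 'D_1 w t.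
    by rewrite deriveE// -linearZ/=; congr ('d w t _); rewrite /GRing.scale/= mulr1.
  by rewrite mnormZ// mulrC ler_wpM2r.
apply: le_trans (gb_upper B _ z1) _.
rewrite mulrC -ler_pdivlMr//; apply: le_trans hs _.
by rewrite mulrAC.
Qed.

End ChartCurve.

Lemma speed_le_cst (m : M) (a b : R) : speed_le g 0 a b (fun=> m).
Proof.
split; first exact: cst_continuous.
move=> t i _ it e e0; apply: filterE => s _.
by rewrite subrr mnorm0 mulr_ge0// add0r ltW.
Qed.

Lemma segment_speed i x0 r C p q (a b : R) : a < b -> good_ball g i x0 r C ->
  tball i x0 r p -> tball i x0 r q ->
  exists K c, [/\ 0 <= K, speed_le g K a b c, c a = p, c b = q &
    forall t, a <= t <= b -> tball i x0 r (c t)].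
Proof.
move=> ab B [ip hp] [iq hq]; have ab' := ltW ab.
pose v : 'rV[R]_n := (b - a)^-1 *: (ph i q - ph i p).
pose w (t : R) : 'rV[R]_n := (ph i p - a *: v) + t *: v.
have ba : 0 < b - a by rewrite subr_gt0.
have wE t : w t = ph i p + ((t - a) / (b - a)) *: (ph i q - ph i p).
  by apply/rowP => k; rewrite !mxE; ring.
have wball t : a <= t <= b -> cball x0 r (w t).
  move=> /andP[at_ tb]; rewrite wE; apply: cball_convex => //.
  rewrite divr_ge0 ?subr_ge0//=.
  by rewrite ler_pdivrMr// mul1r lerD2r.
have wimg t : a <= t <= b -> img i (w t) by move=> /wball; exact: (gb_img B).
have wd (t : R) : is_derive t 1 w v by exact: is_derive_line.
have wc (t : R) : a <= t <= b -> {for t, continuous w}.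
  move=> _; apply: differentiable_continuous; apply/derivable1_diffP.
  by case: (wd t).
have K0 : 0 <= C * `|v| by exact: mulr_ge0 (ltW (gb_C B)) (normr_ge0 _).
exists (C * `|v|), (chart_curve i w a b); split => //.
- apply: chart_curve_speed => // t tab; exists v => //.
  by apply: (gb_upper B); exact: wball.
- rewrite /chart_curve clamp_id ?lexx// wE subrr mul0r scale0r addr0.
  exact: chartKd.
- rewrite /chart_curve clamp_id ?lexx ?ab'// wE divff ?gt_eqF// scale1r addrC subrK.
  exact: chartKd.
- by move=> t tab; split; [exact: chart_curve_dom|rewrite chart_curveK//; exact: wball].
Qed.

Lemma near_tball (f : R -> M) i r t : continuous f -> 0 < r -> dom i (f t) ->
  \forall s \near t, tball i (ph i (f t)) r (f s).
Proof.
move=> fc r0 it; apply: (fc t); apply: (@tball_nbhs _ _ _ X i (ph i (f t)) r 0) => //.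
exact: tball_center.
Qed.

Definition essential (K : R) c :=
  [/\ 0 <= K, speed_le g K 0 1 c, c 0 = c 1 & hseg c 0 1 <> 0].

(** A continuous essential loop is replaced piece by piece by chart segments. Local potentials
    preserve the class, and at each step the larger of two speeds remains a bound. *)
Lemma exists_essential : first_betti R M <> 0%:E -> exists K c, essential K c.
Proof.
move=> /exists_essential_loop[f [fc f01 f1]].
pose P t := exists K c, [/\ 0 <= K, speed_le g K 0 t c, c 0 = f 0, c t = f t &
  hseg c 0 t = hseg f 0 t].
suff [K [c [K0 cK c0 c1 cf]]] : P 1.
  by exists K, c; split; rewrite ?c0 ?c1 ?cf.
apply: (@real_induction _ P 0 1) => //.
  exists 0, (fun=> f 0); split => //; first exact: speed_le_cst.
  by rewrite !hseg_id//; exact: cst_continuous.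
move=> t /andP[t0 t1]; have [i it] := chart_cover X (f t).
have [r [C B]] := good_ball_exists g (chart_img_in it).
have [d d0 hd] := near_delta (near_tball fc (gb_r B) it).
have [pi hpi] := local_potential (ltW (gb_r B)) (gb_img B).
have ext s s' : 0 <= s -> s < s' -> (forall u, s <= u <= s' -> `|u - t| < d) ->
    P s -> P s'.
  move=> s0 ss' hu [K [c [K0 cK c0 cs cf]]].
  have fb u : s <= u <= s' -> tball i (ph i (f t)) r (f u).
    by move=> /hu; exact: hd.
  have sin : s <= s <= s' by rewrite lexx ltW.
  have s'in : s <= s' <= s' by rewrite lexx ltW.
  have [K' [c' [K'0 c'K c's c's' c'b]]] := segment_speed ss' B (fb _ sin) (fb _ s'in).
  have cc : continuous c by case: cK.
  have c'c : continuous c' by case: c'K.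
  have glue_eq : c s = c' s by rewrite cs c's.
  exists (Num.max K K'), (glue c c' s); split.
  - by rewrite le_max K0.
  - apply: speed_le_glue => //; first by rewrite le_max K0.
    + by rewrite s0 ltW.
    + by apply: speed_leW cK; rewrite le_max lexx.
    + by apply: speed_leW c'K; rewrite le_max lexx orbT.
  - by rewrite glueL.
  - by rewrite glueR// ltW.
  - rewrite hseg_glue// ?s0 ?(ltW ss')// cf (hseg_trans 0 s s' fc); congr (_ + _).
    by rewrite (hpi _ _ _ c'c (ltW ss') c'b) (hpi _ _ _ fc (ltW ss') fb) c's c's'.
exists d => //; split=> [s /andP[s0 st] sd|Pt s /andP[ts s1] sd].
  apply: ext => // u /andP[h1 h2]; rewrite ler0_norm ?subr_le0//; move: sd h1; lra.
apply: ext Pt => // u /andP[h1 h2]; rewrite ger0_norm ?subr_ge0//; move: sd h2; lra.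
Qed.

Lemma small_paths q (W : set M) : nbhs q W -> \forall q' \near q,
  exists c, [/\ continuous c, c 0 = q, c 1 = q' & forall t, 0 <= t <= 1 -> W (c t)].
Proof.
move=> qW; have [i iq] := chart_cover X q.
have [r1 [C1 B1]] := good_ball_exists g (chart_img_in iq).
have [r2 r20 hr2] : exists2 r, 0 < r & cball (ph i q) r `<=` ps i @^-1` W.
  apply: nbhs_cball; apply: (chart_inv_cts (chart_img_in iq)).
  by rewrite chartKd.
pose r := Num.min r1 r2; have r0 : 0 < r by rewrite lt_min (gb_r B1).
have B : good_ball g i (ph i q) r C1.
  by apply: good_ball_shrink B1 _; rewrite r0 ge_min lexx.
have : nbhs q (tball i (ph i q) r) by apply: tball_nbhs r0; exact: tball_center.
apply: filterS => q' hq'.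
have hq : tball i (ph i q) r q by apply: tball_center => //; exact: ltW.
have [K [c [K0 cK c0 c1 cb]]] := segment_speed ltr01 B hq hq'.
exists c; split => //; first by case: cK.
move=> t /cb[it ht]; rewrite -(chartKd it); apply: hr2.
by apply: cball_sub ht; rewrite ge_min lexx orbT.
Qed.

(** Both increments are the class of one small path inside both sets. The claim is local because the
    intersection of the sets may be disconnected. *)
Lemma potential_compat q (W1 W2 : set M) pi1 pi2 : nbhs q W1 -> nbhs q W2 ->
  potential W1 pi1 -> potential W2 pi2 ->
  \forall q' \near q, pi1 q' - pi1 q = pi2 q' - pi2 q.
Proof.
move=> q1 q2 h1 h2; apply: filterS (small_paths (filterI q1 q2)) => q'.
move=> [c [cc c0 c1 cb]].
have := h1 c 0 1 cc ler01 (fun t h => (cb t h).1).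
have := h2 c 0 1 cc ler01 (fun t h => (cb t h).2).
by rewrite c0 c1 => -> ->.
Qed.

End Potentials.

(** * The shortest essential loop *)

(** Along an ultrafilter every cluster point is a limit. Applied at each time separately, this gives
    a pointwise limit of loops without a topology on the set of loops. *)
Lemma ultra_limit (M : topologicalType) (T : Type) (U : set_system T) (h : T -> M) :
  compact [set: M] -> UltraFilter U ->
  exists p : M, forall W : set M, nbhs p W -> U (h @^-1` W).
Proof.
move=> Mc UU; have UP : ProperFilter U by exact: ultra_proper.
have [|p [_ hp]] := Mc (h @ U) _; first exact: filterT.
exists p => W pW; have [//|UnW] := @in_ultra_setVsetC _ U (h @^-1` W) UU.
by have [q [qn qW]] := hp (~` W) W UnW pW.
Qed.

Lemma zmod_shuffle (V : zmodType) (x y a b d : V) :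
  (a - b - d) + ((x - a) - (y - b)) = x - y - d.
Proof.
have -> : (x - a) - (y - b) = (x - y) - (a - b).
  by rewrite !opprB [b - y]addrC addrACA [- a + b]addrC.
by rewrite addrC addrA subrK.
Qed.

(** * Ultralimits of nearly minimal loops *)

Section Limit.
Context {R : realType} {n : nat} {M : topologicalType}.
Variables (X : smooth_atlas R n M) (g : riem_metric X).
Hypotheses (M_hausdorff : hausdorff_space M) (M_compact : compact [set: M]).
Local Notation img := (@chart_img _ _ _ X).
Local Notation dom := (@chart_dom _ _ _ X).
Local Notation ph := (@chart _ _ _ X).
Local Notation ps := (@chart_inv _ _ _ X).
Local Notation essential := (essential g).
Implicit Types (c : R -> M) (i j : chart_index X).

(** The metric is frozen at a point [z] that may differ from the position at time [t], such as the
    position of a limit curve; its distance [eta] adds to the distortion. *)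
Lemma near_speed i x0 r C (K a b : R) c s t z eta : good_ball g i x0 r C -> C * r <= 1 ->
  0 <= K -> speed_le g K a b c -> a <= t <= b -> a <= s <= b ->
  tball i x0 (r / 2) (c t) -> 16 * C * K * `|s - t| <= r ->
  cball x0 r z -> `|ph i (c t) - z| <= eta ->
  mnorm (g i z) (ph i (c s) - ph i (c t)) <=
    (1 + C * (eta + 2 * C * K * `|s - t|)) * K * `|s - t|.
Proof.
move=> B Cr K0 cK /andP[at_ tb] /andP[as_ sb] ct Ks hz eta_.
have C0 := gb_C B; have r0 := gb_r B.
have eta0 : 0 <= eta by exact: le_trans eta_.
have CK : 0 <= 2 * C * K by rewrite !mulr_ge0// ltW.
have sub34 : r * (3 / 4) <= r by rewrite ler_piMr ?(ltW r0)//; lra.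

have key u : a <= u <= b -> `|u - t| <= `|s - t| ->
    tball i x0 r (c u) /\ `|ph i (c u) - z| <= eta + 2 * C * K * `|s - t|.
  move=> uab us; have us' : 16 * C * K * `|u - t| <= r.
    by apply: le_trans Ks; rewrite ler_wpM2l// !mulr_ge0// ltW.
  have [h1 h2] := stay M_hausdorff B Cr K0 cK (introT andP (conj at_ tb)) uab ct us'.
  split; first exact: tball_sub sub34 _ h1.
  rewrite -(subrK (ph i (c t)) (ph i (c u))) -addrA addrC.
  apply: le_trans (ler_normD _ _) _; apply: lerD => //.
  by apply: le_trans h2 _; rewrite ler_wpM2l.
have rho0 : 0 <= eta + 2 * C * K * `|s - t| by rewrite addr_ge0// mulr_ge0.
have [ts|st] := leP t s.
  rewrite [in X in _ <= _ * X]ger0_norm ?subr_ge0//.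
  apply: (chart_mean_value B K0 cK) => // u /andP[tu us]; apply: key.
    by rewrite (le_trans at_)//= (le_trans us).
  by rewrite !ger0_norm ?subr_ge0// ?lerD2r// (le_trans tu).
rewrite -mnormN// opprB.
have -> : `|s - t| = t - s by rewrite ltr0_norm ?subr_lt0// opprB.
have -> : t - s = `|s - t| by rewrite ltr0_norm ?subr_lt0// opprB.
rewrite [in X in _ <= _ * X]ltr0_norm ?subr_lt0// opprB.
apply: (chart_mean_value B K0 cK) => //; first exact: ltW.
move=> u /andP[su ut]; apply: key.
  by rewrite (le_trans as_)//= (le_trans ut).
by rewrite !ler0_norm ?subr_le0// ?lerN2 ?lerD2r// ltW.
Qed.

Variable L : R.
Hypothesis L0 : 0 <= L.
Variable U : set_system (R -> M).
Hypothesis UU : UltraFilter U.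
Hypothesis U_ess : forall e, 0 < e -> U [set c | exists2 K, K < L + e & essential K c].
Variable f : R -> M.
Hypothesis f_lim : forall t (W : set M), nbhs (f t) W -> U [set c | W (c t)].

#[local] Existing Instance UU.

Let UI (A B : set (R -> M)) : U A -> U B -> U (A `&` B).
Proof. exact: filterI. Qed.

Let US (A B : set (R -> M)) : A `<=` B -> U A -> U B.
Proof. exact: filterS. Qed.

Let Uex (A : set (R -> M)) : U A -> exists c, A c.
Proof. exact: filter_ex. Qed.

Lemma limit_closed t (A : set M) : closed A -> U [set c | A (c t)] -> A (f t).
Proof.
move=> cA UA; apply: contrapT => nA.
have nb : nbhs (f t) (~` A).
  by apply: open_nbhs_nbhs; split => //; exact: closed_openC.
have h := f_lim nb.
by have /Uex[c [/= h1 h2]] := UI UA h.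
Qed.

Lemma limit_loop : f 0 = f 1.
Proof.
apply: M_hausdorff => A B fA fB.
have := UI (UI (f_lim fA) (f_lim fB)) (U_ess ltr01).
move=> /Uex[c [/= [cA cB] [K _ [_ _ c01 _]]]].
by exists (c 0); split => //; rewrite c01.
Qed.

(** A crude speed bound for all loops of excess at most 1. It fixes the time scale before the excess
    is chosen. *)
Let K1 := L + 1.
Let K1_ge0 : 0 <= K1. Proof. by rewrite /K1 addr_ge0. Qed.

(** The estimate is explicit in the distance of [s] and [t], with a relative error of first order,
    so that continuity of the limit and its speed [L] can both be read off. *)
Lemma limit_speed i t r C : 0 <= t <= 1 -> dom i (f t) ->
  good_ball g i (ph i (f t)) r C -> C * r <= 1 ->
  forall s, 0 <= s <= 1 -> 16 * C * K1 * `|s - t| <= r ->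
  tball i (ph i (f t)) (r * (3 / 4)) (f s) /\
  mnorm (g i (ph i (f t))) (ph i (f s) - ph i (f t)) <=
    (1 + 2 * C ^+ 2 * K1 * `|s - t|) * (L * `|s - t|).
Proof.
move=> t01 it B Cr s s01 Ks; have C0 := gb_C B; have r0 := gb_r B.
set x0 := ph i (f t) in B *.
have sub34 : r * (3 / 4) <= r by rewrite ler_piMr ?(ltW r0)//; lra.
have x0x0 : cball x0 r x0 by rewrite /cball/= subrr normr0 ltW.
have hx : spd_mx (g i x0) by apply: metric_spd; exact: (gb_img B).
have near_t eta : 0 < eta -> U [set c | tball i x0 eta (c t)].
  by move=> eta0; apply: f_lim; apply: tball_nbhs eta0; exact: tball_center.
have r20 : 0 < r / 2 by rewrite divr_gt0.
have Kb K : K < L + 1 -> 0 <= K -> 16 * C * K * `|s - t| <= r.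
  move=> KL K0; apply: le_trans Ks; rewrite ler_wpM2r// ler_wpM2l ?(ltW KL)//.
  by rewrite mulr_ge0// ltW.
have fs : tball i x0 (r * (3 / 4)) (f s).
  apply: limit_closed.
    by apply: tball_closed => //; apply: subset_trans (gb_img B); exact: cball_sub.
  apply: US (UI (near_t _ r20) (U_ess ltr01)) => c /= [ct [K KL [K0 cK _ _]]].
  by have [] := stay M_hausdorff B Cr K0 cK t01 s01 ct (Kb _ KL K0).
split => //; have [is_ hs] := fs.
set d := `|s - t|; have d0 : 0 <= d by exact: normr_ge0.
(* The coefficient of [e] in the error: [2 * C] for moving both ends, the rest for the shifted base
   point and the excess speed. *)
pose E := 2 * C + (C * (L + 1) + (1 + 2 * C ^+ 2 * K1 * d)) * d.
have E0 : 0 < E.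
  rewrite /E ltr_pwDl ?mulr_gt0//; rewrite mulr_ge0// addr_ge0//.
    by rewrite mulr_ge0 ?(ltW C0).
  by rewrite addr_ge0// !mulr_ge0// ?exprn_ge0// ltW.
apply/ler_addgt0Pr => w w0.
pose e := Num.min 1 (Num.min (r / 2) (w / E)).
have e0 : 0 < e by rewrite !lt_min ltr01 r20 divr_gt0.
have e1 : e <= 1 by rewrite ge_min lexx.
have er : e <= r / 2 by rewrite !ge_min lexx orbT.
have eE : e * E <= w by rewrite -ler_pdivlMr// !ge_min lexx !orbT.
clearbody e.
have near_s : U [set c | tball i (ph i (f s)) e (c s)].
  by apply: f_lim; apply: tball_nbhs e0; exact: tball_center.
have [c [/= [ct [isc hsc]] [K KL [K0 cK _ _]]]] :=
  Uex (UI (UI (near_t _ e0) near_s) (U_ess e0)).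
have KL1 : K < L + 1 by apply: lt_le_trans KL _; rewrite lerD2l.
have ct2 : tball i x0 (r / 2) (c t) by exact: tball_sub er _ ct.
have [itc htc] := ct.
have := near_speed B Cr K0 cK t01 s01 ct2 (Kb _ KL1 K0) x0x0 htc.
rewrite -/d => h.
have -> : ph i (f s) - x0 = (ph i (f s) - ph i (c s)) +
    ((ph i (c s) - ph i (c t)) + (ph i (c t) - x0)).
  by rewrite !addrA !subrK.
apply: le_trans (mnormD hx _ _) _.
have h1 : mnorm (g i x0) (ph i (f s) - ph i (c s)) <= C * e.
  by apply: le_trans (gb_upper B _ x0x0) _; rewrite ler_wpM2l ?(ltW C0)// distrC.
have h2 : mnorm (g i x0) (ph i (c t) - x0) <= C * e.
  by apply: le_trans (gb_upper B _ x0x0) _; rewrite ler_wpM2l ?(ltW C0).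
have h3 := mnormD hx (ph i (c s) - ph i (c t)) (ph i (c t) - x0).
have h4 : (1 + C * (e + 2 * C * K * d)) * K * d <=
    (1 + C * (e + 2 * C * K1 * d)) * (L + e) * d.
  apply: ler_wpM2r => //; apply: ler_pM => //.
  - by rewrite addr_ge0// mulr_ge0 ?(ltW C0)// addr_ge0 ?(ltW e0)// !mulr_ge0// ltW.
  - rewrite lerD2l ler_wpM2l ?(ltW C0)// lerD2l ler_wpM2r// ler_wpM2l ?(ltW KL1)//.
    by rewrite mulr_ge0// ltW.
  - exact: ltW.
have h5 : (1 + C * (e + 2 * C * K1 * d)) * (L + e) * d <=
    (1 + 2 * C ^+ 2 * K1 * d) * (L * d) + e * (E - 2 * C).
  have -> : e * (E - 2 * C) = C * e * (L + 1) * d + (1 + 2 * C ^+ 2 * K1 * d) * e * d.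
    by rewrite /E; ring.
  have : C * e * (L + e) * d <= C * e * (L + 1) * d.
    by rewrite ler_wpM2r// ler_wpM2l ?lerD2l// mulr_ge0// ltW.
  rewrite (_ : (1 + C * (e + 2 * C * K1 * d)) * (L + e) * d =
    (1 + 2 * C ^+ 2 * K1 * d) * (L * d) + C * e * (L + e) * d
      + (1 + 2 * C ^+ 2 * K1 * d) * e * d); last by ring.
  move=> h6; rewrite -addrA lerD2l lerD2r//.
have : e * (E - 2 * C) = e * E - 2 * (C * e) by ring.
lra.
Qed.

(** The pointwise limit [f] is controlled on [[0, 1]] only; the clamp makes it continuous on the
    line. *)
Definition limit_curve (t : R) : M := f (clamp 0 1 t).

Lemma small_good_ball i x0 : img i x0 -> exists r C,
  good_ball g i x0 r C /\ C * r <= 1.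
Proof.
move=> /good_ball_exists-/(_ g)[r [C B]]; have C0 := gb_C B; have r0 := gb_r B.
exists (Num.min r C^-1), C; split.
  by apply: good_ball_shrink B _; rewrite lt_min r0 invr_gt0 C0 ge_min lexx.
by rewrite mulrC -ler_pdivlMr// mul1r ge_min lexx orbT.
Qed.

Lemma limit_local_cts i t : 0 <= t <= 1 -> dom i (f t) ->
  forall W, nbhs (f t) W -> \forall s \near t, 0 <= s <= 1 -> W (f s).
Proof.
move=> t01 it W fW; have [r [C [B Cr]]] := small_good_ball (chart_img_in it).
have C0 := gb_C B; have r0 := gb_r B.
have [e e0 he] : exists2 e, 0 < e & cball (ph i (f t)) e `<=` ps i @^-1` W.
  apply: nbhs_cball; apply: (chart_inv_cts (chart_img_in it)).
  by rewrite chartKd.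
have x0x0 : cball (ph i (f t)) r (ph i (f t)) by rewrite /cball/= subrr normr0 ltW.
pose D1 := 16 * C * K1 + 1; have D10 : 0 < D1 by rewrite ltr_wpDl// !mulr_ge0// ltW.
pose q := r / D1; have q0 : 0 <= q by rewrite divr_ge0// ltW.
pose D2 := C * ((1 + 2 * C ^+ 2 * K1 * q) * L) + 1.
have D20 : 0 < D2.
  have : 0 <= C ^+ 2 * K1 * q by apply: mulr_ge0 => //; apply: mulr_ge0 => //; apply: exprn_ge0; exact: ltW.
  move=> h; rewrite ltr_wpDl// mulr_ge0 ?(ltW C0)// mulr_ge0//; lra.
apply: (@delta_near _ _ _ (Num.min q (e / D2))).
  by rewrite lt_min /q !divr_gt0.
move=> s; rewrite lt_min => /andP[s1 s2] s01.
have sD : `|s - t| * D1 <= r by rewrite -ler_pdivlMr// ltW.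
have Ks : 16 * C * K1 * `|s - t| <= r.
  apply: le_trans sD; rewrite mulrC ler_wpM2l// /D1; lra.
have [[is_ _] h] := limit_speed t01 it B Cr s01 Ks.
rewrite -(chartKd is_); apply: he; rewrite /cball/=.
apply: le_trans (gb_lower B _ x0x0) _.
have : `|s - t| * D2 <= e by rewrite -ler_pdivlMr// ltW.
move=> /(le_trans _); apply; apply: le_trans (ler_wpM2l (ltW C0) h) _.
rewrite /D2 (mulrDr `|s - t|) mulr1.
have : (1 + 2 * C ^+ 2 * K1 * `|s - t|) * (L * `|s - t|) <=
       (1 + 2 * C ^+ 2 * K1 * q) * (L * `|s - t|).
  rewrite ler_wpM2r ?mulr_ge0// lerD2l ler_wpM2l ?(ltW s1)//.
  by rewrite !mulr_ge0// ?exprn_ge0// ltW.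
move=> /(ler_wpM2l (ltW C0)) h'; apply: le_trans h' _.
have -> : C * ((1 + 2 * C ^+ 2 * K1 * q) * (L * `|s - t|)) =
  `|s - t| * (C * ((1 + 2 * C ^+ 2 * K1 * q) * L)) by ring.
by rewrite lerDl.
Qed.

Lemma limit_continuous : continuous limit_curve.
Proof.
move=> t W; have tc := clamp_itv t (@ler01 R).
have [i it] := chart_cover X (limit_curve t) => fW.
have h := @clamp_continuous R 0 1 t _ (limit_local_cts tc it fW).
by apply: (@filterS _ (nbhs t) _ _ _ _ h) => s; apply; exact: clamp_itv.
Qed.

Lemma limit_curveE t : 0 <= t <= 1 -> limit_curve t = f t.
Proof. by move=> t01; rewrite /limit_curve clamp_id. Qed.

Lemma limit_speed_le : speed_le g L 0 1 limit_curve.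
Proof.
split; first exact: limit_continuous.
move=> t i t01; rewrite limit_curveE// => it e e0; rewrite limit_curveE//.
have [r [C [B Cr]]] := small_good_ball (chart_img_in it).
have C0 := gb_C B; have r0 := gb_r B.
pose D1 := 16 * C * K1 + 1; have D10 : 0 < D1 by rewrite ltr_wpDl// !mulr_ge0// ltW.
pose D2 := 2 * C ^+ 2 * K1 * L + 1.
have D20 : 0 < D2 by rewrite ltr_wpDl// !mulr_ge0 ?exprn_ge0// ltW.
apply: (@delta_near _ _ _ (Num.min (r / D1) (e / D2))).
  by rewrite lt_min !divr_gt0.
move=> s; rewrite lt_min => /andP[s1 s2] /= s01; rewrite limit_curveE//.
have sD : `|s - t| * D1 <= r by rewrite -ler_pdivlMr// ltW.
have Ks : 16 * C * K1 * `|s - t| <= r.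
  apply: le_trans sD; rewrite mulrC ler_wpM2l// /D1; lra.
have [_ h] := limit_speed t01 it B Cr s01 Ks.
apply: le_trans h _; rewrite mulrA; apply: ler_wpM2r => //.
have : `|s - t| * D2 <= e by rewrite -ler_pdivlMr// ltW.
have := normr_ge0 (s - t); rewrite /D2; lra.
Qed.

(** For almost every loop [c], the classes of [c] and of the limit on [[0, t]] differ by increments
    of local potentials between the two curves at the times [t] and 0. At time 1 both curves have
    closed up and the increments cancel. *)
Lemma limit_essential : hseg limit_curve 0 1 <> 0.
Proof.
have fc := limit_continuous; have fE := limit_curveE.


have [i0 it0] := chart_cover X (f 0).
have [r0 [C0 B0]] := good_ball_exists g (chart_img_in it0).
have [pi0 h0] := local_potential (ltW (gb_r B0)) (gb_img B0).
set W0 := tball _ _ _ in h0.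
have W0n : nbhs (f 0) W0 by apply: tball_nbhs (gb_r B0); exact: tball_center.
pose P t := exists W pi, [/\ nbhs (f t) W, potential W pi &
  U [set c | hseg c 0 t - hseg limit_curve 0 t =
     (pi (c t) - pi (f t)) - (pi0 (c 0) - pi0 (f 0))]].
have U_cts : U [set c | continuous c].
  by apply: US (U_ess ltr01) => c [K _ [_ []]].
suff [W [pi [Wn hpi Ueq]]] : P 1.
  rewrite -limit_loop in Wn.
  have comp := f_lim (potential_compat g Wn W0n hpi h0).
  have [c [/= [ceq ccomp] [K _ [_ _ c01 ch]]]] :=
    Uex (UI (UI Ueq comp) (U_ess ltr01)).
  by move=> fh; apply: ch; move: ceq; rewrite fh subr0 -limit_loop -c01 ccomp subrr.
apply: (@real_induction _ P 0 1) => //.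
  exists W0, pi0; split => //; apply: US U_cts => c cc /=.
  by rewrite !hseg_id// !subrr.
move=> t t01; have [i it] := chart_cover X (f t).
have [r [C [B Cr]]] := small_good_ball (chart_img_in it).
have Cp := gb_C B; have rp := gb_r B.
have [pi hpi] := local_potential (ltW rp) (gb_img B).
have r4 : 0 < r / 4 by rewrite divr_gt0.
have r42 : r / 4 < r / 2 by lra.
have r4r : r / 4 < r by lra.
have nb : nbhs (f t) (tball i (ph i (f t)) (r / 4)).
  by apply: tball_nbhs r4; exact: tball_center.
have [d1 d10 hd1] := near_delta (limit_local_cts t01 it nb).
pose D1 := 16 * C * K1 + 1; have D10 : 0 < D1 by rewrite ltr_wpDl// !mulr_ge0// ltW.
pose d := Num.min d1 (r / D1 / 2).
have d0 : 0 < d by rewrite lt_min d10 !divr_gt0.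
have ext s s' : 0 <= s -> s < s' -> s' <= 1 -> (forall u, s <= u <= s' -> `|u - t| < d) ->
    P s -> P s'.
  move=> s0 ss' s'1 hu [W [pis [Wn hpis Us]]].
  have u01 u : s <= u <= s' -> 0 <= u <= 1.
    by move=> /andP[h1 h2]; rewrite (le_trans s0)//= (le_trans h2).
  have fb u : s <= u <= s' -> tball i (ph i (f t)) (r / 4) (f u).
    move=> uss; apply: hd1; last exact: u01.
    by apply: lt_le_trans (hu _ uss) _; rewrite ge_min lexx.
  have sin : s <= s <= s' by rewrite lexx ltW.
  have s'in : s <= s' <= s' by rewrite lexx ltW.
  exists (tball i (ph i (f t)) r), pi; split => //.
    exact: tball_nbhs (fb _ s'in) r4r.
  have fsn : nbhs (f s) (tball i (ph i (f t)) r) by exact: tball_nbhs (fb _ sin) r4r.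
  have fs2 : U [set c | tball i (ph i (f t)) (r / 2) (c s)].
    by apply: f_lim; exact: tball_nbhs (fb _ sin) r42.
  have comp := f_lim (potential_compat g Wn fsn hpis hpi).
  apply: US (UI (UI Us fs2) (UI comp (U_ess ltr01))) => c /=.
  move=> [[ceq cs2] [ccomp [K KL [K0 cK _ _]]]].
  have cc : continuous c by case: cK.
  have cb u : s <= u <= s' -> tball i (ph i (f t)) r (c u).
    move=> uss; have sd' : 16 * C * K * `|u - s| <= r.
      have dd : `|u - s| <= r / D1.
        have := hu u uss; have := hu s sin; rewrite /d !lt_min => /andP[_ e1] /andP[_ e2].
        have -> : u - s = (u - t) - (s - t) by ring.
        by apply: le_trans (ler_normB _ _) _; lra.
      rewrite ler_pdivlMr// in dd; apply: le_trans dd; rewrite mulrC ler_wpM2l// /D1.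
      have : 16 * C * K <= 16 * C * K1 by rewrite ler_wpM2l ?(ltW KL)// mulr_ge0// ltW.
      lra.
    have [h _] := stay M_hausdorff B Cr K0 cK (u01 _ sin) (u01 _ uss) cs2 sd'.
    by apply: tball_sub h; rewrite ler_piMr ?(ltW rp)//; lra.
  rewrite (hseg_trans 0 s s' cc) (hseg_trans 0 s s' fc).
  rewrite (hpi c s s' cc (ltW ss') cb).
  rewrite (hpi limit_curve s s' fc (ltW ss')); last first.
    by move=> u uss; rewrite fE; [exact: tball_sub (ltW r4r) _ (fb _ uss)|exact: u01].
  rewrite !fE ?u01// opprD addrACA ceq ccomp.
  exact: zmod_shuffle.
exists d => //; split=> [s /andP[s0 st] sd|Pt s /andP[ts s1] sd].
  case/andP: t01 => _ t1.
  apply: ext => // u /andP[h1 h2]; rewrite ler0_norm ?subr_le0//; move: sd h1; lra.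
case/andP: t01 => t0 _.
apply: ext Pt => // u /andP[h1 h2]; rewrite ger0_norm ?subr_ge0//; move: sd h2; lra.
Qed.

End Limit.

(** * Existence and properties of a minimizer *)

Section Minimal.
Context {R : realType} {n : nat} {M : topologicalType}.
Variables (X : smooth_atlas R n M) (g : riem_metric X).
Hypotheses (M_hausdorff : hausdorff_space M) (M_compact : compact [set: M]).
Local Notation dom := (@chart_dom _ _ _ X).
Local Notation ph := (@chart _ _ _ X).
Local Notation essential := (essential g).
Implicit Types (c : R -> M) (i j : chart_index X).

Lemma speed0_constant c (a b : R) : speed_le g 0 a b c ->
  forall s t, a <= s <= b -> a <= t <= b -> c s = c t.
Proof.
move=> c0 s t sab tab; have [i it] := chart_cover X (c t).
have [r [C [B Cr]]] := small_good_ball g (chart_img_in it).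
have r0 := gb_r B.
have ct : tball i (ph i (c t)) (r / 2) (c t).
  by apply: tball_center => //; rewrite divr_ge0// ltW.
have Ks : 16 * C * 0 * `|s - t| <= r by rewrite mulr0 mul0r ltW.
have [[is_ _]] := stay M_hausdorff B Cr (lexx 0) c0 tab sab ct Ks.
rewrite mulr0 mul0r normr_le0 subr_eq0 => /eqP e.
by rewrite -(chartKd is_) e chartKd.
Qed.

Lemma exists_minimal : first_betti R M <> 0%:E ->
  exists (L : R) c, [/\ 0 < L, essential L c & forall K c', essential K c' -> L <= K].
Proof.
move=> /(exists_essential g)[K0 [c0 ess0]].
pose S := [set K | exists c, essential K c].
have infS : has_inf S.
  by split; [exists K0, c0|exists 0 => K [c []]].
pose L := inf S.
have Lmin K c : essential K c -> L <= K.
  by move=> ess; apply: ge_inf; [case: infS|exists c].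
have L0 : 0 <= L by apply: lb_le_inf; [case: infS|move=> K [c []]].
(* The filter of nearly minimal loops plays the role of a minimizing sequence. *)
pose F := filter_from [set e : R | 0 < e]
  (fun e => [set c | exists2 K, K < L + e & essential K c]).
have FF : ProperFilter F.
  apply: filter_from_proper.
    apply: filter_from_filter; first by exists 1 => /=; exact: ltr01.
    move=> e1 e2 /= e10 e20; exists (Num.min e1 e2) => /=; first by rewrite lt_min e10.
    move=> c [K KL ess]; split; exists K => //; apply: lt_le_trans KL _.
      by rewrite lerD2l ge_min lexx.
    by rewrite lerD2l ge_min lexx orbT.
  move=> e /= e0; have [K [c ess] KL] := inf_adherent e0 infS.
  by exists c, K.
have [U [UU FU]] := ultraFilterLemma FF.
have U_ess e : 0 < e -> U [set c | exists2 K, K < L + e & essential K c].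
  by move=> e0; apply: FU; exists e.
have lim t := ultra_limit (fun c : R -> M => c t) M_compact UU.
have [f f_lim] := choice lim.
have fU t (W : set M) : nbhs (f t) W -> U [set c | W (c t)] by exact: f_lim.
have ess : essential L (limit_curve f).
  split => //.
  - exact: (limit_speed_le M_hausdorff L0 UU U_ess fU).
  - rewrite !(limit_curveE f) ?lexx ?ler01//.
    exact: (limit_loop M_hausdorff UU U_ess fU).
  - exact: (limit_essential M_hausdorff L0 UU U_ess fU).
exists L, (limit_curve f); split => //.
(* A loop of speed 0 is constant, hence null-homologous. *)
rewrite lt_neqAle L0 andbT; apply/negP => /eqP L_eq.
move: ess => [_ s01 _]; apply; rewrite -L_eq in s01.
have [fc _] := s01.
have -> : hseg (limit_curve f) 0 1 = hseg (fun=> limit_curve f 0) 0 1.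
  apply: (@eq_hseg R M _ (fun=> limit_curve f 0) 0 1 ler01 fc).
    exact: cst_continuous.
  by move=> t t01; apply: (speed0_constant s01) t01 _; rewrite lexx ler01.
exact: hseg_cst.
Qed.

(** * The periodic extension of a minimizer *)

Section Periodic.
Variables (L : R) (c : R -> M).
Hypotheses (L0 : 0 < L) (c_ess : essential L c)
  (c_min : forall K c', essential K c' -> L <= K).

(** Rescaling to the unit interval multiplies the speed by the duration, so minimality bounds their
    product. *)
Lemma minimal_length (K a b : R) c' : 0 <= K -> a < b -> speed_le g K a b c' ->
  c' a = c' b -> hseg c' a b <> 0 -> L <= K * (b - a).
Proof.
move=> K0 ab c's c'ab ch; have c'c : continuous c' by case: c's.
have ba : 0 < b - a by rewrite subr_gt0.
have e0 : (b - a) * 0 + a = a by ring.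
have e1 : (b - a) * 1 + a = b by ring.
apply: (c_min (c' := fun t => c' ((b - a) * t + a))); split.
- by rewrite mulr_ge0// ltW.
- rewrite mulrC -{1}(gtr0_norm ba); apply: speed_le_affine => //; first by rewrite gt_eqF.
  by rewrite e0 e1 min_l ?max_r// ltW.
- by rewrite e0 e1.
- by rewrite hseg_affine// e0 e1.
Qed.

Definition periodic (t : R) : M := c (t - (Num.floor t)%:~R).

(** Around the integer [m] the periodic extension is two translates of the loop glued at [m]; this
    avoids the jumps of the floor function, since every time lies well inside such a window. *)
Let unroll (m : int) : R -> M :=
  glue (fun t => c (1 * t + - (m - 1)%:~R)) (fun t => c (1 * t + - m%:~R)) m%:~R.

Let unroll_speed m : speed_le g L (m%:~R - 1) (m%:~R + 1) (unroll m).
Proof.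
have [_ cs c01 _] := c_ess.
have p1 (k : int) (a : R) : a = k%:~R ->
    speed_le g L a (a + 1) (fun t => c (1 * t + - k%:~R)).
  move=> ->; have := @speed_le_affine R n M X g L k%:~R (k%:~R + 1) 1 (- k%:~R) c.
  rewrite normr1 !mul1r subrr addrAC subrr add0r min_l ?max_r// oner_eq0.
  by apply => //; exact: ltW.
have e0 : 1 * m%:~R + - (m - 1)%:~R = 1 :> R by rewrite intrB; ring.
apply: speed_le_glue; first exact: ltW.
- by rewrite e0 mul1r subrr.
- by rewrite lerBlDr !lerDl ler01.
- have := p1 (m - 1) (m%:~R - 1); rewrite subrK; apply.
  by rewrite intrB.
- exact: p1.
Qed.

Let unrollE m s : m%:~R - 1 < s < m%:~R + 1 -> periodic s = unroll m s.
Proof.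
have [_ _ c01 _] := c_ess.
move=> /andP[h1 h2]; rewrite /periodic /unroll; have [sm|ms] := ltP s m%:~R.
  rewrite glueL ?(ltW sm)//; have -> : Num.floor s = m - 1.
    by apply: floor_def; rewrite subrK sm intrB (ltW h1).
  by rewrite mul1r.
rewrite glueR//; last by rewrite !mul1r subrr intrB opprB addrC subrK.
have -> : Num.floor s = m by apply: floor_def; rewrite ms intrD.
by rewrite mul1r.
Qed.

Let near_unroll (t : R) : exists m : int, \forall s \near t, m%:~R - 1 < s < m%:~R + 1.
Proof.
have /andP[h1 h2] := floor_itv t; rewrite intrD in h2.
exists (Num.floor t); have h3 : \forall s \near t, s < (Num.floor t)%:~R + 1.
  exact: lt_nbhsl.
have h4 : \forall s \near t, (Num.floor t)%:~R - 1 < s.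
  by apply: lt_nbhsr; apply: lt_le_trans h1; rewrite ltrBlDr ltrDl ltr01.
by apply: filterS2 h3 h4 => s -> ->.
Qed.

Lemma periodic_continuous : continuous periodic.
Proof.
move=> t W; have [m h] := near_unroll t; have [uc _] := unroll_speed m.
rewrite (unrollE (nbhs_singleton h)) => tW.
have uW : nbhs t (unroll m @^-1` W) by exact: uc.
suff sub : unroll m @^-1` W `&` [set s | m%:~R - 1 < s < m%:~R + 1] `<=`
    periodic @^-1` W by exact: filterS sub (filterI uW h).
by move=> s [hs sm]; rewrite /preimage /mkset (unrollE sm).
Qed.

Lemma periodic_speed (a b : R) : speed_le g L a b periodic.
Proof.
split; first exact: periodic_continuous.
move=> t i _ it e e0; have [m h] := near_unroll t; have [uc us] := unroll_speed m.
have tm := nbhs_singleton h; have tm' : m%:~R - 1 <= t <= m%:~R + 1.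
  by case/andP: tm => /ltW -> /ltW ->.
rewrite (unrollE tm) in it *; have := us t i tm' it e e0.
move=> h2; apply: filterS2 h2 h => s h2 sm _; rewrite (unrollE sm); apply: h2 => /=.
by case/andP: sm => /ltW -> /ltW ->.
Qed.

Lemma periodicD1 t : periodic (t + 1) = periodic t.
Proof.
rewrite /periodic; have -> : Num.floor (t + 1) = Num.floor t + 1.
  by apply: floor_def; rewrite !intrD !lerD2r !ltrD2r -intrD floor_itv.
by rewrite intrD opprD addrACA subrr addr0.
Qed.

(** The starting time is irrelevant: the piece from 1 to [a + 1] is a translate of the piece from 0
    to [a]. *)
Lemma hseg_periodic a : hseg periodic a (a + 1) <> 0.
Proof.
have pc := periodic_continuous; have [_ [cc _] c01 ch] := c_ess.
have h1 : hseg periodic 1 (a + 1) = hseg periodic 0 a.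
  have := @hseg_affine R M periodic 1 1 0 a pc.
  rewrite mulr0 add0r mul1r => <-; congr hseg; apply/funext => t.
  by rewrite mul1r periodicD1.
rewrite (hseg_trans a 0 (a + 1) pc) (hseg_trans 0 1 (a + 1) pc) h1.
rewrite addrCA -hseg_trans// hseg_id// addr0.
rewrite (eq_hseg (c' := c) ler01 pc cc)// => t /andP[t0].
rewrite le_eqVlt => /orP[/eqP->|t1].
  rewrite -[in LHS](add0r 1) periodicD1 -c01 /periodic.
  have -> : Num.floor (0 : R) = 0 by apply: floor_def; rewrite lexx add0r ltr01.
  by rewrite subr0.
rewrite /periodic; have -> : Num.floor t = 0 by apply: floor_def; rewrite t0 add0r.
by rewrite subr0.
Qed.

(** A slower arc run at speed [L] takes less time. Completed by the rest of the period, it is an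
    essential loop of speed [L] and duration below 1, against minimality. *)
Lemma periodic_chord_min (a b K : R) c' (W : set M) (pi : M -> @H1 R M) : a < b -> b - a < 1 -> 0 <= K ->
  speed_le g K a b c' -> c' a = periodic a -> c' b = periodic b ->
  potential W pi -> (forall t, a <= t <= b -> W (c' t) /\ W (periodic t)) -> L <= K.
Proof.
move=> ab ab1 K0 c's ca cb hpi hW; have pc := periodic_continuous.
rewrite leNgt; apply/negP => KL.
(* Still below [L], and positive so that one can divide by it. *)
pose K' := Num.max K (L / 2).
have L2 : 0 < L / 2 by rewrite divr_gt0.
have K'0 : 0 < K' by rewrite lt_max L2 orbT.
have K'L : K' < L by rewrite gt_max KL; lra.
have {}c's : speed_le g K' a b c' by apply: speed_leW c's; rewrite le_max lexx.
have c'c : continuous c' by case: c's.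
clearbody K'.
(* The acceleration factor; the map [k * t + m] fixes [b] and sends [a'], which is later than [a],
   to [a]. *)
pose k := L / K'; have k0 : 0 < k by rewrite divr_gt0.
pose a' := b - (b - a) / k; pose m := b - k * b.
have ea : k * a' + m = a by rewrite /a' /m; field; rewrite gt_eqF.
have eb : k * b + m = b by rewrite /m; ring.
have a'b : a' < b by rewrite /a' ltrBlDr ltrDl divr_gt0// subr_gt0.
pose d t := c' (k * t + m).
have ds : speed_le g L a' b d.
  have -> : L = `|k| * K' by rewrite gtr0_norm// /k divfK// gt_eqF.
  apply: speed_le_affine; [by rewrite gt_eqF|exact: ltW|].
  by rewrite ea eb min_l ?max_r// ltW.
have dc : continuous d by case: ds.
have db : d b = periodic b by rewrite /d eb.
have ba1 : b <= a + 1 by move: ab1; lra.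
have es : speed_le g L a' (a + 1) (glue d periodic b).
  apply: speed_le_glue; [exact: ltW|by []|by rewrite (ltW a'b)|by []|].
  exact: periodic_speed.
have h : L <= L * (a + 1 - a').
  apply: minimal_length es _ _ => //; [exact: ltW|exact: lt_le_trans ba1| |].
    by rewrite glueL ?(ltW a'b)// glueR// periodicD1 /d ea.
  rewrite hseg_glue ?(ltW a'b)// /d hseg_affine// ea eb.
  have h1 : hseg c' a b = hseg periodic a b.
    rewrite (hpi c' a b c'c (ltW ab)) => [|t /hW[]//].
    by rewrite (hpi periodic a b pc (ltW ab)) => [|t /hW[]//]; rewrite ca cb.
  by rewrite h1 -hseg_trans//; exact: hseg_periodic.
have : L * (a + 1 - a') < L * 1.
  rewrite ltr_pM2l//; have : (b - a) / k < b - a.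
    by rewrite ltr_pdivrMr// ltr_pMr ?subr_gt0// /k ltr_pdivlMr// mul1r.
  rewrite /a'; lra.
by move: h; lra.
Qed.

Lemma periodic_int t (m : int) : periodic (t + m%:~R) = periodic t.
Proof.
rewrite /periodic; have -> : Num.floor (t + m%:~R) = Num.floor t + m.
  apply: floor_def; have /andP[h1 h2] := floor_itv t.
  rewrite intrD lerD2r h1 addrAC intrD ltrD2r.
  by rewrite intrD in h2 *.
by rewrite intrD opprD addrACA subrr addr0.
Qed.

Lemma periodic_inj s t : periodic s = periodic t -> exists m : int, s = t + m%:~R.
Proof.
have pc := periodic_continuous.
have key u v : u < v -> v < u + 1 -> periodic u = periodic v -> False.
  move=> uv vu puv.
  have closed1 : periodic v = periodic (u + 1) by rewrite periodicD1.
  have := @hseg_periodic u; rewrite (hseg_trans u v (u + 1) pc).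
  have [h1|/eqP h1] := eqVneq (hseg periodic u v) 0.
    rewrite h1 add0r => h2.
    have := minimal_length (ltW L0) vu (periodic_speed v (u + 1)) closed1 h2.
    have : L * (u + 1 - v) < L * 1 by rewrite ltr_pM2l//; lra.
    lra.
  move=> _; have := minimal_length (ltW L0) uv (periodic_speed u v) puv h1.
  have : L * (v - u) < L * 1 by rewrite ltr_pM2l//; lra.
  lra.
move=> pst; have /andP[h1 h2] := floor_itv (s - t); rewrite intrD in h2.
set m := Num.floor (s - t) in h1 h2; exists m.
have : periodic (t + m%:~R) = periodic s by rewrite periodic_int.
have [->//|] := eqVneq s (t + m%:~R).
rewrite neq_lt => /orP[h3|h3] e; first by exfalso; move: h1 h3; lra.
by exfalso; apply: (key _ _ h3 _ e); move: h2; lra.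
Qed.

End Periodic.
End Minimal.

(** * Differentiability of the shortest loop *)

Section Regularity.
Context {R : realType} {n : nat} {M : topologicalType}.
Variables (X : smooth_atlas R n M) (g : riem_metric X) (i : chart_index X).
Variables (x0 : 'rV[R]_n) (r C L : R) (u : R -> 'rV[R]_n) (t0 d : R).
Local Notation G := (g i).

(* [u] is a chart expression of a curve of speed at most [L] that no competitor
   with the same endpoints can join at a smaller speed. *)
Record chord_minimal : Prop := ChordMinimal {
  cm_L : 0 < L;
  cm_d : 0 < d <= 1 / 2;
  cm_ball : forall t, `|t - t0| < d -> cball x0 (r / 2) (u t);
  cm_lip : forall s t, `|s - t0| < d -> `|t - t0| < d ->
    `|u s - u t| <= 2 * C * L * `|s - t|;
  cm_speed : forall s t v h, `|s - t0| < d -> `|t - t0| < d -> `|v - t0| < d ->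
    `|t - v| <= h -> `|s - t| <= h ->
    mnorm (G (u v)) (u s - u t) <= (1 + 4 * C ^+ 2 * L * h) * L * `|s - t|;
  cm_min : forall a b K (w : R -> 'rV[R]_n) (dw : R -> 'rV[R]_n),
    `|a - t0| < d -> `|b - t0| < d -> a < b -> 0 <= K -> w a = u a -> w b = u b ->
    (forall t, a <= t <= b -> [/\ cball x0 r (w t), is_derive t 1 w (dw t) &
       mnorm (G (w t)) (dw t) <= K]) ->
    L <= K }.

Hypothesis B : good_ball g i x0 r C.
Hypothesis H : chord_minimal.

Let C0 := gb_C B.
Let r0 := gb_r B.
Let L0 := cm_L H.

Let ball_r t : `|t - t0| < d -> cball x0 r (u t).
Proof.
by move=> td; apply: cball_sub (cm_ball H td); rewrite ler_pdivrMr// ler_peMr ?(ltW r0)// ler1n.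
Qed.

Let spd t : `|t - t0| < d -> spd_mx (G (u t)).
Proof. by move=> td; apply: metric_spd; apply: (gb_img B); exact: ball_r. Qed.

(** The competitor is the coordinate segment. By the Lipschitz bound it stays within
    [2 * C * L * (b - a)] of the end [z], whence the distortion factor. *)
Lemma chord_lower_forward a b z : `|a - t0| < d -> `|b - t0| < d -> a < b ->
  z = u a \/ z = u b ->
  L * (b - a) <= (1 + 2 * C ^+ 2 * L * (b - a)) * mnorm (G z) (u b - u a).
Proof.
move=> ad bd ab hz; have ba : 0 < b - a by rewrite subr_gt0.
have hzr : cball x0 r z by case: hz => ->; exact: ball_r.
pose v := (b - a)^-1 *: (u b - u a).
pose w (t : R) : 'rV[R]_n := (u a - a *: v) + t *: v.
have wE t : w t = u a + ((t - a) / (b - a)) *: (u b - u a).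
  by apply/rowP => k; rewrite !mxE; ring.
have wball t : a <= t <= b -> cball x0 r (w t) /\ `|w t - z| <= 2 * C * L * (b - a).
  move=> /andP[at_ tb].
  have t01 : 0 <= (t - a) / (b - a) <= 1.
    rewrite divr_ge0 ?subr_ge0//= ?(ltW ab)//.
    by rewrite ler_pdivrMr// mul1r lerD2r.
  split; first by rewrite wE; apply: cball_convex => //; exact: ball_r.
  have lip := cm_lip H bd ad; rewrite gtr0_norm// in lip.
  have zz : cball z (2 * C * L * (b - a)) z.
    by rewrite /cball/= subrr normr0 !mulr_ge0// ltW.
  rewrite wE; apply: cball_convex => //; rewrite /cball/=; case: hz => ->;
    rewrite ?subrr ?normr0 ?lip// ?mulr_ge0 ?(ltW C0) ?(ltW L0) ?(ltW ba)//.
  by rewrite distrC.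
pose K := (1 + 2 * C ^+ 2 * L * (b - a)) * mnorm (G z) v.
have f0 : 0 <= 2 * C ^+ 2 * L * (b - a) by rewrite !mulr_ge0 ?exprn_ge0// ltW.
have K0 : 0 <= K by rewrite mulr_ge0 ?mnorm_ge0// addr_ge0.
have hL : L <= K.
  apply: (@cm_min H a b K w (fun=> v)) => //.
  - by rewrite wE subrr mul0r scale0r addr0.
  - by rewrite wE divff ?gt_eqF// scale1r addrC subrK.
  move=> t tab; have [h1 h2] := wball t tab; split => //; first exact: is_derive_line.
  apply: le_trans (gb_osc B v hzr h1) _; rewrite ler_wpM2r ?mnorm_ge0// lerD2l.
  rewrite distrC; apply: le_trans (ler_wpM2l (ltW C0) h2) _.
  by rewrite le_eqVlt; apply/orP; left; apply/eqP; ring.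
have -> : mnorm (G z) (u b - u a) = (b - a) * mnorm (G z) v.

  by rewrite /v mnormZ// gtr0_norm ?invr_gt0// mulrA divff ?gt_eqF// mul1r.
by rewrite mulrC mulrCA ler_pM2l// mulrC.
Qed.

(** The metric may be frozen at either end of the chord, so the base point [a] can also be the later
    one and [h] negative. *)
Lemma chord_lower a h : `|a - t0| < d -> `|a + h - t0| < d ->
  L * `|h| <= (1 + 2 * C ^+ 2 * L * `|h|) * mnorm (G (u a)) (u (a + h) - u a).
Proof.
move=> ad bd; have [h0|h0|->] := ltgtP h 0.
- have ab : a + h < a by rewrite gtrDl.
  have := chord_lower_forward bd ad ab (or_intror (erefl _)).
  rewrite opprD addrA subrr add0r ltr0_norm// => h1.
  by rewrite -[u (a + h) - u a]opprB mnormN.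
- have ab : a < a + h by rewrite ltrDl.
  have := chord_lower_forward ad bd ab (or_introl (erefl _)).
  by rewrite addrAC subrr add0r gtr0_norm.
- by rewrite normr0 !mulr0 addr0 mul1r mnorm_ge0.
Qed.

Definition dq (a h : R) : 'rV[R]_n := h^-1 *: (u (a + h) - u a).

Let E := 4 * C ^+ 2 * L.
Let E0 : 0 <= E. Proof. by rewrite /E !mulr_ge0 ?exprn_ge0// ltW. Qed.

(* By minimality the chords from [a] to [a + th h] and to [a + h] are nearly as long
   as the arcs, so Stewart's identity makes their directions nearly equal. *)
Lemma chord_deviation a h th : `|a - t0| < d -> `|a + h - t0| < d ->
  0 < th <= 1 -> h != 0 ->
  `|dq a (th * h) - dq a h| ^+ 2 * th <= C ^+ 2 * L ^+ 2 * (3 * E + E ^+ 2) * `|h|.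
Proof.
move=> ad bd /andP[th0 th1] h0.
have hp : 0 < `|h| by rewrite normr_gt0.
have d2 := cm_d H; have /andP[dp dle] := d2.
have h1 : `|h| <= 1.
  have -> : h = (a + h - t0) - (a - t0) by ring.
  by apply: le_trans (ler_normB _ _) _; lra.
have sd : `|a + th * h - t0| < d.
  have -> : a + th * h - t0 = (1 - th) * (a - t0) + th * (a + h - t0) by ring.
  apply: le_lt_trans (ler_normD _ _) _; rewrite !normrM (gtr0_norm th0).
  rewrite ger0_norm ?subr_ge0//.
  have := ler_wpM2l (ltW th0) (ltW bd); have : (1 - th) * `|a - t0| <= (1 - th) * d.
    by rewrite ler_wpM2l ?subr_ge0// ltW.
  have := ltr_pM2l th0 `|a + h - t0| d; rewrite bd.
  lra.
have hA := spd ad.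
have aa : `|a - a| <= `|h| by rewrite subrr normr0 ltW.
set s := a + th * h in sd; set b := a + h in bd.
have nsa : `|s - a| = th * `|h| by rewrite /s addrAC subrr add0r normrM gtr0_norm.
have nsb : `|s - b| = (1 - th) * `|h|.
  have -> : s - b = - ((1 - th) * h) by rewrite /s /b; ring.
  by rewrite normrN normrM ger0_norm// subr_ge0.
have p1 : mnorm (G (u a)) (u s - u a) <= (1 + E * `|h|) * L * (th * `|h|).
  rewrite -nsa; apply: (cm_speed H sd ad ad aa); rewrite nsa.
  by rewrite ler_piMl// ltW.
have q1 : mnorm (G (u a)) (u s - u b) <= (1 + E * `|h|) * L * ((1 - th) * `|h|).
  rewrite -nsb; apply: (cm_speed H sd bd ad).
    by rewrite /b addrAC subrr add0r.
  by rewrite nsb ler_piMl ?(ltW hp)// gerBl ltW.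
have pq := chord_lower ad bd; rewrite -/b in pq.
(* The deviation of [u s] from the point dividing the chord in the ratio [th], written as a convex
   combination so that [stewart] expresses it by three lengths: two bounded above by the speed, one
   below by minimality. *)
have dev : u s - u a - th *: (u b - u a) =
    (1 - th) *: (u s - u a) + th *: (u s - u b).
  by apply/rowP => k; rewrite !mxE; ring.
have key : mnorm (G (u a)) (u s - u a - th *: (u b - u a)) ^+ 2 <=
    L ^+ 2 * (3 * E + E ^+ 2) * `|h| ^+ 3 * th.
  rewrite dev mnorm_sq// stewart// -!mnorm_sq//.
  have -> : u s - u a - (u s - u b) = u b - u a by apply/rowP => k; rewrite !mxE; ring.
  move: p1 q1 pq (mnorm_ge0 (G (u a)) (u s - u a)) (mnorm_ge0 (G (u a)) (u s - u b))
    (mnorm_ge0 (G (u a)) (u b - u a)) E0 => /=.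
  rewrite (_ : 2 * C ^+ 2 * L = E / 2); last by rewrite /E; field.
  move: (mnorm _ _) (mnorm _ _) (mnorm _ _) `|h| hp h1 E => S Q P k k0 k1 F.
  move=> hP hQ hS P0 Q0 S0 F0.
  have hP2 : P ^+ 2 <= ((1 + F * k) * L * (th * k)) ^+ 2.
    by rewrite ler_pXn2r ?nnegrE//; exact: le_trans P0 hP.
  have hQ2 : Q ^+ 2 <= ((1 + F * k) * L * ((1 - th) * k)) ^+ 2.
    by rewrite ler_pXn2r ?nnegrE//; exact: le_trans Q0 hQ.
  (* The inequality [(1 + F * k / 2) ^+ 2 * (1 - F * k) <= 1] replaces a division; for [F * k >= 1]
     the claim is trivial. *)
  have hS2 : (L * k) ^+ 2 * (1 - F * k) <= S ^+ 2.
    have f0 : 0 <= F * k by rewrite mulr_ge0// ltW.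
    have : (L * k) ^+ 2 <= ((1 + F / 2 * k) * S) ^+ 2.
      have Lk : 0 <= L * k by rewrite mulr_ge0// ltW.
      by rewrite ler_pXn2r ?nnegrE//; exact: le_trans Lk hS.
    rewrite [((1 + _) * S) ^+ 2]exprMn => h2.
    have [f1|f1] := leP 1 (F * k).
      by apply: le_trans (sqr_ge0 S); rewrite mulr_ge0_le0 ?sqr_ge0// subr_le0.
    have h3 : (L * k) ^+ 2 * (1 - F * k) <= (1 + F / 2 * k) ^+ 2 * S ^+ 2 * (1 - F * k).
      by rewrite ler_wpM2r// subr_ge0 ltW.
    apply: le_trans h3 _; rewrite mulrAC ler_piMl ?sqr_ge0//.
    have -> : (1 + F / 2 * k) ^+ 2 * (1 - F * k) =
       1 - (3 / 4 * (F * k) ^+ 2 + (F * k) ^+ 3 / 4) by field.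
    by have := exprn_ge0 2 f0; have := exprn_ge0 3 f0; lra.
  have t10 : 0 <= 1 - th by rewrite subr_ge0.
  have h1' := ler_wpM2l t10 hP2.
  have h2' := ler_wpM2l (ltW th0) hQ2.
  have h3' := ler_wpM2l (mulr_ge0 (ltW th0) t10) hS2.

  have e2 : L ^+ 2 * k ^+ 3 * (3 * F + F ^+ 2 * k) * (th * (1 - th)) <=
      L ^+ 2 * (3 * F + F ^+ 2) * k ^+ 3 * th.
    rewrite [L ^+ 2 * k ^+ 3 * _]mulrAC; apply: ler_pM.
    - apply: mulr_ge0; last by apply: exprn_ge0; exact: ltW.
      apply: mulr_ge0; first exact: sqr_ge0.
      by have := mulr_ge0 (sqr_ge0 F) (ltW k0); lra.
    - by rewrite mulr_ge0// ltW.
    - rewrite ler_wpM2r ?exprn_ge0 ?(ltW k0)// ler_wpM2l ?exprn_ge0 ?(ltW L0)// lerD2l.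
      by rewrite ler_piMr// exprn_ge0.
    - by rewrite ler_piMr ?(ltW th0)// gerBl ltW.
  lra.
have dE : dq a (th * h) - dq a h = (th * h)^-1 *: (u s - u a - th *: (u b - u a)).
  rewrite /dq -/s -/b; apply/rowP => k; rewrite !mxE; field.
  by rewrite h0 gt_eqF.
have lowb : `|u s - u a - th *: (u b - u a)| ^+ 2 <=
    C ^+ 2 * (L ^+ 2 * (3 * E + E ^+ 2) * `|h| ^+ 3 * th).
  apply: le_trans (ler_wpM2l (exprn_ge0 2 (ltW C0)) key).
  rewrite -exprMn ler_pXn2r ?nnegrE ?mulr_ge0 ?mnorm_ge0 ?(ltW C0)//.
  by apply: (gb_lower B); exact: ball_r.
rewrite dE normrZ exprMn normfV normrM (gtr0_norm th0).
have -> : (th * `|h|)^-1 ^+ 2 * `|u s - u a - th *: (u b - u a)| ^+ 2 * th =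
  `|u s - u a - th *: (u b - u a)| ^+ 2 / (`|h| ^+ 2 * th).
  by field; rewrite !gt_eqF.
rewrite ler_pdivrMr ?mulr_gt0 ?exprn_gt0//; apply: le_trans lowb _.
by rewrite le_eqVlt; apply/orP; left; apply/eqP; ring.
Qed.

Let Q := C ^+ 2 * L ^+ 2 * (3 * E + E ^+ 2).
Let Q0 : 0 <= Q.
Proof. by rewrite /Q !mulr_ge0 ?exprn_ge0// ?addr_ge0 ?mulr_ge0 ?exprn_ge0// ltW. Qed.

(** The constant of a Hoelder estimate of exponent one half for the difference quotients. *)
Definition dq_const := Num.sqrt (2 * Q).
Let A := dq_const.
Let A0 : 0 <= A. Proof. exact: sqrtr_ge0. Qed.

Let inJ a h th : `|a - t0| < d -> `|a + h - t0| < d -> 0 <= th <= 1 ->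
  `|a + th * h - t0| < d.
Proof.
move=> ad bd /andP[th0 th1].
have -> : a + th * h - t0 = (1 - th) * (a - t0) + th * (a + h - t0) by ring.
apply: le_lt_trans (ler_normD _ _) _; rewrite !normrM (ger0_norm th0).
rewrite ger0_norm ?subr_ge0//.
have [->|th0'] := eqVneq th 0; first by rewrite subr0 mul1r mul0r addr0.
have thp : 0 < th by rewrite lt_neqAle eq_sym th0' th0.
have : (1 - th) * `|a - t0| <= (1 - th) * d by rewrite ler_wpM2l ?subr_ge0// ltW.
have := ltr_pM2l thp `|a + h - t0| d; rewrite bd; lra.
Qed.

(** Here the factor [th] of [chord_deviation] is at least one half and can be divided out. *)
Lemma dq_half a h th : `|a - t0| < d -> `|a + h - t0| < d ->
  1 / 2 <= th <= 1 -> h != 0 ->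
  `|dq a (th * h) - dq a h| <= A * Num.sqrt `|h|.
Proof.
move=> ad bd /andP[th1 th2] h0.
have thp : 0 < th by lra.
have := @chord_deviation a h th ad bd _ h0; rewrite thp th2 => /(_ isT) dev.
have Q20 : 0 <= 2 * Q := mulr_ge0 (ler0n _ 2) Q0.
have Qh : 0 <= 2 * Q * `|h| := mulr_ge0 Q20 (normr_ge0 h).
rewrite /A /dq_const -(sqrtrM _ Q20) -[leLHS]ger0_norm// -sqrtr_sqr (ler_sqrt _ Qh).
rewrite -/Q in dev.
have := ler_wpM2l (sqr_ge0 `|dq a (th * h) - dq a h|) th1.
lra.
Qed.

Let sqrt_half (x : R) : 0 <= x -> Num.sqrt (x / 2) <= 3 / 4 * Num.sqrt x.
Proof.
move=> xp; rewrite -(@ler_pXn2r _ 2)// ?nnegrE ?mulr_ge0 ?sqrtr_ge0//.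
by rewrite exprMn !sqr_sqrtr ?divr_ge0//; lra.
Qed.

Lemma dq_same_sign a h th : `|a - t0| < d -> `|a + h - t0| < d ->
  0 < th <= 1 -> h != 0 ->
  `|dq a (th * h) - dq a h| <= 4 * A * Num.sqrt `|h|.
Proof.
move=> ad bd /andP[th0 th1].
have [k hk] : exists k, (1 / 2) ^+ k <= th.
  exists (Num.trunc th^-1).+1; rewrite div1r exprVn invf_ple ?posrE ?exprn_gt0//.
  apply: ltW; have /andP[_ h1] := truncn_itv (ltW (etrans (invr_gt0 th) th0)).
  apply: lt_le_trans h1 _; rewrite -natrX ler_nat; apply: ltnW; exact: ltn_expl.
elim: k h th bd th0 th1 hk => [|k IH] h th bd th0 th1.
  rewrite expr0 => h1; have -> : th = 1 by apply/eqP; rewrite eq_le th1.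
  by rewrite mul1r subrr normr0 !mulr_ge0// sqrtr_ge0.
move=> hk h0.
have sq0 := mulr_ge0 A0 (sqrtr_ge0 `|h|).
have [h1|h1] := leP (1 / 2) th.
  apply: le_trans (dq_half ad bd _ h0) _; first by rewrite h1.
  by move: sq0; rewrite -mulrA; lra.
have half : 0 <= (1 / 2 : R) <= 1 by lra.
have bd' := inJ ad bd half.
have h0' : 1 / 2 * h != 0 by rewrite mulf_neq0// gt_eqF//; lra.
have := IH (1 / 2 * h) (2 * th) bd' _ _ _ h0'.
have -> : 2 * th * (1 / 2 * h) = th * h by field.
rewrite exprS in hk => /(_ _ _ _)h2.
have {}h2 : `|dq a (th * h) - dq a (1 / 2 * h)| <= 4 * A * Num.sqrt `|1 / 2 * h|.
  by apply: h2; lra.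
have := dq_half ad bd (th := 1 / 2) _ h0; rewrite lexx => h3.
have {}h3 : `|dq a (1 / 2 * h) - dq a h| <= A * Num.sqrt `|h| by apply: h3; lra.
have h4 : Num.sqrt `|1 / 2 * h| <= 3 / 4 * Num.sqrt `|h|.
  have -> : `|1 / 2 * h| = `|h| / 2.
    by rewrite normrM (@ger0_norm _ (1 / 2)); [rewrite div1r mulrC|lra].
  exact: sqrt_half.
have h5 := ler_wpM2l A0 h4.
rewrite -(subrK (dq a (1 / 2 * h)) (dq a (th * h))) -addrA.
apply: le_trans (ler_normD _ _) _; move: h2 h3 h5; lra.
Qed.

(** The slope over the interval from [a - h] to [a + h] is the mean of the slopes over its halves,
    so [dq_half] at [a - h] with step [2 * h] compares the two. *)
Lemma dq_opp a h : `|a - h - t0| < d -> `|a + h - t0| < d -> h != 0 ->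
  `|dq a h - dq a (- h)| <= 3 * A * Num.sqrt `|h|.
Proof.
move=> ad bd h0.
have bd' : `|a - h + 2 * h - t0| < d by rewrite (_ : a - h + 2 * h = a + h)//; ring.
have h20 : 2 * h != 0 by rewrite mulf_neq0// pnatr_eq0.
have := dq_half ad bd' (th := 1 / 2) _ h20; rewrite lexx => /(_ _)h1.
have {}h1 : `|dq (a - h) (1 / 2 * (2 * h)) - dq (a - h) (2 * h)|
   <= A * Num.sqrt `|2 * h| by apply: h1; lra.
have e : dq (a - h) (1 / 2 * (2 * h)) - dq (a - h) (2 * h) =
    (-1 / 2) *: (dq a h - dq a (- h)).
  rewrite /dq (_ : 1 / 2 * (2 * h) = h) ?subrK; last by field.
  rewrite (_ : a - h + 2 * h = a + h); last by ring.
  by apply/rowP => k; rewrite !mxE; field.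
move: h1; rewrite e normrZ => h1.
have : Num.sqrt `|h| = Num.sqrt (`|2 * h| / 2).
  by congr Num.sqrt; rewrite normrM ger0_norm// mulrC mulrA mulVf ?mul1r// pnatr_eq0.
have h2 : Num.sqrt `|2 * h| <= 3 / 2 * Num.sqrt `|h|.
  rewrite -(@ler_pXn2r _ 2)// ?nnegrE ?mulr_ge0 ?sqrtr_ge0// exprMn !sqr_sqrtr//.
  by rewrite normrM ger0_norm//; have := normr_ge0 h; lra.
have h3 := ler_wpM2l A0 h2.
have e2 : `|-1 / 2 : R| = 1 / 2 by rewrite mulN1r normrN ger0_norm ?invr_ge0// div1r.
rewrite e2 in h1.
by move: h1 h3; lra.
Qed.

(** Steps of opposite signs are compared through [dq a (- h)]; the constants 4 and 3 are rounded up
    to 8. *)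
Lemma dq_close a h h' : `|a - t0| + `|h| < d -> 0 < `|h'| <= `|h| ->
  `|dq a h' - dq a h| <= 8 * A * Num.sqrt `|h|.
Proof.
move=> ad /andP[h'0 h'h]; have hp : 0 < `|h| by exact: lt_le_trans h'h.
have h0 : h != 0 by rewrite -normr_gt0.
have nh (s : R) : `|s| = `|h| -> `|a + s - t0| < d.
  move=> sh; rewrite addrAC; apply: le_lt_trans (ler_normD _ _) _; by rewrite sh.
have ad0 : `|a - t0| < d by apply: le_lt_trans ad; rewrite lerDl.
pose th := `|h'| / `|h|.
have thp : 0 < th <= 1 by rewrite divr_gt0//= ler_pdivrMr// mul1r.
have sq0 := mulr_ge0 A0 (sqrtr_ge0 `|h|).
have [same|opp] : h' = th * h \/ h' = th * - h.
  rewrite /th; case: (ger0P h) h'h hp h0 => hs; case: (ger0P h') h'0 => hs' *;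
    [left|right|right|left]; field; rewrite ?oppr_eq0//.
- rewrite same; apply: le_trans (dq_same_sign ad0 (nh _ _) thp h0) _ => //.
  by move: sq0; rewrite -!mulrA; lra.
- rewrite opp; have nh0 : - h != 0 by rewrite oppr_eq0.
  have h1 := dq_same_sign ad0 (nh _ (normrN h)) thp nh0; rewrite normrN in h1.
  have h2 := dq_opp (nh _ (normrN h)) (nh _ erefl) h0.
  rewrite -(subrK (dq a (- h)) (dq a (th * - h))) -addrA.
  apply: le_trans (ler_normD _ _) _; rewrite distrC in h2.
  by move: sq0 h1 h2; rewrite -!mulrA; lra.
Qed.

Let small_sqrt (e k m : R) : 0 < e -> 0 <= k -> 0 < m ->
  exists2 h, 0 < h < m & k * Num.sqrt h <= e.
Proof.
move=> e0 k0 m0; have k1 : 0 < k + 1 by rewrite ltr_wpDl.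
exists (Num.min (m / 2) ((e / (k + 1)) ^+ 2)).
  rewrite lt_min divr_gt0// exprn_gt0 ?divr_gt0//= gt_min; apply/orP; left.
  by rewrite ltr_pdivrMr// mulr_natr mulr2n ltrDl.
apply: (@le_trans _ _ (k * (e / (k + 1)))).
  rewrite ler_wpM2l// -[leRHS]ger0_norm ?divr_ge0 ?(ltW e0) ?(ltW k1)//.
  by rewrite -sqrtr_sqr ler_sqrt ?sqr_ge0// ge_min lexx orbT.
by rewrite mulrCA ler_piMr ?(ltW e0)// ler_pdivrMr// mul1r lerDl.
Qed.

Let dq_quotient a :
  (fun h : R => h^-1 *: ((u \o shift a) (h *: (1 : R^o)) - u a)) = dq a.
Proof.
apply/funext => h; rewrite /dq /=.
have -> : h *: (1 : R^o) + a = a + h by rewrite addrC; congr (_ + _); exact: mulr1.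
by [].
Qed.

Lemma chord_derivable a : `|a - t0| < d -> derivable u a 1.
Proof.
move=> ad; rewrite /derivable.
rewrite dq_quotient.
apply: cauchy_cvg; apply: cauchy_exP => e e0.
have m0 : 0 < d - `|a - t0| by rewrite subr_gt0.
have A80 : 0 <= 8 * A by rewrite mulr_ge0.
have [h /andP[h0 hm] hA] := small_sqrt (divr_gt0 e0 (ltr0n _ 2)) A80 m0.
exists (dq a h).
change (nbhs (0 : R) (fun s => s != 0 -> ball (dq a h) e (dq a s))).
apply/nbhs_ballP; exists h => //= s; rewrite -ball_normE /= sub0r normrN => sh s0.
rewrite -ball_normE /= distrC; apply: (@le_lt_trans _ _ (e / 2)); last first.
  by rewrite ltr_pdivrMr// mulr_natr mulr2n ltrDl.
apply: le_trans hA; have := @dq_close a h s; rewrite (gtr0_norm h0); apply.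
  by move: hm; lra.
by rewrite normr_gt0 s0 ltW.
Qed.

Lemma dq_cvg a : `|a - t0| < d -> dq a @ 0^' --> ('D_1 u a : 'rV[R]_n).
Proof.
move=> ad; have := chord_derivable ad; rewrite /derivable /derive.
rewrite dq_quotient.
by [].
Qed.

Lemma dq_derive a h : h != 0 -> `|a - t0| + `|h| < d ->
  `|dq a h - 'D_1 u a| <= 8 * A * Num.sqrt `|h|.
Proof.
move=> h0 ad; have ad0 : `|a - t0| < d by apply: le_lt_trans ad; rewrite lerDl.
apply/ler_addgt0Pr => e e0; have /cvgrPdist_le/(_ e e0) hn := dq_cvg ad0.
have /nbhs_ballP[m /= m0 hm] : nbhs (0 : R) (fun s => s != 0 ->
  `|'D_1 u a - dq a s| <= e) by exact: hn.
pose s := Num.min (m / 2) `|h|.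
have hp : 0 < `|h| by rewrite normr_gt0.
have s0 : 0 < s by rewrite lt_min divr_gt0.
have sn0 : s != 0 by rewrite gt_eqF.
have sm : ball (0 : R) m s.
  rewrite -ball_normE /= sub0r normrN gtr0_norm// gt_min; apply/orP; left.
  by rewrite ltr_pdivrMr// mulr_natr mulr2n ltrDl.
have h1 := hm s sm sn0.
have h2 : `|dq a s - dq a h| <= 8 * A * Num.sqrt `|h|.
  by apply: dq_close => //; rewrite gtr0_norm// s0 ge_min lexx orbT.
have -> : dq a h - 'D_1 u a = (dq a h - dq a s) + (dq a s - 'D_1 u a) by rewrite addrA subrK.
apply: le_trans (ler_normD _ _) _; rewrite distrC; apply: lerD => //.
by rewrite distrC.
Qed.

Let sum_bound (p q k x y e : R) : p <= 8 * k * x -> q <= 8 * k * x ->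
  16 * k * y <= e -> k * x <= k * y -> p + q <= e.
Proof. lra. Qed.

(** The slope of the chord between [a] and [s] is close to the derivative at each of its ends. *)
Lemma derive_continuous a : `|a - t0| < d ->
  {for a, continuous (fun t : R => 'D_1 u t : 'rV[R]_n)}.
Proof.
move=> ad; apply/cvgrPdist_le => e e0.
have m0 : 0 < (d - `|a - t0|) / 2 by rewrite divr_gt0 ?subr_gt0.
have A160 : 0 <= 16 * A by rewrite mulr_ge0.
have [h /andP[h0 hm] hA] := small_sqrt e0 A160 m0.
apply: (@delta_near _ _ _ h) => // s sh.
have [->|sa] := eqVneq s a; first by rewrite subrr normr0 ltW.
have sa0 : s - a != 0 by rewrite subr_eq0.
have sd : `|s - t0| + `|s - a| < d.
  have -> : s - t0 = (s - a) + (a - t0) by ring.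
  by have := ler_normD (s - a) (a - t0); move: sh hm; lra.
have ad' : `|a - t0| + `|s - a| < d by move: sh hm; have := normr_ge0 (s - a); lra.
have h1 := dq_derive sa0 ad'.
have as0 : a - s != 0 by rewrite -oppr_eq0 opprB.
have sd2 : `|s - t0| + `|a - s| < d by rewrite [`|a - s|]distrC.
have h2 := dq_derive as0 sd2.
have e1 : dq s (a - s) = dq a (s - a).
  rewrite /dq ![_ + (_ - _)]addrC !subrK -[a - s]opprB invrN.
  by rewrite -[u a - u s]opprB scaleNr scalerN opprK.
rewrite e1 in h2; rewrite [`|a - s|]distrC in h2.
have -> : 'D_1 u a - 'D_1 u s = - (dq a (s - a) - 'D_1 u a) + (dq a (s - a) - 'D_1 u s) :> 'rV[R]_n.
  by rewrite opprB addrA subrK.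
apply: le_trans (ler_normD _ _) _; rewrite normrN.
have h3 : Num.sqrt `|s - a| <= Num.sqrt h by rewrite ler_sqrt ltW.
have h4 := ler_wpM2l A0 h3.
exact: sum_bound h1 h2 hA h4.
Qed.

Let le_sqrt_limit (x y k m : R) : 0 <= k -> 0 < m ->
  (forall h, 0 < h < m -> x <= y + k * Num.sqrt h) -> x <= y.
Proof.
move=> k0 m0 hx; apply/ler_addgt0Pr => e e0.
have [h hm hk] := small_sqrt e0 k0 m0.
by apply: le_trans (hx h hm) _; rewrite lerD2l.
Qed.

(** The speed bound gives one inequality and the chord comparison the other, both as [h] tends to 0.
    The equality later provides the energy of the closed geodesic. *)
Lemma derive_mnorm a : `|a - t0| < d -> mnorm (G (u a)) ('D_1 u a) = L.
Proof.
move=> ad; have hA := spd ad; have /andP[_ dle] := cm_d H.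
have m0 : 0 < d - `|a - t0| by rewrite subr_gt0.
set V := 'D_1 u a : 'rV[R]_n.
have hsq h : 0 < h < d - `|a - t0| -> h <= Num.sqrt h.
  move=> /andP[h0 hm]; have h1 : h <= 1 by have := normr_ge0 (a - t0); lra.
  rewrite -(@ler_pXn2r _ 2)// ?nnegrE ?sqrtr_ge0 ?(ltW h0)// sqr_sqrtr ?(ltW h0)//.
  by rewrite expr2 ler_piMr// ltW.
have near h : 0 < h < d - `|a - t0| -> mnorm (G (u a)) (dq a h - V) <= 8 * A * C * Num.sqrt h.
  move=> /andP[h0 hm]; apply: le_trans (gb_upper B _ (ball_r ad)) _.
  rewrite mulrAC mulrC ler_wpM2r// ?(ltW C0)//.
  have := @dq_derive a h; rewrite (gtr0_norm h0); apply; first by rewrite gt_eqF.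
  by move: hm; lra.
have dqE h : 0 < h -> mnorm (G (u a)) (u (a + h) - u a) = h * mnorm (G (u a)) (dq a h).
  move=> h0; rewrite /dq mnormZ// gtr0_norm ?invr_gt0// mulrA divff ?mul1r//.
  by rewrite gt_eqF.
have inb h : 0 < h < d - `|a - t0| -> `|a + h - t0| < d.
  move=> /andP[h0 hm]; rewrite addrAC; apply: le_lt_trans (ler_normD _ _) _.
  by rewrite (gtr0_norm h0); move: hm; lra.
have AC0 : 0 <= 8 * A * C by rewrite !mulr_ge0// ltW.
apply/eqP; rewrite eq_le; apply/andP; split.
  apply: (@le_sqrt_limit _ _ (E * L + 8 * A * C) _ _ m0); first by rewrite addr_ge0// mulr_ge0// ltW.
  move=> h hh; have /andP[h0 hm] := hh.
  have h1 : mnorm (G (u a)) (dq a h) <= (1 + E * h) * L.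
    rewrite -(@ler_pM2l _ h)// -dqE//.
    have := @cm_speed H (a + h) a a h (inb _ hh) ad ad; rewrite subrr normr0.
    rewrite addrAC subrr add0r (gtr0_norm h0) lexx => /(_ (ltW h0) isT).
    by rewrite [h * _]mulrC.
  have -> : V = - (dq a h - V) + dq a h by rewrite opprB subrK.
  apply: le_trans (mnormD hA _ _) _; rewrite mnormN//.
  have := near h hh; have := ler_wpM2l (mulr_ge0 E0 (ltW L0)) (hsq h hh).
  by move: h1; lra.
apply: (@le_sqrt_limit _ _ (E * mnorm (G (u a)) V + (1 + E) * (8 * A * C)) _ _ m0).
  by rewrite addr_ge0// mulr_ge0 ?mnorm_ge0// addr_ge0.
move=> h hh; have /andP[h0 hm] := hh.
have := chord_lower ad (inb _ hh); rewrite (gtr0_norm h0) dqE// mulrCA mulrC ler_pM2l// => h1.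
have h2 : mnorm (G (u a)) (dq a h) <= mnorm (G (u a)) V + 8 * A * C * Num.sqrt h.
  rewrite -[dq a h](subrK V); apply: le_trans (mnormD hA _ _) _.
  by rewrite addrC lerD2l near.
have h3 : 1 + 2 * C ^+ 2 * L * h <= 1 + E * h.
  by rewrite lerD2l ler_wpM2r ?(ltW h0)// /E ler_wpM2r ?(ltW L0)// ler_wpM2r ?exprn_ge0 ?(ltW C0)// ler_nat.
have h4 : (1 + 2 * C ^+ 2 * L * h) * mnorm (G (u a)) (dq a h) <=
    (1 + E * h) * (mnorm (G (u a)) V + 8 * A * C * Num.sqrt h).
  apply: ler_pM => //; last exact: mnorm_ge0.
  by rewrite addr_ge0// !mulr_ge0 ?exprn_ge0// ltW.
have h5 := hsq h hh.
have h6 := ler_wpM2l (mulr_ge0 E0 (mnorm_ge0 (G (u a)) V)) h5.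
have h7 : E * h * (8 * A * C * Num.sqrt h) <= E * (8 * A * C * Num.sqrt h).
  apply: ler_wpM2r; first exact: mulr_ge0 AC0 (sqrtr_ge0 _).
  rewrite -[leRHS]mulr1; apply: ler_wpM2l; first exact: E0.
  by have := normr_ge0 (a - t0); lra.
apply: le_trans h1 _; apply: le_trans h4 _.
move: h6 h7; rewrite mulrDl mul1r [(1 + E * h) * _]mulrDl; lra.
Qed.

End Regularity.

(** * The Euler-Lagrange equation *)

Section OneVariable.
Context {R : realType}.

Lemma antiderivative (f : R -> R) (a b : R) : continuous f ->
  exists F, forall t, a <= t <= b -> is_derive t 1 F (f t).
Proof.
(* Starting the integral at [a - 1] makes [a] an interior point, where the derivative is
   two-sided. *)
move=> fc; exists (fun x => \int[lebesgue_measure]_(t in `[a - 1, x]) (f t))%R.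
move=> t /andP[at_ tb].
have tb1 : t < b + 1 by apply: le_lt_trans tb _; rewrite ltrDl.
have at1 : a - 1 < t by apply: lt_le_trans at_; rewrite ltrBlDr ltrDl.
have fi : lebesgue_measure.-integrable `[a - 1, b + 1] (EFin \o f).
  apply: continuous_compact_integrable; first exact: segment_compact.
  exact: continuous_subspaceT.
have [h1 h2] := @continuous_FTC1_closed R f (a - 1) t (b + 1) tb1 fi at1 (fc t).
apply: (DeriveDef h1); rewrite -derive1E; exact: h2.
Qed.

Lemma uniform_continuity (f : R -> R) (a b e : R) : a <= b -> continuous f -> 0 < e ->
  exists2 d, 0 < d & forall s t, a <= s <= b -> a <= t <= b -> `|s - t| < d ->
    `|f s - f t| <= e.
Proof.
move=> ab fc e0.
pose P x := exists2 d, 0 < d & forall s t, a <= s <= x -> a <= t <= x -> s <= t ->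
  t - s < d -> `|f s - f t| <= e.
suff [d d0 hd] : P b.
  exists d => // s t sab tab; have [st|ts] := leP s t => h.
    by apply: hd => //; move: h; rewrite distrC ger0_norm// subr_ge0.
  by rewrite distrC; apply: hd => //; [exact: ltW|move: h; rewrite gtr0_norm// subr_gt0].
apply: (@real_induction _ P a b ab).
  exists 1 => // s t /andP[s1 s2] /andP[t1 t2] st _.
  have -> : s = t by apply/eqP; rewrite eq_le st (le_trans t2).
  by rewrite subrr normr0 ltW.
move=> x _; have e20 : 0 < e / 2 by rewrite divr_gt0.
have /cvgrPdist_le /(_ _ e20) hx := fc x; have [d d0 hd] := near_delta hx.
have ext y z : y <= z -> x - d < y -> z < x + d -> P y -> P z.
  move=> yz xy zx [m m0 hm]; exists (Num.min m (y - (x - d))).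
    by rewrite lt_min m0 subr_gt0.
  move=> s t /andP[as_ sz] /andP[at_ tz] st; rewrite lt_min => /andP[h1 h2].
  have [ty|yt] := leP t y; first by apply: hm => //; rewrite ?as_ ?at_//= (le_trans st).
  have h3 : `|f x - f s| <= e / 2.
    by apply: hd; rewrite ltr_distl; apply/andP; split; move: h2 yt sz zx; lra.
  have h4 : `|f x - f t| <= e / 2.
    by apply: hd; rewrite ltr_distl; apply/andP; split; move: h2 yt tz zx xy; lra.
  have -> : f s - f t = (f x - f t) - (f x - f s) by ring.
  by apply: le_trans (ler_normB _ _) _; lra.
exists d => //; split=> [s /andP[as_ sx] xs|Px s /andP[xs sb] sd].
  by apply: ext => //; [exact: ltW|rewrite ltrDl].
by apply: ext Px => //; [exact: ltW|rewrite ltrBlDr ltrDl].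
Qed.

Lemma bounded_segment (f : R -> R) (a b : R) : a <= b ->
  (forall t, a <= t <= b -> {for t, continuous f}) ->
  exists2 Y, 0 < Y & forall t, a <= t <= b -> `|f t| <= Y.
Proof.
move=> ab fc; have [|c _ hc] := @EVT_max R (fun t => `|f t|) a b ab.
  apply: continuous_in_subspaceT => t; rewrite inE/= in_itv/= => tab.
  by apply: (@ctscomp _ _ _ f (fun y => `|y|)); [exact: fc|exact: norm_continuous].
exists (`|f c| + 1); first by rewrite ltr_wpDl.
by move=> t tab; apply: le_trans (hc t _) _; [rewrite in_itv|rewrite lerDl].
Qed.

Lemma is_derive_continuous (V : normedModType R) (f : R -> V) (t : R) df :
  is_derive t 1 f df -> {for t, continuous f}.
Proof.
by move=> [fd _]; apply: differentiable_continuous; apply/derivable1_diffP.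
Qed.

Lemma is_derive_comp_scalar n (w : R -> 'rV[R]_n) (f : R -> R) (t df : R) dw :
  is_derive t 1 f df -> is_derive (f t) 1 w dw ->
  is_derive t 1 (w \o f) (df *: dw).
Proof.
move=> [fd <-] [wd <-].
have fd' : differentiable f t by apply/derivable1_diffP.
have wd' : differentiable w (f t) by apply/derivable1_diffP.
have d : differentiable (w \o f) t by exact: differentiable_comp.
apply: DeriveDef; first exact/derivable1_diffP.
rewrite [LHS]deriveE// diff_comp// [in RHS]deriveE// [in RHS]deriveE//=.
by rewrite -linearZ/=; congr ('d w (f t) _); rewrite /GRing.scale/= mulr1.
Qed.

End OneVariable.

(** * Second-order expansion of the squared speed *)

Section Taylor.
Context {R : realType} {n : nat} {M : topologicalType}.
Variables (X : smooth_atlas R n M) (g : riem_metric X) (i : chart_index X).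
Variables (x0 : 'rV[R]_n) (r C : R).
Hypothesis B : good_ball g i x0 r C.
Local Notation G := (g i).
Implicit Types x y v e : 'rV[R]_n.

Let C0 := gb_C B.

(* [dGdir x y] is the derivative of the metric at [x] in the direction [y]. *)
Definition dG (b : 'I_n) x : 'M[R]_n := \matrix_(c, e) partial b (fun z => G z c e) x.

Definition dGdir x y : 'M[R]_n := \sum_b y ord0 b *: dG b x.

Lemma bilin_le2 (A : 'M[R]_n) (k : R) e v : 0 <= k -> (forall a b, `|A a b| <= k) ->
  `|bilin A e v| <= n%:R ^+ 2 * k * `|e| * `|v|.
Proof.
move=> k0 Ak; rewrite bilinE; apply: le_trans (ler_norm_sum _ _ _) _.
have h : \sum_(a < n) `|\sum_b e ord0 a * A a b * v ord0 b| <=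
    \sum_(a < n) \sum_(b < n) `|e| * k * `|v|.
  apply: ler_sum => a _; apply: le_trans (ler_norm_sum _ _ _) _.
  apply: ler_sum => b _; rewrite !normrM; apply: ler_pM => //.
  - by apply: ler_pM => //; exact: coord_le_norm.
  - exact: coord_le_norm.
apply: le_trans h _; rewrite !sumr_const card_ord -mulrnA -[leLHS]mulr_natr natrM.
by rewrite le_eqVlt; apply/orP; left; apply/eqP; ring.
Qed.

Lemma metric_taylor x y a b : cball x0 r x -> cball x0 r (x + y) ->
  `|G (x + y) a b - G x a b - dGdir x y a b| <= n%:R * C * `|y| ^+ 2.
Proof.
move=> hx hy; pose f (z : 'rV[R]_n) : R^o := G z a b.
pose l (t : R) : 'rV[R]_n := x + t *: y.
have lin (t : R) : 0 <= t <= 1 -> cball x0 r (l t).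
  move=> t01; have -> : l t = x + t *: (x + y - x) by rewrite /l addrAC subrr add0r.
  exact: cball_convex.
pose df (t : R) : R := \sum_c y ord0 c * partial c f (l t).
have dfl (t : R) : 0 <= t <= 1 -> is_derive t 1 (f \o l : R -> R) (df t).
  move=> t01; apply: is_derive_comp_row; last exact: is_derive_line.
  by have [h _] := comp_smooth g i a b 1%N; apply: h; apply: (gb_img B); exact: lin.
have [t t01] := mvt_closed ler01 dfl.
have l1 : l 1 = x + y by rewrite /l scale1r.
have l0 : l 0 = x by rewrite /l scale0r addr0.
rewrite /= l1 l0 subr0 mulr1 /f => ->.
have -> : dGdir x y a b = \sum_c y ord0 c * partial c f x.
  by rewrite /dGdir summxE; apply: eq_bigr => c _; rewrite !mxE.
rewrite -sumrB; apply: le_trans (ler_norm_sum _ _ _) _.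
have : \sum_(c < n) `|y ord0 c * partial c f (l t) - y ord0 c * partial c f x| <=
   \sum_(c < n) C * `|y| ^+ 2.
  apply: ler_sum => c _; rewrite -mulrBr normrM.
  have [_ h1] := gb_dcoef B a b c (lin _ t01) hx.
  have h2 : `|l t - x| <= `|y|.
    rewrite /l addrAC subrr add0r normrZ; case/andP: t01 => t0 t1.
    by rewrite ger0_norm// ler_piMl.
  have h3 := coord_le_norm y c.
  have h4 : `|partial c f (l t) - partial c f x| <= C * `|y|.
    by apply: le_trans h1 _; rewrite ler_wpM2l// ltW.
  apply: le_trans (ler_pM _ _ h3 h4) _ => //.
  by rewrite expr2 mulrCA.
by move=> /le_trans; apply; rewrite sumr_const card_ord -[leLHS]mulr_natl mulrA.
Qed.

Lemma mnorm_bound x v (L : R) : cball x0 r x -> mnorm (G x) v = L -> `|v| <= C * L.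
Proof. by move=> hx <-; exact: (gb_lower B). Qed.

Lemma dGdir_bilin x y v : bilin (dGdir x y) v v = \sum_b y ord0 b * bilin (dG b x) v v.
Proof.
rewrite /dGdir /bilin mulmx_sumr mulmx_suml summxE; apply: eq_bigr => b _.
by rewrite -scalemxAr -scalemxAl mxE.
Qed.

(** The constant [K] depends on the cube and on the bounds [Y] and [L] alone, which makes the
    expansion uniform along an arc. *)
Lemma speed_variation (Y L : R) : 0 <= Y -> 0 <= L -> exists2 K, 0 <= K &
  forall x v y e eps, cball x0 r x -> cball x0 r (x + eps *: y) ->
    mnorm (G x) v = L -> `|y| <= Y -> `|e| <= Y -> 0 <= eps <= 1 ->
    bilin (G (x + eps *: y)) (v + eps *: e) (v + eps *: e) <=
    L ^+ 2 + 2 * eps * (bilin (G x) v e + 1 / 2 * bilin (dGdir x y) v v) + K * eps ^+ 2.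
Proof.
move=> Y0 L0; pose D := C * L; have D0 : 0 <= D by rewrite mulr_ge0// ltW.
(* These bound the Taylor remainder of the metric, the change of the metric in the mixed term, and
   the term quadratic in [e]. *)
pose k1 := n%:R ^+ 2 * (n%:R * C * Y ^+ 2) * D ^+ 2.
pose k2 := n%:R ^+ 2 * (C * Y) * D * Y.
pose k3 := n%:R ^+ 2 * C * Y * Y.
have k10 : 0 <= k1 by rewrite !mulr_ge0 ?exprn_ge0 ?ler0n// ltW.
have k20 : 0 <= k2 by rewrite !mulr_ge0 ?exprn_ge0 ?ler0n// ltW.
have k30 : 0 <= k3 by rewrite !mulr_ge0 ?exprn_ge0 ?ler0n// ltW.
exists (k1 + 2 * k2 + k3); first by lra.
move=> x v y e eps hx hy vL yY eY /andP[e0 e1].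
have hvD : `|v| <= D by exact: mnorm_bound vL.
have sx : spd_mx (G x) by apply: metric_spd; exact: (gb_img B).
have sy : spd_mx (G (x + eps *: y)) by apply: metric_spd; exact: (gb_img B).
have neps : `|eps *: y| <= eps * Y by rewrite normrZ ger0_norm// ler_wpM2l.
have vL2 : bilin (G x) v v = L ^+ 2 by rewrite -vL mnorm_sq.
have h1 : `|bilin (G (x + eps *: y) - G x - dGdir x (eps *: y)) v v| <= k1 * eps ^+ 2.
  have kk : 0 <= n%:R * C * (eps * Y) ^+ 2 by rewrite !mulr_ge0 ?exprn_ge0 ?mulr_ge0// ltW.
  apply: le_trans (bilin_le v kk _) _.
    move=> a b; rewrite ![in X in `|X|]mxE; apply: le_trans (metric_taylor a b hx hy) _.
    apply: ler_wpM2l; first by rewrite mulr_ge0// ltW.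
    by rewrite ler_pXn2r ?nnegrE ?mulr_ge0.
  have -> : k1 * eps ^+ 2 = n%:R ^+ 2 * (n%:R * C * (eps * Y) ^+ 2) * D ^+ 2 by rewrite /k1; ring.
  by apply: ler_wpM2l; [rewrite mulr_ge0 ?exprn_ge0|rewrite ler_pXn2r ?nnegrE].
have h2 : `|bilin (G (x + eps *: y) - G x) v e| <= k2 * eps.
  have kk : 0 <= C * (eps * Y) by rewrite !mulr_ge0// ltW.
  apply: le_trans (bilin_le2 v e kk _) _.
    move=> a b; rewrite ![in X in `|X|]mxE; have [_ h] := gb_coef B a b hy hx.
    apply: le_trans h _; rewrite addrAC subrr add0r; apply: ler_wpM2l => //; exact: ltW.
  have -> : k2 * eps = n%:R ^+ 2 * (C * (eps * Y)) * D * Y by rewrite /k2; ring.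
  apply: ler_pM => //; first by rewrite !mulr_ge0 ?exprn_ge0// ltW.
  by apply: ler_wpM2l => //; rewrite mulr_ge0 ?exprn_ge0.
have h3 : `|bilin (G (x + eps *: y)) e e| <= k3.
  apply: le_trans (bilin_le2 e e (ltW C0) _) _.
    by move=> a b; have [h _] := gb_coef B a b hy hy.
  have k0 : 0 <= n%:R ^+ 2 * C by rewrite mulr_ge0 ?exprn_ge0// ltW.
  rewrite /k3; apply: ler_pM => //; first by rewrite mulr_ge0.
  exact: ler_wpM2l.
rewrite bilinDD// !bilinZr bilinZl.
rewrite !bilinBmx vL2 in h1; rewrite bilinBmx in h2.
have dE : bilin (dGdir x (eps *: y)) v v = eps * bilin (dGdir x y) v v.
  rewrite !dGdir_bilin mulr_sumr; apply: eq_bigr => b _.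
  by rewrite !mxE mulrA.
rewrite dE in h1.
move: h1 h2 h3; rewrite !ler_norml => /andP[_ h1] /andP[_ h2] /andP[_ h3].
have h2' := ler_wpM2l e0 h2; have h3' := ler_wpM2l (sqr_ge0 eps) h3.
move: h1 h2' h3'; rewrite expr2.
move: (bilin (G (x + eps *: y)) v v) (bilin (dGdir x y) v v)
  (bilin (G (x + eps *: y)) v e) (bilin (G x) v e) (bilin (G (x + eps *: y)) e e).
by move=> p q s t w; lra.
Qed.

End Taylor.

Section Arithmetic.
Variables (R : realType) (L K Y kap eps x y F s1 : R).
Let b1 := kap + L ^+ 2 * Y.
Let K3 := K + 4 * Y * b1 + Y ^+ 2 * L ^+ 2 + 2 * Y * K + 2 * Y ^+ 2 * b1 + Y ^+ 2 * K.
Hypotheses (L20 : 0 < L ^+ 2) (K0 : 0 <= K) (Y0 : 0 <= Y) (kap0 : 0 < kap)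
  (e0 : 0 < eps) (e1 : eps <= 1) (eK : eps * K3 <= kap / 2)
  (F1 : F <= L ^+ 2 + 2 * eps * s1 + K * eps ^+ 2)
  (dec : L ^+ 2 * y + s1 <= - kap) (dd : `|x - y| <= kap / (4 * L ^+ 2))
  (d1 : `|x| <= Y) (d2 : `|y| <= Y).

Let bb := kap + L ^+ 2 * y.

Let bbb : `|bb| <= b1.
Proof.
apply: le_trans (ler_normD _ _) _; rewrite gtr0_norm// lerD2l normrM gtr0_norm//.
by rewrite ler_wpM2l// ltW.
Qed.

Let F2 : F <= L ^+ 2 - 2 * eps * bb + K * eps ^+ 2.
Proof.
apply: le_trans F1 _; rewrite lerD2r lerD2l -mulrN ler_wpM2l ?mulr_ge0 ?(ltW e0)//.
by rewrite /bb; move: dec; lra.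
Qed.

Let main : 2 * eps * (L ^+ 2 * x - bb) <= - (3 / 2) * eps * kap.
Proof.
have h1 : L ^+ 2 * (x - y) <= kap / 4.
  have : x - y <= kap / (4 * L ^+ 2) by apply: le_trans dd; exact: ler_norm.
  have p4 : 0 < 4 * L ^+ 2 := mulr_gt0 (ltr0n _ 4) L20.
  rewrite ler_pdivlMr//; move: (L ^+ 2) => l; lra.
have := ler_wpM2l (ltW e0) h1; rewrite /bb; move: (L ^+ 2) => l; lra.
Qed.

Let rest : K - 4 * (x * bb) + x ^+ 2 * L ^+ 2 + eps * (2 * (x * K)) - eps * (2 * (x ^+ 2 * bb))
    + eps ^+ 2 * (x ^+ 2 * K) <= K3.
Proof.
have x2 : x ^+ 2 <= Y ^+ 2 by rewrite -[x ^+ 2]ger0_norm ?sqr_ge0// normrX ler_pXn2r ?nnegrE.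
have ab_le (p q P Q : R) : `|p| <= P -> `|q| <= Q -> `|p * q| <= P * Q.
  by move=> hp hq; rewrite normrM; apply: ler_pM.
have nx2 : `|x ^+ 2| <= Y ^+ 2 by rewrite ger0_norm ?sqr_ge0.
have nK : `|K| <= K by rewrite ger0_norm.
have c1 := ab_le _ _ _ _ d1 bbb.
have c2 := ab_le _ _ _ _ d1 nK.
have c3 := ab_le _ _ _ _ nx2 bbb.
have c4 := ab_le _ _ _ _ nx2 nK.
have c5 : x ^+ 2 * L ^+ 2 <= Y ^+ 2 * L ^+ 2 by rewrite ler_wpM2r// ltW.
have eps_le (p P : R) : `|p| <= P -> `|eps * p| <= P.
  move=> hp; rewrite normrM gtr0_norm//; apply: le_trans hp.
  by rewrite ler_piMl.
have c2' := eps_le _ _ c2.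
have c3' := eps_le _ _ c3.
have c4' := eps_le _ _ (eps_le _ _ c4).
move: c1 c2' c3' c4'; rewrite !ler_norml => /andP[c1 _] /andP[_ c2'] /andP[c3' _] /andP[_ c4'].
rewrite /K3 (_ : eps * (2 * (x * K)) = 2 * (eps * (x * K))); last by ring.
rewrite (_ : eps * (2 * (x ^+ 2 * bb)) = 2 * (eps * (x ^+ 2 * bb))); last by ring.
rewrite (_ : eps ^+ 2 * (x ^+ 2 * K) = eps * (eps * (x ^+ 2 * K))); last by ring.
move: c1 c2' c3' c4' c5.
move: (x * bb) (eps * (x * K)) (eps * (x ^+ 2 * bb)) (eps * (eps * (x ^+ 2 * K)))
  (x ^+ 2 * L ^+ 2) b1 => p q s t w b; lra.
Qed.

(** Here [F] is the squared speed of the varied curve at the new time, and [x], [y] are the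
    derivatives of the time shift at the old and the new time. As [x - y] is small, the first-order
    term is at most [- (3 / 2) * eps * kap]; [K3] bounds the coefficient of [eps ^+ 2], and this
    term takes back at most a third of the gain. *)
Lemma speed_decrease : (1 + eps * x) ^+ 2 * F <= L ^+ 2 - eps * kap.
Proof.
have F3 := ler_wpM2l (sqr_ge0 (1 + eps * x)) F2.
apply: le_trans F3 _.
have -> : (1 + eps * x) ^+ 2 * (L ^+ 2 - 2 * eps * bb + K * eps ^+ 2) =
  L ^+ 2 + 2 * eps * (L ^+ 2 * x - bb) + eps ^+ 2 *
  (K - 4 * (x * bb) + x ^+ 2 * L ^+ 2 + eps * (2 * (x * K)) - eps * (2 * (x ^+ 2 * bb))
    + eps ^+ 2 * (x ^+ 2 * K)) by ring.
have h1 := ler_wpM2l (sqr_ge0 eps) rest.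
have h2 := ler_wpM2l (ltW e0) eK.
have h3 : eps ^+ 2 * K3 = eps * (eps * K3) by rewrite expr2 mulrA.
have arith (p q s t w : R) : p <= - (3 / 2) * w -> q <= s -> s <= w / 2 ->
    t + p + q <= t - w by lra.
have m' : 2 * eps * (L ^+ 2 * x - bb) <= - (3 / 2) * (eps * kap).
  by rewrite mulrA; exact: main.
have h2' : eps ^+ 2 * K3 <= eps * kap / 2 by rewrite h3 -[leRHS]mulrA.
exact: arith m' h1 h2'.
Qed.

End Arithmetic.

Lemma is_derive_shift_scale (R : realType) (f : R -> R) (t df e : R) :
  is_derive t 1 f df -> is_derive t 1 (fun s => s + e * f s) (1 + e * df).
Proof. by move=> h; exact: (is_deriveD (is_derive_id t 1) (is_deriveZ e h)). Qed.

Lemma is_derive_add_scale (R : realType) (V : normedModType R) (f h : R -> V)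
    (t e : R) (df dh : V) : is_derive t 1 f df -> is_derive t 1 h dh ->
  is_derive t 1 (fun s => f s + e *: h s) (df + e *: dh).
Proof. by move=> hf hh; exact: (is_deriveD hf (is_deriveZ e hh)). Qed.

(** * Variations combined with a change of time *)

Section EulerLagrange.
Context {R : realType} {n : nat} {M : topologicalType}.
Variables (X : smooth_atlas R n M) (g : riem_metric X) (i : chart_index X).
Variables (x0 : 'rV[R]_n) (r C L : R) (u : R -> 'rV[R]_n) (t0 d : R).
Hypothesis B : good_ball g i x0 r C.
Hypothesis H : chord_minimal g i x0 r C L u t0 d.
Local Notation G := (g i).
Local Notation v t := ('D_1 u t : 'rV[R]_n).

Let L0 := cm_L H.
Let r0 := gb_r B.

Lemma inJ_itv (a b t : R) : `|a - t0| < d -> `|b - t0| < d -> a <= t <= b -> `|t - t0| < d.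
Proof. by rewrite !ltr_distl => /andP[h1 h2] /andP[h3 h4] /andP[h5 h6]; lra. Qed.

Lemma curve_is_derive (t : R) : `|t - t0| < d -> is_derive t 1 u (v t).
Proof. by move=> td; apply: DeriveDef => //; exact: (chord_derivable B H). Qed.

Lemma bounded_row (f : R -> 'rV[R]_n) (a b : R) : a <= b ->
  (forall t : R, a <= t <= b -> {for t, continuous f}) ->
  exists2 Y, 0 < Y & forall t : R, a <= t <= b -> `|f t| <= Y.
Proof.
move=> ab fc; have [|Y Y0 hY] := @bounded_segment R (fun t => `|f t|) a b ab.
  move=> t tab; apply: (@ctscomp _ _ _ f (fun y => `|y|)); first exact: fc.
  exact: norm_continuous.
by exists Y => // t /hY; rewrite normr_id.
Qed.

(** Half the derivative of the squared speed in the direction [eta], that is, the integrand of the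
    first variation of the energy. *)
Definition first_variation (eta deta : R -> 'rV[R]_n) (t : R) : R :=
  bilin (G (u t)) (v t) (deta t) + 1 / 2 * bilin (dGdir g i (u t) (eta t)) (v t) (v t).

Section Variation.
Variables (a b : R) (eta deta : R -> 'rV[R]_n) (th dth : R -> R) (kap : R).
Hypotheses (ad : `|a - t0| < d) (bd : `|b - t0| < d) (ab : a < b) (kap0 : 0 < kap).
Hypotheses (etad : forall t : R, a <= t <= b -> is_derive t 1 eta (deta t))
  (detac : forall t : R, a <= t <= b -> {for t, continuous deta})
  (thd : forall t : R, a <= t <= b -> is_derive t 1 th (dth t)) (dthc : continuous dth)
  (eta_a : eta a = 0) (eta_b : eta b = 0) (th_a : th a = 0) (th_b : th b = 0).
Hypothesis decrease : forall t : R, a <= t <= b ->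
  L ^+ 2 * dth t + first_variation eta deta t <= - kap.

Let ab' := ltW ab.

(* The reparametrization [t + eps th t] of the varied curve [u + eps eta] makes its
   speed uniformly smaller than [L]. *)
Lemma no_decreasing_variation : False.
Proof.
have etac (t : R) : a <= t <= b -> {for t, continuous eta}.
  by move=> tab; exact: is_derive_continuous (etad tab).
have thc (t : R) : a <= t <= b -> {for t, continuous th}.
  by move=> tab; exact: is_derive_continuous (thd tab).
have [Y1 Y10 hY1] := bounded_row ab' etac.
have [Y2 Y20 hY2] := bounded_row ab' detac.
have [Y3 Y30 hY3] := bounded_segment ab' (fun (t : R) _ => @dthc t).
have [Y4 Y40 hY4] := bounded_segment ab' thc.
pose Y := 1 + Y1 + Y2 + Y3 + Y4.
have Y_1 : 1 <= Y by rewrite /Y; lra.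
have Y_0 : 0 < Y by lra.
have bY1 t : a <= t <= b -> `|eta t| <= Y by move=> /hY1; rewrite /Y; lra.
have bY2 t : a <= t <= b -> `|deta t| <= Y by move=> /hY2; rewrite /Y; lra.
have bY3 t : a <= t <= b -> `|dth t| <= Y by move=> /hY3; rewrite /Y; lra.
have bY4 t : a <= t <= b -> `|th t| <= Y by move=> /hY4; rewrite /Y; lra.
clearbody Y.
have [K K0 hK] := speed_variation B (ltW Y_0) (ltW L0).
have L20 : 0 < L ^+ 2 by rewrite exprn_gt0.
have [m m0 hm] := uniform_continuity ab' dthc (divr_gt0 kap0 (mulr_gt0 (ltr0n _ 4) L20)).
pose b1 := kap + L ^+ 2 * Y.
pose K3 := K + 4 * Y * b1 + Y ^+ 2 * L ^+ 2 + 2 * Y * K + 2 * Y ^+ 2 * b1 + Y ^+ 2 * K.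
have b10 : 0 < b1 by rewrite ltr_wpDr// mulr_ge0// ltW.
have K30 : 0 < K3.
  have h1 : 0 <= Y * K by rewrite mulr_ge0// ltW.
  have h2 : 0 < Y * b1 by rewrite mulr_gt0.
  have h3 : 0 <= Y ^+ 2 * b1 by rewrite mulr_ge0 ?exprn_ge0// ltW.
  have h4 : 0 <= Y ^+ 2 * K by rewrite mulr_ge0 ?exprn_ge0// ltW.
  have h5 : 0 <= Y ^+ 2 * L ^+ 2 by rewrite mulr_ge0 ?exprn_ge0// ltW.
  by rewrite /K3; lra.
(* The four bounds keep the change of time increasing, keep the varied curve in the cube, let the
   uniform continuity of [dth] apply between old and new time, and make the quadratic error smaller
   than the gain. *)
pose eps := Num.min (1 / 2 / Y) (Num.min (r / 2 / Y) (Num.min (m / 2 / Y) (kap / 2 / K3))).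
have e0 : 0 < eps by rewrite !lt_min !divr_gt0.
have eY : eps * Y <= 1 / 2 by rewrite -ler_pdivlMr// ge_min lexx.
have er : eps * Y <= r / 2 by rewrite -ler_pdivlMr// !ge_min lexx !orbT.
have em : eps * Y <= m / 2 by rewrite -ler_pdivlMr// !ge_min lexx !orbT.
have eK : eps * K3 <= kap / 2 by rewrite -ler_pdivlMr// !ge_min lexx !orbT.
clearbody eps.
have e1 : eps <= 1 by have := ler_wpM2l (ltW e0) Y_1; lra.
pose tau (t : R) : R := t + eps * th t.
have taud (t : R) : a <= t <= b -> is_derive t 1 tau (1 + eps * dth t).
  by move=> tab; exact: is_derive_shift_scale (thd tab).
have lam_pos t : a <= t <= b -> 1 / 2 <= 1 + eps * dth t.
  move=> /bY3; rewrite ler_norml => /andP[h1 h2].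
  by have := ler_wpM2l (ltW e0) h1; lra.
have tau_a : tau a = a by rewrite /tau th_a mulr0 addr0.
have tau_b : tau b = b by rewrite /tau th_b mulr0 addr0.
have tau_itv t : a <= t <= b -> a <= tau t <= b.
  move=> /andP[at_ tb]; apply/andP; split.
    have [s /andP[s1 s2]] := mvt_closed at_ (fun (s : R) (h : a <= s <= t) => taud s
      (introT andP (conj (andP h).1 (le_trans (andP h).2 tb)))).
    rewrite tau_a => e; rewrite -subr_ge0 e mulr_ge0 ?subr_ge0//.
    by have := lam_pos s; rewrite s1 (le_trans s2 tb) => /(_ isT); lra.
  have [s /andP[s1 s2]] := mvt_closed tb (fun (s : R) (h : t <= s <= b) => taud s
      (introT andP (conj (le_trans at_ (andP h).1) (andP h).2))).
  rewrite tau_b => e; rewrite -subr_ge0 e mulr_ge0 ?subr_ge0//.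
  by have := lam_pos s; rewrite s2 (le_trans at_ s1) => /(_ isT); lra.
pose w (s : R) := u s + eps *: eta s.
have wd (s : R) : a <= s <= b -> is_derive s 1 w (v s + eps *: deta s).
  move=> sab; apply: is_derive_add_scale (etad sab).
  exact: curve_is_derive (inJ_itv ad bd sab).
have wball s : a <= s <= b -> cball x0 r (w s).
  move=> sab; rewrite /cball/= /w addrAC; apply: le_trans (ler_normD _ _) _.
  have := cm_ball H (inJ_itv ad bd sab); rewrite /cball/= => h1.
  have : `|eps *: eta s| <= eps * Y.
    by rewrite normrZ gtr0_norm// ler_wpM2l ?(ltW e0)// bY1.
  by move: h1 er; lra.
have uball s : a <= s <= b -> cball x0 r (u s).
  move=> sab; apply: cball_sub (cm_ball H (inJ_itv ad bd sab)).
  by rewrite ler_pdivrMr// ler_peMr ?(ltW r0)// ler1n.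
pose W := w \o tau.
pose dW t := (1 + eps * dth t) *: (v (tau t) + eps *: deta (tau t)).
pose K' := Num.sqrt (L ^+ 2 - eps * kap).
suff : L <= K'.
  rewrite leNgt /K' -[ltRHS](ger0_norm (ltW L0)) -sqrtr_sqr ltr_sqrt//.
  by rewrite ltrBlDr ltrDl mulr_gt0.
apply: (@cm_min _ _ _ _ _ _ _ _ _ _ _ _ _ H a b K' W dW) => //; first exact: sqrtr_ge0.
- by rewrite /W /w /= tau_a eta_a scaler0 addr0.
- by rewrite /W /w /= tau_b eta_b scaler0 addr0.
move=> t tab; have sab := tau_itv t tab; split; first exact: wball.
  by apply: is_derive_comp_scalar; [exact: taud|exact: wd].
set s := tau t in sab *; rewrite /dW -/s /W /= -/s.
have hA : spd_mx (G (w s)) by apply: metric_spd; apply: (gb_img B); exact: wball.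
rewrite /mnorm /K'; apply: ler_wsqrtr; rewrite bilinZl bilinZr mulrA -expr2.
have e01 : 0 <= eps <= 1 by rewrite (ltW e0).
have F1 := hK (u s) (v s) (eta s) (deta s) eps (uball _ sab) (wball _ sab)
  (derive_mnorm B H (inJ_itv ad bd sab)) (bY1 _ sab) (bY2 _ sab) e01.
rewrite -/(w s) -/(first_variation eta deta s) in F1.
have dec := decrease sab.
have dd : `|dth t - dth s| <= kap / (4 * L ^+ 2).
  apply: hm => //; rewrite distrC /s /tau addrAC subrr add0r normrM gtr0_norm//.
  by have := ler_wpM2l (ltW e0) (bY4 _ tab); move: em m0; lra.
have d1 := bY3 _ tab; have d2 := bY3 _ sab.
have lam := lam_pos _ tab.
have F0 := bilin_ge0 hA (v s + eps *: deta s).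
move: F1 F0 dec dd d1 d2 lam.
move: (bilin _ _ _) (first_variation _ _ _) (dth t) (dth s) => F s1 x y.
move=> F1 F0 dec dd d1 d2 lam.
exact: (speed_decrease L20 K0 (ltW Y_0) kap0 e0 e1 eK F1 dec dd d1 d2).
Qed.

End Variation.
End EulerLagrange.

Lemma is_derive_sumf (R : realType) n (h : 'I_n -> R -> R) (dh : 'I_n -> R) (t : R) :
  (forall i, is_derive t 1 (h i) (dh i)) ->
  is_derive t 1 (fun s => \sum_i h i s) (\sum_i dh i).
Proof.
move=> hd; have -> : (fun s => \sum_i h i s) = \sum_i h i.
  by apply/funext => s; rewrite fct_sumE.
exact: is_derive_sum.
Qed.

Lemma is_deriveMf (R : realType) (f h : R -> R) (t df dh : R) :
  is_derive t 1 f df -> is_derive t 1 h dh ->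
  is_derive t 1 (fun s => f s * h s) (f t * dh + h t * df).
Proof. by move=> hf hh; exact: (is_deriveM hf hh). Qed.

Lemma is_derive_near (R : realType) (f h : R -> R) (t df : R) :
  (\forall s \near t, f s = h s) -> is_derive t 1 f df -> is_derive t 1 h df.
Proof. by move=> fh fd; exact: (@near_eq_is_derive _ _ _ f h t 1 df). Qed.

Lemma is_derive_zero (R : realType) (f : R -> R) (t df c : R) :
  (\forall s \near t, f s = c) -> is_derive t 1 f df -> df = 0.
Proof.
move=> fc /(is_derive_near fc)[_ <-].
exact: derive_cst.
Qed.

(** * The integrated equation of du Bois-Reymond *)

Section Equation.
Context {R : realType} {n : nat} {M : topologicalType}.
Variables (X : smooth_atlas R n M) (g : riem_metric X) (i : chart_index X).
Variables (x0 : 'rV[R]_n) (r C L : R) (u : R -> 'rV[R]_n) (t0 d : R).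
Hypothesis B : good_ball g i x0 r C.
Hypothesis H : chord_minimal g i x0 r C L u t0 d.
Local Notation G := (g i).
Local Notation v t := ('D_1 u t : 'rV[R]_n).

(** The momentum conjugate to the velocity for the Lagrangian [1 / 2 * g(v, v)]. The function
    [force] is twice the position derivative of that Lagrangian, hence the factor [1 / 2] in the
    equation. *)
Definition momentum (c : 'I_n) (t : R) : R := (v t *m G (u t)) ord0 c.
Definition force (c : 'I_n) (t : R) : R := bilin (dG g i c (u t)) (v t) (v t).

Lemma curve_img (t : R) : `|t - t0| < d -> chart_img i (u t).
Proof.
move=> td; apply: (gb_img B); apply: cball_sub (cm_ball H td).
by rewrite ler_pdivrMr// ler_peMr ?(ltW (gb_r B))// ler1n.
Qed.

Lemma curve_continuous (t : R) : `|t - t0| < d -> {for t, continuous u}.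
Proof. by move=> td; exact: is_derive_continuous (curve_is_derive B H td). Qed.

Lemma velocity_coord_continuous (t : R) a : `|t - t0| < d ->
  {for t, continuous (fun s : R => v s ord0 a)}.
Proof.
move=> td; apply: (@ctscomp R 'rV[R]_n R (fun s => v s) (fun x => x ord0 a) t).
  exact: (derive_continuous B H).
exact: coord_continuous.
Qed.

Lemma coef_continuous (t : R) a b : `|t - t0| < d ->
  {for t, continuous (fun s : R => G (u s) a b)}.
Proof.
move=> td; apply: (@ctscomp R 'rV[R]_n R u (fun x => G x a b) t).
  exact: curve_continuous.
have [h _] := comp_smooth g i a b 1%N.
by apply: differentiable_continuous; apply: h; exact: curve_img.
Qed.

Lemma dcoef_continuous (t : R) a b c : `|t - t0| < d ->
  {for t, continuous (fun s : R => partial c (fun z => G z a b) (u s))}.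
Proof.
move=> td; apply: (@ctscomp R 'rV[R]_n R u (partial c (fun z => G z a b)) t).
  exact: curve_continuous.
have [_ h] := comp_smooth g i a b 1%N.
by have := h (delta_mx 0 c) (u t) (mem_set (curve_img td)).
Qed.

Lemma momentumE c t : momentum c t = \sum_a v t ord0 a * G (u t) a c.
Proof. by rewrite /momentum mxE. Qed.

Lemma forceE c t : force c t =
  \sum_a \sum_b v t ord0 a * partial c (fun z => G z a b) (u t) * v t ord0 b.
Proof.
by rewrite /force bilinE; do 2 (apply: eq_bigr => ? _); rewrite mxE.
Qed.

Lemma momentum_continuous (t : R) c : `|t - t0| < d ->
  {for t, continuous (momentum c)}.
Proof.
move=> td; have -> : momentum c = fun s => \sum_a v s ord0 a * G (u s) a c.
  by apply/funext => s; exact: momentumE.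
apply: cts_sum => a _; apply: ctsM; first exact: velocity_coord_continuous.
exact: coef_continuous.
Qed.

Lemma force_continuous (t : R) c : `|t - t0| < d -> {for t, continuous (force c)}.
Proof.
move=> td; have -> : force c = fun s =>
    \sum_a \sum_b v s ord0 a * partial c (fun z => G z a b) (u s) * v s ord0 b.
  by apply/funext => s; exact: forceE.
apply: cts_sum => a _; apply: cts_sum => b _; apply: ctsM; last first.
  exact: velocity_coord_continuous.
by apply: ctsM; [exact: velocity_coord_continuous|exact: dcoef_continuous].
Qed.

Lemma first_variationE (eta deta : R -> 'rV[R]_n) t :
  first_variation g i u eta deta t =
  \sum_c momentum c t * deta t ord0 c + 1 / 2 * \sum_c eta t ord0 c * force c t.
Proof.
rewrite /first_variation dGdir_bilin; congr (_ + _).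
by rewrite /bilin mxE; apply: eq_bigr => c _; rewrite [(_^T) _ _]mxE.
Qed.

Section Interval.
Variables (a b : R).
Hypotheses (ad : `|a - t0| < d) (bd : `|b - t0| < d) (ab : a < b).
Let ab' := ltW ab.
Let cl := clamp a b.

Let cts_clamp (f : R -> R) : (forall t, a <= t <= b -> {for t, continuous f}) ->
  continuous (fun t => f (cl t)).
Proof.
move=> fc t; apply: (@ctscomp R R R cl f t); first exact: clamp_continuous.
by apply: fc; exact: clamp_itv.
Qed.

Let clE t : a <= t <= b -> cl t = t. Proof. exact: clamp_id. Qed.

(* The du Bois-Reymond argument: a variation [e] whose derivative is the deviation
   of [momentum - A / 2] from its mean would decrease the speed, where [A] is an
   antiderivative of [force]. *)
Lemma momentum_antiderivative : exists (A : 'I_n -> R -> R) (k : 'I_n -> R),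
  (forall c t, a <= t <= b -> is_derive t 1 (A c) (force c t)) /\
  forall c t, a < t < b -> momentum c t = 1 / 2 * A c t + k c.
Proof.
have inJ t : a <= t <= b -> `|t - t0| < d by exact: (inJ_itv ad bd).
have qc c : continuous (fun t => force c (cl t)).
  by apply: cts_clamp => t /inJ; exact: force_continuous.
have pc c : continuous (fun t => momentum c (cl t)).
  by apply: cts_clamp => t /inJ; exact: momentum_continuous.
have [A hA] := choice (fun c => antiderivative a b (qc c)).
have {}hA c t : a <= t <= b -> is_derive t 1 (A c) (force c t).
  by move=> tab; have := hA c t tab; rewrite clE.
pose w c t := momentum c (cl t) - 1 / 2 * A c (cl t).
have wc c : continuous (w c).
  have Ac : continuous (fun t => A c (cl t)).
    by apply: cts_clamp => s sab; exact: is_derive_continuous (hA c s sab).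
  by move=> t; exact: (ctsB (@pc c t) (ctsM (@ctsC R R (1 / 2) t) (@Ac t))).
have [W hW] := choice (fun c => antiderivative a b (wc c)).
(* The mean of [w c], so that the variation [e c] vanishes at [b] as well as at [a]. *)
pose k c := (W c b - W c a) / (b - a).
have ba : b - a != 0 by rewrite subr_eq0 gt_eqF.
pose z t := \sum_c (w c t - k c) ^+ 2.
have zc : continuous z.
  move=> t; rewrite /z; apply: cts_sum => c _.
  have h : {for t, continuous (fun y => w c y - k c)}.
    exact: (ctsB (@wc c t) (@ctsC R R (k c) t)).
  exact: (ctsM h h).
have [Z hZ] := antiderivative a b zc.
have z0 t : 0 <= z t by apply: sumr_ge0 => c _; exact: sqr_ge0.
have Zmono s t : a <= s -> s <= t -> t <= b -> Z s <= Z t.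
  move=> as_ st tb; have [|x _] := @mvt_closed R Z z s t st.
    by move=> y /andP[y1 y2]; apply: hZ; rewrite (le_trans as_)//= (le_trans y2).
  move=> e; by rewrite -subr_ge0 e mulr_ge0// subr_ge0.
pose zeta := Z b - Z a.
pose e c t := - (W c t - W c a - k c * (t - a)).
pose de c t := - (w c t - k c).
have ed c t : a <= t <= b -> is_derive t 1 (e c) (de c t).
  move=> tab; have h := hW c t tab.
  have h1 : is_derive t 1 (fun s : R => k c * (s - a)) (k c).
    have := is_deriveZ (k c) (is_deriveB (is_derive_id t 1) (is_derive_cst a t 1)).
    by rewrite subr0 => h1; apply: is_derive_eq; exact: mulr1.
  have h2 := is_deriveN (is_deriveB (is_deriveB h (is_derive_cst (W c a) t 1)) h1).
  by rewrite subr0 in h2; exact: h2.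
have ea c : e c a = 0 by rewrite /e !subrr mulr0 subr0 oppr0.
have eb c : e c b = 0 by rewrite /e /k divfK// subrr oppr0.
have decont c : continuous (de c).
  by move=> t; exact: (ctsN (ctsB (@wc c t) (@ctsC R R (k c) t))).
pose eta t : 'rV[R]_n := \row_c e c t.
pose deta t : 'rV[R]_n := \row_c de c t.
have etad (t : R) : a <= t <= b -> is_derive t 1 eta (deta t).
  move=> tab; apply/is_derive_row => c; rewrite mxE.
  have -> : (fun s => eta s ord0 c) = e c by apply/funext => s; rewrite mxE.
  exact: ed.
have detac (t : R) : {for t, continuous deta}.
  apply: continuous_row => c.
  have -> : (fun s => deta s ord0 c) = de c by apply/funext => s; rewrite mxE.
  exact: decont.
pose fv t := \sum_c momentum c (cl t) * de c t + 1 / 2 * \sum_c e c (cl t) * force c (cl t).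
have fvE t : a <= t <= b -> first_variation g i u eta deta t = fv t.
  move=> tab; rewrite first_variationE /fv clE//; congr (_ + _ * _);
    by apply: eq_bigr => c _; rewrite mxE.
have fvc : continuous fv.
  have ec c : continuous (fun t => e c (cl t)).
    by apply: cts_clamp => s sab; exact: is_derive_continuous (ed c s sab).
  move=> t.
  have h1 : {for t, continuous (fun t => \sum_c momentum c (cl t) * de c t)}.
    by apply: cts_sum => c _; exact: (ctsM (@pc c t) (@decont c t)).
  have h2 : {for t, continuous (fun t => \sum_c e c (cl t) * force c (cl t))}.
    by apply: cts_sum => c _; exact: (ctsM (@ec c t) (@qc c t)).
  exact: (ctsD h1 (ctsM (@ctsC R R (1 / 2) t) h2)).
(* An antiderivative of the first variation, by parts: the momentum is [w + A / 2], and
   [(w - k) * de] sums to [- z]. *)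
pose S t := - Z t + \sum_c k c * e c t + 1 / 2 * \sum_c A c t * e c t.
have Sd t : a <= t <= b -> is_derive t 1 S (fv t).
  move=> tab; have h1 := is_deriveN (hZ t tab).
  have h2 : is_derive t 1 (fun s => \sum_c k c * e c s) (\sum_c k c * de c t).
    by apply: is_derive_sumf => c; exact: (is_deriveZ (k c) (ed c t tab)).
  have h3 : is_derive t 1 (fun s => \sum_c A c s * e c s)
      (\sum_c (A c t * de c t + e c t * force c t)).
    by apply: is_derive_sumf => c; exact: is_deriveMf (hA c t tab) (ed c t tab).
  have h4 := is_deriveD (is_deriveD h1 h2) (is_deriveZ (1 / 2) h3).
  apply: (@is_derive_eq _ _ _ _ _ _ _ _ h4).
  rewrite /fv clE// /z /GRing.scale/= -sumrN -big_split/= !mulr_sumr -!big_split/=.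
  apply: eq_bigr => c _; by rewrite /de /w clE//; field.
(* Chosen so that [L ^+ 2 * dth] plus the first variation is the constant [- (zeta / (b - a))]; it
   vanishes at [b] because the first variation has integral [- zeta]. *)
pose th t := (L ^+ 2)^-1 * (- (zeta / (b - a)) * (t - a) - (S t - S a)).
pose dth t := (L ^+ 2)^-1 * (- (zeta / (b - a)) - fv t).
have L20 : L ^+ 2 != 0 by rewrite expf_neq0// gt_eqF// (cm_L H).
have thd (s : R) : a <= s <= b -> is_derive s 1 th (dth s).
  move=> tab; have h1 := is_deriveZ (- (zeta / (b - a))) (is_deriveB (is_derive_id s 1) (is_derive_cst a s 1)).
  have h2 := is_deriveZ (L ^+ 2)^-1 (is_deriveB h1 (is_deriveB (Sd s tab) (is_derive_cst (S a) s 1))).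
  apply: (@is_derive_eq _ _ _ _ _ _ _ _ h2).
  by rewrite !subr0 /dth; congr (_ * (_ - _)); exact: mulr1.
have dthc : continuous dth.
  move=> t.
  exact: (ctsM (@ctsC R R ((L ^+ 2)^-1) t) (ctsB (@ctsC R R (- (zeta / (b - a))) t) (@fvc t))).
have Sends : S b - S a = - zeta.
  rewrite /S /zeta !big1 ?mulr0 ?addr0; first by ring.
  - by move=> c _; rewrite ea mulr0.
  - by move=> c _; rewrite ea mulr0.
  - by move=> c _; rewrite eb mulr0.
  - by move=> c _; rewrite eb mulr0.
have zeta0 : zeta <= 0.
  rewrite leNgt; apply/negP => zp.
  apply: (@no_decreasing_variation R n M X g i x0 r C L u t0 d B H a b eta deta th dth
    (zeta / (b - a))) => //.
  - by rewrite divr_gt0// subr_gt0.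
  - by apply/rowP => c; rewrite !mxE ea.
  - by apply/rowP => c; rewrite !mxE eb.
  - by rewrite /th !subrr mulr0 subr0 mulr0.
  - by rewrite /th Sends mulNr divfK// opprK addNr mulr0.
  move=> t tab; rewrite fvE// /dth mulrA divff// mul1r subrK.
  exact: lexx.
(* Since [zeta <= 0], the nondecreasing function [Z] is constant, which forces the deviation [z] to
   vanish. *)
have Zc t : a <= t <= b -> Z t = Z a.
  move=> /andP[at_ tb]; apply/eqP; rewrite eq_le (Zmono _ _ (lexx a) at_ tb) andbT.
  by apply: le_trans (Zmono t b at_ tb (lexx _)) _; rewrite -subr_le0.
exists A, k; split => // c t /andP[at_ tb].
have tab : a <= t <= b by rewrite !ltW.
have zt : z t = 0.
  apply: (is_derive_zero (c := Z a) _ (hZ t tab)).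
  have h1 : \forall s \near t, a < s by exact: lt_nbhsr.
  have h2 : \forall s \near t, s < b by exact: lt_nbhsl.
  by apply: filterS2 h1 h2 => s s1 s2; apply: Zc; rewrite !ltW.
have : (w c t - k c) ^+ 2 == 0.
  have := zt => /eqP; rewrite psumr_eq0; last by move=> c' _; exact: sqr_ge0.
  by move=> /allP/(_ c (mem_index_enum c)).
rewrite sqrf_eq0 subr_eq0 /w clE// => /eqP <-.
by rewrite addrC subrK.
Qed.

End Interval.

Lemma euler_lagrange c (t : R) : `|t - t0| < d ->
  is_derive t 1 (momentum c) (1 / 2 * force c t).
Proof.
move=> td; pose m := (d - `|t - t0|) / 2.
have m0 : 0 < m by rewrite divr_gt0// subr_gt0.
have near s : `|s| <= m -> `|t + s - t0| < d.
  move=> sm; rewrite addrAC; apply: le_lt_trans (ler_normD _ _) _.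
  by move: sm; rewrite /m; move: m0; rewrite /m; lra.
have ad : `|t - m - t0| < d by apply: near; rewrite normrN gtr0_norm.
have bd : `|t + m - t0| < d by apply: near; rewrite gtr0_norm.
have ab : t - m < t + m by lra.
have [A [k [hA hk]]] := momentum_antiderivative ad bd ab.
have tab : t - m <= t <= t + m by apply/andP; split; lra.
have h := is_deriveD (is_deriveZ (1 / 2) (hA c t tab)) (is_derive_cst (k c) t 1).
rewrite addr0 in h; apply: is_derive_near h.
have h1 : \forall s \near t, t - m < s by apply: lt_nbhsr; lra.
have h2 : \forall s \near t, s < t + m by apply: lt_nbhsl; lra.
by apply: filterS2 h1 h2 => s s1 s2; rewrite hk// s1.
Qed.

End Equation.

(** * Smoothness *)

Section OneVariable.
Context {R : realType}.
Implicit Types (A B : set R) (f h : R -> R).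

(** The derivative is a witness that matters on [A] only, so that it can be given by an explicit
    formula; [ck_is_Ck] returns to the general notion. *)
Fixpoint ck k A f : Prop :=
  if k is k'.+1 then
    exists2 f', (forall t, A t -> is_derive t 1 f (f' t)) & ck k' A f'
  else forall t, A t -> {for t, continuous f}.

Lemma ck_continuous k A f : ck k A f -> forall t, A t -> {for t, continuous f}.
Proof. by case: k => [//|k] [f' h _] t /h; exact: is_derive_continuous. Qed.

Lemma ckW k A f : ck k.+1 A f -> ck k A f.
Proof.
elim: k f => [|k IH] f; first exact: ck_continuous.
by move=> [f' fd /IH f'k]; exists f'.
Qed.

Lemma eq_ck k A f h : open A -> (forall t, A t -> f t = h t) -> ck k A f -> ck k A h.
Proof.
move=> Ao fh.
have near_fh (t : R) : A t -> \forall s \near t, f s = h s.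
  by move=> At; apply: filterS fh _; exact: open_nbhs_nbhs.
case: k => [fc t At|k [f' fd f'k]]; last first.
  by exists f' => // t At; apply: is_derive_near (near_fh t At) (fd t At).
have c : f @ t --> f t := fc t At; rewrite (fh t At) in c.
exact: cvg_trans (near_eq_cvg (near_fh t At)) c.
Qed.

Lemma ck_cst k A (a : R) : ck k A (fun=> a).
Proof.
elim: k a => [|k IH] a; first by move=> t _; exact: cst_continuous.
by exists (fun=> 0) => // t _; exact: is_derive_cst.
Qed.

Lemma ckD k A f h : ck k A f -> ck k A h -> ck k A (fun t => f t + h t).
Proof.
elim: k f h => [|k IH] f h.
  by move=> fc hc t At; exact: (ctsD (fc t At) (hc t At)).
move=> [f' fd f'k] [h' hd h'k]; exists (fun t => f' t + h' t); last exact: IH.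
by move=> t At; exact: (is_deriveD (fd t At) (hd t At)).
Qed.

Lemma ckM k A f h : ck k A f -> ck k A h -> ck k A (fun t => f t * h t).
Proof.
elim: k f h => [|k IH] f h.
  by move=> fc hc t At; exact: (ctsM (fc t At) (hc t At)).
move=> fk hk; case: (fk) (hk) => [f' fd f'k] [h' hd h'k].
exists (fun t => f t * h' t + h t * f' t).
  by move=> t At; exact: is_deriveMf (fd t At) (hd t At).
by apply: ckD; apply: IH => //; exact: ckW.
Qed.

Lemma ck_sum (I : Type) (s : seq I) (P : pred I) k A (F : I -> R -> R) :
  (forall j, ck k A (F j)) -> ck k A (fun t => \sum_(j <- s | P j) F j t).
Proof.
move=> Fk; elim: s => [|j s IH].
  rewrite (_ : (fun _ => _) = fun=> 0); first exact: ck_cst.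
  by apply/funext => t; rewrite big_nil.
case Pj : (P j).
  rewrite (_ : (fun _ => _) = fun t => F j t + \sum_(j <- s | P j) F j t); first exact: ckD.
  by apply/funext => t; rewrite big_cons Pj.
rewrite (_ : (fun _ => _) = fun t => \sum_(j <- s | P j) F j t)//.
by apply/funext => t; rewrite big_cons Pj.
Qed.

Lemma ck_prod (I : Type) (s : seq I) k A (F : I -> R -> R) :
  (forall j, ck k A (F j)) -> ck k A (fun t => \prod_(j <- s) F j t).
Proof.
move=> Fk; elim: s => [|j s IH].
  rewrite (_ : (fun _ => _) = fun=> 1); first exact: ck_cst.
  by apply/funext => t; rewrite big_nil.
rewrite (_ : (fun _ => _) = fun t => F j t * \prod_(j <- s) F j t); first exact: ckM.
by apply/funext => t; rewrite big_cons.
Qed.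

Lemma ckV k A f : (forall t, A t -> f t != 0) -> ck k A f -> ck k A (fun t => (f t)^-1).
Proof.
move=> f0; elim: k => [|k IH].
  by move=> fc t At; exact: (cvgV (f0 t At) (fc t At)).
move=> fk; case: (fk) => f' fd f'k.
exists (fun t => (-1 * f' t) * ((f t)^-1 * (f t)^-1)).
  move=> t At; have [d1 d2] := fd t At.
  apply: is_derive_eq (is_deriveV (f0 t At) (fd t At)) _.

  rewrite /GRing.scale/=; rewrite -exprVn; ring.
have fVk := IH (ckW fk).
by apply: ckM; apply: ckM => //; exact: ck_cst.
Qed.

Lemma ck_det m k A (F : R -> 'M[R]_m) :
  (forall a b, ck k A (fun t => F t a b)) -> ck k A (fun t => \det (F t)).
Proof.
move=> Fk; rewrite /determinant; apply: ck_sum => s; apply: ckM; first exact: ck_cst.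
exact: ck_prod.
Qed.

(** By Cramer's rule the entries are cofactors divided by the determinant. *)
Lemma ck_invmx m k A (F : R -> 'M[R]_m) a b : open A ->
  (forall t, A t -> F t \in unitmx) ->
  (forall a b, ck k A (fun t => F t a b)) -> ck k A (fun t => invmx (F t) a b).
Proof.
move=> Ao Fu Fk.
apply: (@eq_ck k A (fun t => (\det (F t))^-1 * ((-1) ^+ (b + a) * \det (row' b (col' a (F t)))))) => //.
  by move=> t At; rewrite /invmx Fu// !mxE.
apply: ckM.
  apply: ckV; last exact: ck_det.
  by move=> t /Fu; rewrite unitmxE unitfE.
apply: ckM; first exact: ck_cst.
apply: ck_det => p q.
by rewrite (_ : (fun _ => _) = fun t => F t (lift b p) (lift a q))//; apply/funext => t; rewrite !mxE.
Qed.

Lemma ck_comp n (D : set 'rV[R]_n) (f : 'rV[R]_n -> R) k A (u : R -> 'rV[R]_n) :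
  smooth_on D (f : _ -> R^o) -> (forall t, A t -> D (u t)) ->
  (forall a, ck k A (fun t => u t ord0 a)) -> ck k A (fun t => f (u t)).
Proof.
move=> + uD; elim: k f => [|k IH] f fs uk.
  move=> t At; apply: (@ctscomp R 'rV[R]_n R u f t).
    by apply: continuous_row => a; exact: uk.
  by have := fs 0%N => /(_ (u t) (mem_set (uD t At))).
have [u' hu'] := choice (fun a => let: ex_intro2 u' h1 h2 := uk a in ex_intro _ u' (conj h1 h2)).
exists (fun t => \sum_a u' a t * partial a f (u t)).
  move=> t At; have [fd _] := fs 1%N.
  have ud : is_derive t 1 u (\row_a u' a t).
    by apply/is_derive_row => a; rewrite mxE; exact: (hu' a).1.
  apply: is_derive_eq (is_derive_comp_row (fd _ (uD t At)) ud) _.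
  by apply: eq_bigr => a _; rewrite mxE.
apply: ck_sum => a; apply: ckM; first exact: (hu' a).2.
apply: IH; last by move=> b; exact: ckW.
by move=> m; have [_ h] := fs m.+1; exact: h.
Qed.

End OneVariable.

Section Ck.
Context {R : realType}.

Lemma eq_is_Ck (W : normedModType R) k (A : set R^o) (f h : R^o -> W) : open A ->
  (forall x, A x -> f x = h x) -> is_Ck k A f -> is_Ck k A h.
Proof.
move=> Ao; elim: k f h => [|k IH] f h fh /=.
  move=> fc x Ax; have near_fh : \forall y \near x, f y = h y.
    by apply: filterS fh _; apply: open_nbhs_nbhs; split => //; exact: set_mem.
  have c : f @ x --> f x := fc x Ax; rewrite (fh x (set_mem Ax)) in c.
  exact: cvg_trans (near_eq_cvg near_fh) c.
move=> [fd fk].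
have near_fh x : A x -> \forall y \near x, f y = h y.
  by move=> Ax; apply: filterS fh _; exact: open_nbhs_nbhs.
split=> [x Ax|v].
  apply/derivable1_diffP; apply: near_eq_derivable (near_fh x Ax) _.
  by apply/derivable1_diffP; exact: fd.
by apply: IH (fk v) => x Ax; apply: near_eq_derive; exact: near_fh.
Qed.

Lemma is_Ck_local (V W : normedModType R) k (A : set V) (f : V -> W) :
  (forall x, A x -> exists2 B : set V, B x & is_Ck k B f) -> is_Ck k A f.
Proof.
elim: k f => [|k IH] f h /=.
  by move=> x /set_mem /h[B Bx]; apply; exact: mem_set.
split.
  by move=> x Ax; have [B Bx Bk] := h x Ax; exact: Bk.1 x Bx.
by move=> v; apply: IH => x Ax; have [B Bx Bk] := h x Ax; exists B => //; exact: Bk.2 v.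
Qed.

Lemma ck_is_Ck n k (A : set R) (u : R -> 'rV[R]_n) : open A ->
  (forall a, ck k A (fun t => u t ord0 a)) -> is_Ck k (A : set R^o) (u : R^o -> _).
Proof.
move=> Ao; elim: k u => [|k IH] u uk /=.
  by move=> t /set_mem At; apply: continuous_row => a; exact: uk.
have [u' hu'] := choice (fun a => let: ex_intro2 u' h1 h2 := uk a in ex_intro _ u' (conj h1 h2)).
have ud t : A t -> is_derive t 1 u (\row_a u' a t).
  by move=> At; apply/is_derive_row => a; rewrite mxE; exact: (hu' a).1.
have udf t : A t -> differentiable (u : R^o -> _) t.
  by move=> /ud[h _]; apply/derivable1_diffP.
split=> // v; apply: (@eq_is_Ck _ _ _ (fun t => v *: \row_a u' a t)) => //.
  move=> t At; rewrite deriveE; last exact: udf.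
  have -> : v = v *: (1 : R^o) by rewrite /GRing.scale/= mulr1.
  by rewrite linearZ/= -deriveE; [have [_ ->] := ud t At; rewrite /GRing.scale/= mulr1|exact: udf].
apply: IH => a.
rewrite (_ : (fun _ => _) = fun t => v * u' a t); last by apply/funext => t; rewrite !mxE.
by apply: ckM; [exact: ck_cst|exact: (hu' a).2].
Qed.

End Ck.

(** * Bootstrapping from the Euler-Lagrange equation *)

Section Smooth.
Context {R : realType} {n : nat} {M : topologicalType}.
Variables (X : smooth_atlas R n M) (g : riem_metric X) (i : chart_index X).
Variables (x0 : 'rV[R]_n) (r C L : R) (u : R -> 'rV[R]_n) (t0 d : R).
Hypothesis B : good_ball g i x0 r C.
Hypothesis H : chord_minimal g i x0 r C L u t0 d.
Local Notation G := (g i).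
Local Notation v t := ('D_1 u t : 'rV[R]_n).
Let J := [set t : R | `|t - t0| < d].

Let J_open : open J.
Proof.
rewrite (_ : J = ball t0 d); first exact: ball_open.
by apply/seteqP; split => t; rewrite /J -ball_normE /= distrC.
Qed.

Let coord_derive t a : J t -> is_derive t 1 (fun s => u s ord0 a) (v t ord0 a).
Proof. 
by move=> Jt; have h := curve_is_derive B H Jt; exact: ((is_derive_row u t _).2 h a). Qed.

Let velocityE t a : J t -> v t ord0 a = \sum_c momentum g i u c t * invmx (G (u t)) c a.
Proof.
move=> Jt; have hu := metric_unit g (curve_img B H Jt).
rewrite -[v t in LHS](mulmxK hu) mxE; apply: eq_bigr => c _.
by rewrite /momentum.
Qed.

(** If the velocity has class [k], the position has class [k.+1] and the force class [k]. By the
    equation the momentum then has class [k.+1], and so has the velocity, its product with the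
    inverse metric. *)
Let velocity_ck k a : ck k J (fun t => v t ord0 a).
Proof.
elim: k a => [|k IH] a; first by move=> t Jt; exact: (@velocity_coord_continuous _ _ _ _ _ _ _ _ _ _ _ _ _ B H t a Jt).
have uk b : ck k.+1 J (fun t => u t ord0 b).
  by exists (fun t => v t ord0 b) => // t Jt; exact: coord_derive.
have uimg t : J t -> chart_img i (u t) by move=> Jt; exact: (curve_img B H Jt).
have Gk b c : ck k.+1 J (fun t => G (u t) b c).
  by apply: (@ck_comp R n (chart_img i) (fun x => G x b c)) => //; exact: comp_smooth.
have dGk b c e : ck k J (fun t => partial e (fun x => G x b c) (u t)).
  apply: (@ck_comp R n (chart_img i) (partial e (fun x => G x b c))) => //; last by move=> ?; exact: ckW.
  by move=> m; have [_ h] := comp_smooth g i b c m.+1; exact: h.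
have forcek c : ck k J (force g i u c).
  rewrite (_ : force g i u c = fun t => \sum_a \sum_b v t ord0 a * partial c (fun z => G z a b) (u t) * v t ord0 b).
    by apply: ck_sum => b; apply: ck_sum => e; apply: ckM => //; exact: ckM.
  by apply/funext => t; rewrite forceE.
have momk c : ck k.+1 J (momentum g i u c).
  exists (fun t => 1 / 2 * force g i u c t); last by apply: ckM => //; exact: ck_cst.
  by move=> t Jt; exact: (euler_lagrange B H c Jt).
apply: (@eq_ck R k.+1 J (fun t => \sum_c momentum g i u c t * invmx (G (u t)) c a)) => //.
  by move=> t Jt; rewrite velocityE.
apply: ck_sum => c; apply: ckM => //; apply: ck_invmx => // t Jt.
exact: metric_unit (curve_img B H Jt).
Qed.

Lemma minimal_smooth : smooth_on (J : set R^o) (u : R^o -> 'rV[R]_n).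
Proof.
move=> k; apply: ck_is_Ck => // a; apply: ckW.
by exists (fun t => v t ord0 a) => // t Jt; exact: coord_derive.
Qed.

Lemma minimal_acceleration (t : R) : J t -> exists2 w : 'rV[R]_n,
  is_derive t 1 (fun s : R => v s) w &
  forall c, w ord0 c + \sum_a \sum_b christoffel g i (u t) a b c * v t ord0 a * v t ord0 b = 0.
Proof.
move=> Jt.
have [v' hv'] := choice (fun a => let: ex_intro2 v' h1 h2 := velocity_ck 1 a in ex_intro _ v' (conj h1 h2)).
pose w : 'rV[R]_n := \row_a v' a t.
exists w; first by apply/is_derive_row => a; rewrite mxE; exact: (hv' a).1.
have ut := curve_img B H Jt; have Gu := metric_unit g ut.
pose D a b c := partial a (fun y => G y b c) (u t).
have Dsym a b c : D a b c = D a c b.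
  rewrite /D (_ : (fun y => G y b c) = fun y => G y c b)//.
  by apply/funext => y; rewrite -[in LHS](Defs.metric_sym g i y) mxE.
pose x a := v t ord0 a.
(* The coordinate acceleration with lowered index: half the force minus the contribution of the
   moving metric to the derivative of the momentum. *)
pose F c := 1 / 2 * (\sum_a \sum_b x a * D c a b * x b) - \sum_a \sum_b x a * (x b * D b a c).
have EL c : \sum_a G (u t) a c * v' a t = F c.
  have h1 : is_derive t 1 (momentum g i u c)
      (\sum_a (x a * (\sum_b x b * D b a c) + G (u t) a c * v' a t)).
    rewrite (_ : momentum g i u c = fun s => \sum_a v s ord0 a * G (u s) a c); last first.
      by apply/funext => s; rewrite momentumE.
    apply: is_derive_sumf => a; apply: is_deriveMf; first exact: (hv' a).1.
    have [h _] := comp_smooth g i a c 1%N.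
    exact: is_derive_comp_row (h _ ut) (curve_is_derive B H Jt).
  have [_ e1] := h1; have [_ e2] := euler_lagrange B H c Jt.
  move: e1; rewrite e2 big_split/= forceE => e1.
  have {}e1 : 1 / 2 * (\sum_a \sum_b x a * D c a b * x b) =
    \sum_a x a * (\sum_b x b * D b a c) + \sum_a G (u t) a c * v' a t := e1.
  rewrite /F e1 addrAC -sumrB [X in _ = X + _]big1 ?add0r// => a _.
  by rewrite mulr_sumr subrr.
have wG : w *m G (u t) = \row_c F c.
  by apply/rowP => c; rewrite !mxE -EL; apply: eq_bigr => a _; rewrite mxE mulrC.
have wE c : w ord0 c = \sum_m F m * invmx (G (u t)) m c.
  by rewrite -[w in LHS](mulmxK Gu) wG mxE; apply: eq_bigr => m _; rewrite mxE.
(* Summed against [x a * x b], the first two terms of the Christoffel symbol coincide by exchange of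
   the indices. *)
have FE m : 1 / 2 * \sum_a \sum_b (D a m b + D b a m - D m a b) * x a * x b = - F m.
  have e : \sum_a \sum_b D a m b * x a * x b = \sum_a \sum_b x a * (x b * D b a m).
    rewrite exchange_big/=; apply: eq_bigr => a _; apply: eq_bigr => b _.
    by rewrite (Dsym b a m); ring.
  transitivity (1 / 2 * (\sum_a \sum_b D a m b * x a * x b
      + \sum_a \sum_b x a * (x b * D b a m) - \sum_a \sum_b x a * D m a b * x b)).
    congr (_ * _); rewrite -big_split -sumrB/=; apply: eq_bigr => a _.
    by rewrite -big_split -sumrB/=; apply: eq_bigr => b _; ring.
  by rewrite e /F; field.
have Gsym m c : invmx (G (u t)) c m = invmx (G (u t)) m c.
  by rewrite -[in RHS](Defs.metric_sym g i (u t)) -trmx_inv mxE.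
move=> c; rewrite wE.
have -> : \sum_a \sum_b christoffel g i (u t) a b c * v t ord0 a * v t ord0 b =
    \sum_m - F m * invmx (G (u t)) m c.
  transitivity (\sum_a \sum_b \sum_m
      1 / 2 * ((D a m b + D b a m - D m a b) * x a * x b) * invmx (G (u t)) m c).
    apply: eq_bigr => a _; apply: eq_bigr => b _.
    rewrite /christoffel mulr_sumr !mulr_suml; apply: eq_bigr => m _.
    by rewrite Gsym /D /x; field.
  transitivity (\sum_m \sum_a \sum_b
      1 / 2 * ((D a m b + D b a m - D m a b) * x a * x b) * invmx (G (u t)) m c).
    rewrite [RHS]exchange_big/=; apply: eq_bigr => a _.
    by rewrite exchange_big.
  apply: eq_bigr => m _; rewrite -FE mulr_sumr mulr_suml; apply: eq_bigr => a _.
  by rewrite mulr_sumr mulr_suml.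
by rewrite -big_split/= big1// => m _; rewrite mulNr subrr.
Qed.

End Smooth.

(** * From chart expressions to curves in the manifold *)

Section Geodesic.
Context {R : realType} {n : nat} {M : topologicalType}.
Variables (X : smooth_atlas R n M) (M_hausdorff : hausdorff_space M) (g : riem_metric X).
Variables (L p : R) (c : R -> M).
Hypotheses (L0 : 0 < L) (p0 : 0 < p).
Hypothesis c_speed : forall a b, speed_le g L a b c.
Hypothesis c_min : forall (a b K : R) c' (W : set M) (pi : M -> @H1 R M),
  a < b -> b - a < p -> 0 <= K -> speed_le g K a b c' -> c' a = c a -> c' b = c b ->
  potential W pi -> (forall t, a <= t <= b -> W (c' t) /\ W (c t)) -> L <= K.
Local Notation dom := (@chart_dom _ _ _ X).
Local Notation ph := (@chart _ _ _ X).

Lemma local_chord_minimal i t0 : dom i (c t0) -> exists r C d,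
  [/\ good_ball g i (ph i (c t0)) r C,
      chord_minimal g i (ph i (c t0)) r C L (fun t => ph i (c t)) t0 d &
      forall t, `|t - t0| < d -> dom i (c t)].
Proof.
move=> it0; set x0 := ph i (c t0).
have [r [C [B Cr]]] := small_good_ball g (chart_img_in it0); rewrite -/x0 in B.
have r0 := gb_r B; have C0 := gb_C B.
(* Two times in the window differ by at most [2 * d], so this is half the time for which [stay]
   keeps the curve in the cube; the bound [p / 2] makes arcs shorter than [p]. *)
pose q := r / (32 * C * L).
have q0 : 0 < q by rewrite divr_gt0// !mulr_gt0.
pose d := Num.min (1 / 2) (Num.min (p / 2) q).
have d0 : 0 < d by rewrite !lt_min q0 !divr_gt0.
have d1 : d <= 1 / 2 by rewrite ge_min lexx.
have dp : d <= p / 2 by rewrite !ge_min lexx !orbT.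
have dq : 32 * C * L * d <= r.
  by rewrite mulrC -ler_pdivlMr ?mulr_gt0// !ge_min lexx !orbT.
clearbody d; clear q q0.
have L0' := ltW L0.
have CL0 : 0 <= C * L by rewrite mulr_ge0// ltW.
have itv t : `|t - t0| < d -> t0 - 1 <= t <= t0 + 1.
  by rewrite ltr_distl => /andP[h1 h2]; apply/andP; split; lra.
have t0itv : t0 - 1 <= t0 <= t0 + 1 by apply/andP; split; lra.
have dist s t : `|s - t0| < d -> `|t - t0| < d -> `|s - t| <= 2 * d.
  rewrite !ltr_distl => /andP[h1 h2] /andP[h3 h4].
  by rewrite ler_norml; apply/andP; split; lra.
have small e : e <= 2 * d -> 16 * C * L * e <= r.
  move=> ed; apply: le_trans dq; rewrite (_ : 32 * C * L * d = 16 * C * L * (2 * d)); last by ring.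
  by rewrite ler_wpM2l// -mulrA mulr_ge0.
have cs := c_speed (t0 - 1) (t0 + 1).
have half t : `|t - t0| < d -> tball i x0 (r / 2) (c t).
  move=> td; have e2 : 16 * C * L * `|t - t0| <= r by apply: small; lra.
  have [[h1 _] h2] := stay M_hausdorff B Cr L0' cs t0itv (itv t td)
    (tball_center (divr_ge0 (ltW r0) (ler0n _ _)) it0) e2.
  split => //; apply: le_trans h2 _; move: e2; lra.
exists r, C, d; split => //; last by move=> t /half[].
split => //.
- by rewrite d0.
- by move=> t /half[].
- move=> s t sd td.
  by have [_] := stay M_hausdorff B Cr L0' cs (itv t td) (itv s sd) (half t td) (small _ (dist _ _ sd td)).
- move=> s t v h sd td vd tv st.
  have [_ e1] := stay M_hausdorff B Cr L0' cs (itv v vd) (itv t td) (half v vd) (small _ (dist _ _ td vd)).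
  have {}e1 : `|ph i (c t) - ph i (c v)| <= 2 * C * L * h.
    by apply: le_trans e1 _; rewrite ler_wpM2l// !mulr_ge0// ltW.
  have vr : cball x0 r (ph i (c v)).
    by have [_ hv] := half v vd; apply: cball_sub hv; rewrite ler_pdivrMr// ler_peMr ?(ltW r0)// ler1n.
  have := near_speed M_hausdorff B Cr L0' cs (itv t td) (itv s sd) (half t td)
    (small _ (dist _ _ sd td)) vr e1.
  move=> h1; apply: le_trans h1 _; rewrite -mulrA -[leRHS]mulrA.
  have m1 := ler_wpM2l CL0 st.
  have key : C * (2 * C * L * h + 2 * C * L * `|s - t|) <= 4 * C ^+ 2 * L * h.
    have -> : 4 * C ^+ 2 * L * h = C * (2 * C * L * h + 2 * (C * L * h)) by ring.
    by rewrite ler_wpM2l ?(ltW C0)// lerD2l -!mulrA ler_wpM2l// !mulrA.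
  by apply: ler_wpM2r; [exact: mulr_ge0|rewrite lerD2l].
move=> a b K w dw ad bd ab K0 wa wb hw.
have [pi hpi] := local_potential (ltW r0) (gb_img B).
have wc t : a <= t <= b -> {for t, continuous w}.
  by move=> /hw[_ h _]; exact: is_derive_continuous h.
have wi t : a <= t <= b -> chart_img i (w t) by move=> /hw[h _ _]; exact: (gb_img B) h.
have aab : a <= a <= b by rewrite lexx ltW.
have bab : a <= b <= b by rewrite lexx ltW.
apply: (@c_min a b K (chart_curve i w a b) (tball i x0 r) pi) => //.
- move: ad bd; rewrite !ltr_distl => /andP[h1 h2] /andP[h3 h4]; lra.
- apply: chart_curve_speed => // [|t /hw[_ h1 h2]]; first exact: ltW.
  by exists (dw t).
- by rewrite /chart_curve clamp_id// wa; apply: chartKd; exact: (half a ad).1.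
- by rewrite /chart_curve clamp_id// wb; apply: chartKd; exact: (half b bd).1.
move=> t tab; split.
  split; first by apply: chart_curve_dom tab; exact: wi.
  by rewrite chart_curveK//; have [h _ _] := hw t tab.
apply: tball_sub (half t (inJ_itv ad bd tab)).
by rewrite ler_pdivrMr// ler_peMr ?(ltW r0)// ler1n.
Qed.

Lemma minimal_smooth_curve : smooth_curve X c.
Proof.
have cc : continuous c by have [] := c_speed 0 1.
split => // i k; apply: is_Ck_local => t0 /= it0.
have [r [C [d [B H hd]]]] := local_chord_minimal it0.
exists [set t : R^o | `|t - t0| < d]; last exact: minimal_smooth B H k.
by rewrite /= subrr normr0; have /andP[] := cm_d H.
Qed.

Lemma minimal_geodesic : geodesic g c.
Proof.
split=> [|i t it]; first exact: minimal_smooth_curve.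
have [r [C [d [B H hd]]]] := local_chord_minimal it.
have td : `|t - t| < d by rewrite subrr normr0; have /andP[] := cm_d H.
have [w [_ e] hw] := minimal_acceleration B H td.
apply/rowP => a; rewrite !mxE -[RHS](hw a) -e; congr (_ + _).
Qed.

Lemma minimal_speed i t : dom i (c t) ->
  bilin (g i (ph i (c t))) (velocity i c t) (velocity i c t) = L ^+ 2.
Proof.
move=> it; have [r [C [d [B H hd]]]] := local_chord_minimal it.
have td : `|t - t| < d by rewrite subrr normr0; have /andP[] := cm_d H.
have Lt := derive_mnorm B H td; rewrite -{1}Lt mnorm_sq//.
by apply: metric_spd; exact: chart_img_in.
Qed.

End Geodesic.

(** * Embedded closed geodesics *)

Lemma is_Ck_cst (R : realType) (V W : normedModType R) k (A : set V) (w : W) :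
  is_Ck k A (fun=> w).
Proof.
elim: k w => [|k IH] w /=; first by move=> x _; exact: cst_continuous.
split=> [x _|v]; first exact: differentiable_cst.
suff -> : (fun x : V => 'D_v (fun=> w) x) = fun=> 0 by exact: IH.
by apply/funext => x; exact: derive_cst.
Qed.

Section Zero.
Context {R : realType} {n : nat} {M : topologicalType}.
Variable X : smooth_atlas R n M.

Definition zero_tensor : tensor2 X.
Proof.
refine (@Tensor2 R n M X (fun _ _ => 0) _ _ _) => //.
- move=> i a b k; rewrite (_ : (fun _ => _) = fun=> (0 : R^o)); first exact: is_Ck_cst.
  by apply/funext => x; rewrite mxE.
- by move=> i j x _; rewrite mulmx0 mul0mx.
Defined.

Definition zero_field : magnetic_field X.
Proof.
refine (@MagneticField R n M X zero_tensor _ _) => [i x|i x _ a b c] /=.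
  by rewrite trmx0 oppr0.
have p0 d e f : partial d (fun _ : 'rV[R]_n => (0 : 'M[R]_n) e f) x = 0.
  by rewrite /partial; exact: derive_cst.
by rewrite !p0 !addr0.
Defined.

End Zero.

(** * Embeddings of the circle *)

Section Loop.
Context {R : realType} {M : topologicalType}.

Lemma int_shift (P : R -> Prop) (T t : R) (m : int) :
  (forall s, P (s + T) <-> P s) -> (P (t + m%:~R * T) <-> P t).
Proof.
move=> PT; elim/int_rec: m => [|m IH|m IH]; first by rewrite mul0r addr0.
  have -> : t + m.+1%:Z%:~R * T = t + m%:Z%:~R * T + T.
    by rewrite -addn1 PoszD rmorphD/= mulrDl mul1r addrA.
  exact: iff_trans (PT _) IH.
have e : t + (- m%:Z)%:~R * T = t + (- m.+1%:Z)%:~R * T + T.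
  by rewrite -addn1 PoszD opprD rmorphD/= mulrDl rmorphN/= mulN1r addrA addrNK.
by apply: iff_trans IH; rewrite e; apply: iff_sym; exact: PT.
Qed.

(** The part of one period outside [O] is compact, so its image is closed. The complement of this
    image is the required open set, by injectivity modulo [T] and periodicity of [O]. *)
Lemma loop_embedding (T : R) (c : R -> M) : hausdorff_space M -> 0 < T ->
  continuous c -> (forall t, c (t + T) = c t) ->
  (forall s t, c s = c t -> exists m : int, s = t + m%:~R * T) ->
  forall O : set R, open O -> (forall t, O (t + T) <-> O t) ->
  exists2 V : set M, open V & O = c @^-1` V.
Proof.
move=> Mh T0 cc cT cinj O Oo OT.
pose K : set M := c @` (`[0, T] `&` ~` O).
exists (~` K).
  apply: closed_openC; apply: compact_closed => //; apply: continuous_compact.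
    by apply: continuous_subspaceT; exact: cc.
  apply: (@subclosed_compact _ _ `[0, T]%classic); last by move=> x [].
    apply: closedI; first exact: interval_closed.
    exact: open_closedC.
  exact: segment_compact.
apply/seteqP; split=> t /=.
  move=> Ot [s [_ nOs] /cinj[m st]]; apply: nOs; rewrite st.
  by apply/(int_shift t m OT).
move=> nK; apply: contrapT => nO; apply: nK.
pose m := Num.floor (t / T).
have tm : t + (- m)%:~R * T = t - m%:~R * T by rewrite rmorphN/= mulNr.
exists (t - m%:~R * T); last first.
  by rewrite -tm; apply/(@int_shift (fun s => c s = c t)) => // s; rewrite cT.
split; last by rewrite -tm => /(int_shift t (- m) OT).
have /andP[h1 h2] := floor_itv (t / T).
rewrite /= in_itv/= subr_ge0 -ler_pdivlMr// h1/=.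
rewrite lerBlDr -{1}[T]mul1r -mulrDl addrC -ler_pdivrMr//.
by rewrite ltW//; move: h2; rewrite rmorphD.
Qed.

End Loop.

(** The difference quotients agree as functions, so no differentiability is required. *)
Lemma velocity_shift (R : realType) n (M : topologicalType) (X : smooth_atlas R n M)
    (i : chart_index X) (c : R -> M) (T t : R) : (forall s, c (s + T) = c s) ->
  velocity i c (t + T) = velocity i c t.
Proof.
move=> cT; rewrite /velocity /derive.
set f := (X in lim (fmap X _) = _); set h := (X in _ = lim (fmap X _)).
suff -> : f = h by [].
by apply/funext => e; rewrite /f /h /= addrA !cT.
Qed.

(** * Closed geodesics of every speed *)

Section Assembly.
Context {R : realType} {n : nat} {M : topologicalType}.
Variables (X : smooth_atlas R n M) (g : riem_metric X).
Hypotheses (M_hausdorff : hausdorff_space M).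
Variables (L : R) (c : R -> M).
Hypotheses (L0 : 0 < L) (c_ess : essential g L c).
Hypothesis c_min : forall K c', essential g K c' -> L <= K.
Local Notation dom := (@chart_dom _ _ _ X).
Local Notation ph := (@chart _ _ _ X).

(** At rate [k] the loop has period [k^-1] and speed [k * L]. *)
Definition shortest (k t : R) : M := periodic c (k * t).

Section Speed.
Variable k : R.
Hypothesis k0 : 0 < k.
Let k_neq0 : k != 0. Proof. by rewrite gt_eqF. Qed.
Let kV0 : 0 < k^-1. Proof. by rewrite invr_gt0. Qed.

Lemma shortest_speed (a b : R) : speed_le g (k * L) a b (shortest k).
Proof.
have := speed_le_affine (a := a) (b := b) (m := 0) k_neq0 (ltW L0) (periodic_speed L0 c_ess _ _).
rewrite gtr0_norm//; apply: eq_speed_le => [t|t _]; last by rewrite /shortest addr0.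
apply: (@ctscomp R R M (fun t => k * t) (periodic c) t).
  exact: (ctsM (@ctsC R R k t) (@ctsid R t)).
exact: (periodic_continuous L0 c_ess).
Qed.

Lemma shortest_min (a b K : R) c' (W : set M) (pi : M -> @H1 R M) :
  a < b -> b - a < k^-1 -> 0 <= K -> speed_le g K a b c' ->
  c' a = shortest k a -> c' b = shortest k b -> potential W pi ->
  (forall t, a <= t <= b -> W (c' t) /\ W (shortest k t)) -> k * L <= K.
Proof.
move=> ab ba K0 c's ca cb hpi hW.
have e t : k^-1 * (k * t) + 0 = t by rewrite addr0 mulKf.
have e' t : k * (k^-1 * t + 0) = t by rewrite addr0 mulVKf.
rewrite -ler_pdivlMl//.
apply: (@periodic_chord_min R n M X g L c L0 c_ess c_min (k * a) (k * b) (k^-1 * K)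
  (fun t => c' (k^-1 * t + 0)) W pi) => //.
- by rewrite ltr_pM2l.
- by rewrite -mulrBr -ltr_pdivlMl// mulr1.
- by rewrite mulr_ge0// ltW.
- rewrite -{1}(gtr0_norm kV0); apply: speed_le_affine => //; first by rewrite gt_eqF.
  by rewrite !e min_l ?max_r// ltW.
- by rewrite e.
- by rewrite e.
move=> t /andP[t1 t2]; have := hW (k^-1 * t + 0); rewrite /shortest e'; apply.
by rewrite addr0 ler_pdivlMl// ler_pdivrMl// t1.
Qed.

Let kL0 : 0 < k * L. Proof. exact: mulr_gt0. Qed.

Lemma shortest_geodesic : geodesic g (shortest k).
Proof. exact: (@minimal_geodesic R n M X M_hausdorff g (k * L) k^-1 (shortest k) kL0 kV0 shortest_speed shortest_min). Qed.

Lemma shortest_norm i t : dom i (shortest k t) ->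
  bilin (g i (ph i (shortest k t))) (velocity i (shortest k) t) (velocity i (shortest k) t)
  = (k * L) ^+ 2.
Proof. exact: (@minimal_speed R n M X M_hausdorff g (k * L) k^-1 (shortest k) kL0 kV0 shortest_speed shortest_min i t). Qed.

Lemma shortestD t : shortest k (t + k^-1) = shortest k t.
Proof. by rewrite /shortest mulrDr divff// periodicD1. Qed.

Lemma shortest_embedded : embedded_loop X k^-1 (shortest k).
Proof.
have sc : smooth_curve X (shortest k) by have [] := shortest_geodesic.
have inj t t' : shortest k t = shortest k t' -> exists m : int, t = t' + m%:~R * k^-1.
  move=> /(periodic_inj L0 c_ess c_min)[m e]; exists m.
  by apply: (mulfI k_neq0); rewrite e mulrDr mulrCA divff// mulr1.
split => //.
- by split => // t; exact: shortestD.
- move=> i t /shortest_norm h; apply/eqP => v0; move: h; rewrite v0 /bilin !mul0mx mxE.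
  by move/eqP; rewrite eq_sym expf_eq0/= gt_eqF.
apply: loop_embedding => //; first by case: sc.
exact: shortestD.
Qed.

End Speed.

(** Stated for any field that vanishes on the loop, so that it covers both the zero field and its
    modifications away from the loop. *)
Lemma field_vanishing_shortest (s : magnetic_field X) :
  (forall i t, dom i (periodic c t) -> s i (ph i (periodic c t)) = 0) ->
  geodesic_type_loop g s 1 (shortest 1) /\
  forall kappa, 0 < kappa -> has_embedded_periodic_orbit g s kappa.
Proof.
move=> sv; split.
  split; [|exact: shortest_geodesic|].
    by rewrite -[X in embedded_loop _ X]invr1; exact: shortest_embedded.
  by move=> i t it v; rewrite /bilin /shortest sv// mulmx0 mul0mx mxE.
(* Energy [kappa] means speed [Num.sqrt (2 * kappa)]. *)
move=> kappa kp; pose k := Num.sqrt (2 * kappa) / L.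
have k0 : 0 < k by rewrite divr_gt0// sqrtr_gt0 mulr_gt0.
have kL : (k * L) ^+ 2 = 2 * kappa.
  by rewrite /k divfK ?gt_eqF// sqr_sqrtr// mulr_ge0// ltW.
exists k^-1, (shortest k); split; last exact: shortest_embedded.
have [sc sg] := shortest_geodesic k0.
split.
- by rewrite invr_gt0.
- by split => // i t it; rewrite sg// /lorentz /shortest sv// mulmx0 mul0mx.
- by move=> t; exact: shortestD.
- by move=> i t _; apply: velocity_shift => t'; exact: shortestD.
by move=> i t it; rewrite (shortest_norm k0 it) kL mulKf.
Qed.

End Assembly.

Theorem corollary7 (R : realType) (n : nat) (M : topologicalType)
    (X : smooth_atlas R n M)
    (hn : (2 <= n)%N)
    (M_hausdorff : hausdorff_space M)
    (M_compact : compact [set: M])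
    (M_connected : connected [set: M])
    (M_betti : first_betti R M <> 0%:E)
    (l : nat) (hl : (2 <= l)%N) :
  exists D : set (metrics_Cl X l), dense D /\
    forall g : riem_metric X, D g ->
      exists (s : magnetic_field X) (T : R) (gamma : R -> M),
        [/\ geodesic_type_loop g s T gamma,
            (forall kappa : R, 0 < kappa ->
               has_embedded_periodic_orbit g s kappa) &
            forall U : set M, open U -> range gamma `<=` U ->
              forall s' : magnetic_field X, agree_on U s s' ->
                geodesic_type g s' /\
                (forall kappa : R, 0 < kappa ->
                   has_embedded_periodic_orbit g s' kappa)].
Proof.
exists setT; split; first by move=> O O0 _; rewrite setIT.
move=> g _; have [L [c [L0 c_ess c_min]]] := exists_minimal g M_hausdorff M_compact M_betti.
have [h1 h2] := @field_vanishing_shortest R n M X g M_hausdorff L c L0 c_ess c_min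
  (zero_field X) (fun _ _ _ => erefl).
exists (zero_field X), 1, (shortest c 1); split => // U _ cU s' ss'.
have [|k1 k2] := @field_vanishing_shortest R n M X g M_hausdorff L c L0 c_ess c_min s'.
  move=> i t it; rewrite -ss'//; apply: cU; exists t => //.
  by rewrite /shortest mul1r.
by split => //; exists 1, (shortest c 1).
Qed.
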